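(* The following are equivalent over $\mathsf{RCA}_0$: (i) The infinite pigeonhole principle $\mathsf{IPP}$. (ii) The intermediate value theorem, which states that any continuous function $f\colon[0,1]\to\mathbb R$ with $f(0)\cdot f(1)<0$ admits an $x\in(0,1)$ with $f(x)=0$. (iii) The intermediate value theorem (as in (ii)) restricted to strictly increasing functions. (iv) Any continuous function $f\colon\mathbb R\to\{0,1\}$ is constant.
   Context: $\mathsf{RCA}_0$ is the usual base system of second-order arithmetic (basic arithmetic axioms, $\Sigma^0_1$-induction, $\Delta^0_1$-comprehension). ''Equivalent over $\mathsf{RCA}_0$'' means that the equivalences, formalized in second-order arithmetic, are provable in $\mathsf{RCA}_0$. Reals. A real is a Cauchy sequence $x=(x_n)_{n\in\mathbb N}$ of rationals with no rate of convergence given: for each rational $\varepsilon>0$ there is an $N\in\mathbb N$ with $|x_m-x_n|<\varepsilon$ for all $m,n\geq N$. For reals $x,y$: $x\leq y$ means that for each rational $\varepsilon>0$ there is an $N$ with $x_n\leq y_n+\varepsilon$ for all $n\geq N$; $x=y$ means $x\leq y$ and $y\leq x$; $x<y$ means $x\leq y$ but not $x=y$. Addition, multiplication and absolute value are defined pointwise; rationals are identified with constant sequences. Put $B_\delta(y)=\{z\in\mathbb R:|y-z|<\delta\}$; intervals are classes of reals. Continuous functions. A partial continuous function on $\mathbb R$ is (represented by) an arbitrary function $f\colon\mathbb Q\to\mathbb Q^{\mathbb N}$, $f(q)=(f(q)_i)_{i\in\mathbb N}$. A real $x$ lies in $\operatorname{dom}(f)$ if each $\varepsilon>0$ admits a (positive)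 $N\in\mathbb N$ such that $|f(q)_i-f(r)_j|<\varepsilon$ for all rationals $q,r\in B_{1/N}(x)$ and all $i,j\geq N$. For $x=(x_i)\in\operatorname{dom}(f)$ the value is the real $f(x)=(f(x_i)_i)_{i\in\mathbb N}$. A continuous function $f\colon D\to\mathbb R$ is such an $f$ with $D\subseteq\operatorname{dom}(f)$; $f\colon D\to E$ means in addition that $f(x)\in E$ (up to equality of reals) for all $x\in D$. $\mathsf{IPP}$ (infinite pigeonhole principle): for any $N\in\mathbb N$ and any $c\colon\mathbb N\to\{0,\ldots,N\}$ there is an $n\leq N$ such that $\{i\in\mathbb N:c(i)=n\}$ is infinite. *)

(* Defs.v *)
(* Provability in RCA_0, with second-order arithmetic deeply embedded.  Only the
   prelude and the lists of Stdlib are used. *)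
From Stdlib Require Import List.
Import ListNotations.

(** * The language of second-order arithmetic

    Two sorts, numbers and sets of numbers, each with its own de Bruijn indices.
    Equality is primitive for numbers only. *)

Inductive term : Type :=
| Var (i : nat)
| Zero
| One
| Plus (s t : term)
| Times (s t : term).

Inductive form : Type :=
| Bot
| Equal (s t : term)
| Less (s t : term)
| Mem (t : term) (X : nat)
| Imp (A B : form)
| And (A B : form)
| Or (A B : form)
| All (A : form)
| Ex (A : form)
| AllSet (A : form)
| ExSet (A : form).

Definition Not (A : form) : form := Imp A Bot.
Definition Iff (A B : form) : form := And (Imp A B) (Imp B A).

Definition scons {T : Type} (x : T) (f : nat -> T) (i : nat) : T :=
  match i with 0 => x | S i => f i end.

Fixpoint tsubst (sg : nat -> term) (t : term) : term :=
  match t with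
  | Var i => sg i
  | Zero => Zero
  | One => One
  | Plus s t => Plus (tsubst sg s) (tsubst sg t)
  | Times s t => Times (tsubst sg s) (tsubst sg t)
  end.

Definition tshift : term -> term := tsubst (fun i => Var (S i)).

Definition up (sg : nat -> term) : nat -> term :=
  scons (Var 0) (fun i => tshift (sg i)).

Definition upS (rh : nat -> nat) : nat -> nat :=
  scons 0 (fun i => S (rh i)).

(* Set variables are the only terms of the set sort, so substitution for them
   is renaming. *)
Fixpoint subst (sg : nat -> term) (rh : nat -> nat) (A : form) : form :=
  match A with
  | Bot => Bot
  | Equal s t => Equal (tsubst sg s) (tsubst sg t)
  | Less s t => Less (tsubst sg s) (tsubst sg t)
  | Mem t X => Mem (tsubst sg t) (rh X)
  | Imp A B => Imp (subst sg rh A) (subst sg rh B)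
  | And A B => And (subst sg rh A) (subst sg rh B)
  | Or A B => Or (subst sg rh A) (subst sg rh B)
  | All A => All (subst (up sg) rh A)
  | Ex A => Ex (subst (up sg) rh A)
  | AllSet A => AllSet (subst sg (upS rh) A)
  | ExSet A => ExSet (subst sg (upS rh) A)
  end.

Definition shift : form -> form := subst (fun i => Var (S i)) (fun X => X).
Definition shiftS : form -> form := subst Var S.
Definition inst (A : form) (t : term) : form :=
  subst (scons t Var) (fun X => X) A.
Definition instS (A : form) (X : nat) : form :=
  subst Var (scons X (fun Y => Y)) A.

(** * Classical natural deduction

    By [prv_ax] an axiom may be used under any context, hence also below the
    shifts of the quantifier rules: a member of [T] with free variables acts as
    its universal closure. *)

Inductive prv (T : form -> Prop) : list form -> form -> Prop :=
| prv_ax G A : T A -> prv T G A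
| prv_hyp G A : In A G -> prv T G A
| prv_raa G A : prv T (Not A :: G) Bot -> prv T G A
| prv_imp_i G A B : prv T (A :: G) B -> prv T G (Imp A B)
| prv_imp_e G A B : prv T G (Imp A B) -> prv T G A -> prv T G B
| prv_and_i G A B : prv T G A -> prv T G B -> prv T G (And A B)
| prv_and_l G A B : prv T G (And A B) -> prv T G A
| prv_and_r G A B : prv T G (And A B) -> prv T G B
| prv_or_l G A B : prv T G A -> prv T G (Or A B)
| prv_or_r G A B : prv T G B -> prv T G (Or A B)
| prv_or_e G A B C :
    prv T G (Or A B) -> prv T (A :: G) C -> prv T (B :: G) C -> prv T G C
| prv_all_i G A : prv T (map shift G) A -> prv T G (All A)
| prv_all_e G A t : prv T G (All A) -> prv T G (inst A t)
| prv_ex_i G A t : prv T G (inst A t) -> prv T G (Ex A)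
| prv_ex_e G A C :
    prv T G (Ex A) -> prv T (A :: map shift G) (shift C) -> prv T G C
| prv_alls_i G A : prv T (map shiftS G) A -> prv T G (AllSet A)
| prv_alls_e G A X : prv T G (AllSet A) -> prv T G (instS A X)
| prv_exs_i G A X : prv T G (instS A X) -> prv T G (ExSet A)
| prv_exs_e G A C :
    prv T G (ExSet A) -> prv T (A :: map shiftS G) (shiftS C) -> prv T G C
| prv_eq_refl G t : prv T G (Equal t t)
| prv_eq_subst G A s t :
    prv T G (Equal s t) -> prv T G (inst A s) -> prv T G (inst A t).

Definition provable (T : form -> Prop) (A : form) : Prop := prv T [] A.

(** * The axioms of RCA_0 *)

Inductive Delta0 : form -> Prop :=
| d0_bot : Delta0 Bot
| d0_eq s t : Delta0 (Equal s t)
| d0_lt s t : Delta0 (Less s t)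
| d0_mem t X : Delta0 (Mem t X)
| d0_imp A B : Delta0 A -> Delta0 B -> Delta0 (Imp A B)
| d0_and A B : Delta0 A -> Delta0 B -> Delta0 (And A B)
| d0_or A B : Delta0 A -> Delta0 B -> Delta0 (Or A B)
| d0_all t A : Delta0 A -> Delta0 (All (Imp (Less (Var 0) (tshift t)) A))
| d0_ex t A : Delta0 A -> Delta0 (Ex (And (Less (Var 0) (tshift t)) A)).

Inductive Sigma1 : form -> Prop :=
| sigma1 A : Delta0 A -> Sigma1 (Ex A).

Inductive Pi1 : form -> Prop :=
| pi1 A : Delta0 A -> Pi1 (All A).

(* [A] with [Var 0 + 1] for [Var 0]. *)
Definition at_succ (A : form) : form :=
  subst (scons (Plus (Var 0) One) (fun i => Var (S i))) (fun X => X) A.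

Inductive RCA0 : form -> Prop :=
| ax_succ_ne0 : RCA0 (Not (Equal (Plus (Var 0) One) Zero))
| ax_succ_inj :
    RCA0 (Imp (Equal (Plus (Var 0) One) (Plus (Var 1) One)) (Equal (Var 0) (Var 1)))
| ax_plus0 : RCA0 (Equal (Plus (Var 0) Zero) (Var 0))
| ax_plusS :
    RCA0 (Equal (Plus (Var 0) (Plus (Var 1) One)) (Plus (Plus (Var 0) (Var 1)) One))
| ax_times0 : RCA0 (Equal (Times (Var 0) Zero) Zero)
| ax_timesS :
    RCA0 (Equal (Times (Var 0) (Plus (Var 1) One))
                (Plus (Times (Var 0) (Var 1)) (Var 0)))
| ax_lt0 : RCA0 (Not (Less (Var 0) Zero))
| ax_ltS :
    RCA0 (Iff (Less (Var 0) (Plus (Var 1) One))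
              (Or (Less (Var 0) (Var 1)) (Equal (Var 0) (Var 1))))
| ax_Sigma1_induction A :
    Sigma1 A ->
    RCA0 (Imp (And (inst A Zero) (All (Imp A (at_succ A)))) (All A))
| ax_Delta1_comprehension A B :
    Sigma1 A -> Pi1 B ->
    RCA0 (Imp (All (Iff A B)) (ExSet (All (Iff (Mem (Var 0) 0) (shiftS A))))).

(** * Writing formulas with bound names

    A [fml] yields a formula once the numbers of enclosing number and set
    quantifiers are given.  A variable bound below [k] quantifiers of its sort
    has index [k' - k - 1] when used below [k'] of them. *)

Definition ntm : Type := nat -> term.
Definition stm : Type := nat -> nat.
Definition fml : Type := nat -> nat -> form.

Definition sentence (P : fml) : form := P 0 0.

Definition num0 : ntm := fun _ => Zero.
Definition num1 : ntm := fun _ => One.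
Definition nadd (s t : ntm) : ntm := fun k => Plus (s k) (t k).
Definition nmul (s t : ntm) : ntm := fun k => Times (s k) (t k).

Definition fbot : fml := fun _ _ => Bot.
Definition feq (s t : ntm) : fml := fun k _ => Equal (s k) (t k).
Definition flt (s t : ntm) : fml := fun k _ => Less (s k) (t k).
Definition fmem (t : ntm) (X : stm) : fml := fun k l => Mem (t k) (X l).
Definition fimp (P Q : fml) : fml := fun k l => Imp (P k l) (Q k l).
Definition fconj (P Q : fml) : fml := fun k l => And (P k l) (Q k l).
Definition fdisj (P Q : fml) : fml := fun k l => Or (P k l) (Q k l).
Definition fall (P : ntm -> fml) : fml :=
  fun k l => All (P (fun k' => Var (k' - k - 1)) (S k) l).
Definition fex (P : ntm -> fml) : fml :=
  fun k l => Ex (P (fun k' => Var (k' - k - 1)) (S k) l).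
Definition falls (P : stm -> fml) : fml :=
  fun k l => AllSet (P (fun l' => l' - l - 1) k (S l)).
Definition fexs (P : stm -> fml) : fml :=
  fun k l => ExSet (P (fun l' => l' - l - 1) k (S l)).

Declare Scope fml_scope.
Delimit Scope fml_scope with fml.
Bind Scope fml_scope with fml.

Notation "s ≐ t" := (feq s t) (at level 70) : fml_scope.
Notation "s ≺ t" := (flt s t) (at level 70) : fml_scope.
Notation "s ≼ t" := (fdisj (flt s t) (feq s t)) (at level 70) : fml_scope.
Notation "t ∊ X" := (fmem t X) (at level 70) : fml_scope.
Notation "P ⊓ Q" := (fconj P Q) (at level 80, right associativity) : fml_scope.
Notation "P ⊔ Q" := (fdisj P Q) (at level 85, right associativity) : fml_scope.
Notation "P ⊃ Q" := (fimp P Q) (at level 90, right associativity) : fml_scope.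
Notation "'forallN' x .. y , P" := (fall (fun x => .. (fall (fun y => P%fml)) ..))
  (at level 200, x binder, y binder, right associativity) : fml_scope.
Notation "'existsN' x .. y , P" := (fex (fun x => .. (fex (fun y => P%fml)) ..))
  (at level 200, x binder, y binder, right associativity) : fml_scope.
Notation "'forallS' x .. y , P" := (falls (fun x => .. (falls (fun y => P%fml)) ..))
  (at level 200, x binder, y binder, right associativity) : fml_scope.
Notation "'existsS' x .. y , P" := (fexs (fun x => .. (fexs (fun y => P%fml)) ..))
  (at level 200, x binder, y binder, right associativity) : fml_scope.

Local Open Scope fml_scope.

Definition fnot (P : fml) : fml := P ⊃ fbot.
Definition ftop : fml := fbot ⊃ fbot.

(** * Pairs and functions *)

(* The injective pairing [(i, j) = (i + j)^2 + i], which is a term. *)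
Definition pair (i j : ntm) : ntm := nadd (nmul (nadd i j) (nadd i j)) i.

(* [F] is a function from the class [A] to the class [B], as a set of pairs. *)
Definition is_fun (F : stm) (A B : ntm -> fml) : fml :=
  (forallN p, p ∊ F ⊃ existsN i j, p ≐ pair i j ⊓ A i ⊓ B j) ⊓
  (forallN i, A i ⊃ existsN j, pair i j ∊ F) ⊓
  (forallN i j k, pair i j ∊ F ⊓ pair i k ∊ F ⊃ j ≐ k).

Definition any_num (n : ntm) : fml := ftop.

(** * Rational numbers *)

(* [Frac a b c] stands for the fraction [(a - b) / c], where [c > 0]. *)
Record frac : Type := Frac { fpos : ntm; fneg : ntm; fden : ntm }.

Definition frac0 : frac := Frac num0 num0 num1.
Definition frac1 : frac := Frac num1 num0 num1.

Definition frac_opp (u : frac) : frac := Frac (fneg u) (fpos u) (fden u).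

Definition frac_add (u v : frac) : frac :=
  Frac (nadd (nmul (fpos u) (fden v)) (nmul (fpos v) (fden u)))
       (nadd (nmul (fneg u) (fden v)) (nmul (fneg v) (fden u)))
       (nmul (fden u) (fden v)).

Definition frac_sub (u v : frac) : frac := frac_add u (frac_opp v).

Definition frac_mul (u v : frac) : frac :=
  Frac (nadd (nmul (fpos u) (fpos v)) (nmul (fneg u) (fneg v)))
       (nadd (nmul (fpos u) (fneg v)) (nmul (fneg u) (fpos v)))
       (nmul (fden u) (fden v)).

Definition frac_eq (u v : frac) : fml :=
  nadd (nmul (fpos u) (fden v)) (nmul (fneg v) (fden u)) ≐
  nadd (nmul (fpos v) (fden u)) (nmul (fneg u) (fden v)).

Definition frac_lt (u v : frac) : fml :=
  nadd (nmul (fpos u) (fden v)) (nmul (fneg v) (fden u)) ≺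
  nadd (nmul (fpos v) (fden u)) (nmul (fneg u) (fden v)).

Definition frac_le (u v : frac) : fml := frac_lt u v ⊔ frac_eq u v.

(* [K |u|]. *)
Definition frac_abs (u : frac) (K : frac -> fml) : fml :=
  (frac_le frac0 u ⊓ K u) ⊔ (frac_lt u frac0 ⊓ K (frac_opp u)).

(* The number [((a, b), c)] codes the fraction [(a - b) / (c + 1)]. *)
Definition code (a b c : ntm) : ntm := pair (pair a b) c.

(* [K u] for the fraction [u] coded by [q]. *)
Definition with_frac (q : ntm) (K : frac -> fml) : fml :=
  existsN a b c, q ≐ code a b c ⊓ K (Frac a b (nadd c num1)).

(* A rational number is the least code of a fraction with its value, so that
   equal rationals are equal numbers. *)
Definition is_rat (q : ntm) : fml :=
  with_frac q (fun u =>
    forallN a b c, code a b c ≺ q ⊃ fnot (frac_eq (Frac a b (nadd c num1)) u)).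

(* These are least codes, with values 6 and 0. *)
Definition rat1 : ntm := code num1 num0 num0.
Definition rat0 : ntm := code num0 num0 num0.

(* For each rational [e > 0], [K e]. *)
Definition forall_eps (K : frac -> fml) : fml :=
  forallN q, is_rat q ⊃ with_frac q (fun e => frac_lt frac0 e ⊃ K e).

(** * Real numbers *)

(* Sequences of rationals in continuation-passing style: [x n K] is the formula
   [K x_n].  In [ratseq] the continuation gets the (code of the) rational, in
   [seqexp] its value as a fraction. *)
Definition ratseq : Type := ntm -> (ntm -> fml) -> fml.
Definition seqexp : Type := ntm -> (frac -> fml) -> fml.

Definition seq_of (X : stm) : ratseq :=
  fun n K => existsN q, pair n q ∊ X ⊓ K q.
Definition seq_const (q : ntm) : ratseq := fun _ K => K q.

Definition val (x : ratseq) : seqexp := fun n K => x n (fun q => with_frac q K).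
Definition rcst (u : frac) : seqexp := fun _ K => K u.
Definition rsub (x y : seqexp) : seqexp :=
  fun n K => x n (fun u => y n (fun v => K (frac_sub u v))).
Definition rmul (x y : seqexp) : seqexp :=
  fun n K => x n (fun u => y n (fun v => K (frac_mul u v))).
Definition rabs (x : seqexp) : seqexp :=
  fun n K => x n (fun u => frac_abs u K).

Definition is_cauchy (x : seqexp) : fml :=
  forall_eps (fun e => existsN N, forallN m n, N ≼ m ⊓ N ≼ n ⊃
    x m (fun u => x n (fun v => frac_abs (frac_sub u v) (fun w => frac_lt w e)))).

Definition is_real (X : stm) : fml :=
  is_fun X any_num is_rat ⊓ is_cauchy (val (seq_of X)).

Definition rle (x y : seqexp) : fml :=
  forall_eps (fun e => existsN N, forallN n, N ≼ n ⊃
    x n (fun u => y n (fun v => frac_le u (frac_add v e)))).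
Definition req (x y : seqexp) : fml := rle x y ⊓ rle y x.
Definition rlt (x y : seqexp) : fml := rle x y ⊓ fnot (req x y).

Definition real0 : seqexp := rcst frac0.
Definition real1 : seqexp := rcst frac1.

(* Membership of [z] in the open ball [B_d(y)]. *)
Definition in_ball (d y z : seqexp) : fml := rlt (rabs (rsub y z)) d.

(** * Continuous functions *)

Definition is_rat_num_pair (p : ntm) : fml :=
  existsN q i, p ≐ pair q i ⊓ is_rat q.

(* [F] represents a partial continuous function: [f : Q -> Q^N] is given as a
   function on pairs [(q, i)]. *)
Definition is_pcf (F : stm) : fml := is_fun F is_rat_num_pair is_rat.

(* [K f(q)_i]. *)
Definition at_rat (F : stm) (q i : ntm) (K : ntm -> fml) : fml :=
  existsN r, pair (pair q i) r ∊ F ⊓ K r.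

Definition in_dom (F : stm) (x : seqexp) : fml :=
  forall_eps (fun e => existsN N, num0 ≺ N ⊓
    forallN q r,
      is_rat q ⊓ is_rat r ⊓
      in_ball (rcst (Frac num1 num0 N)) x (val (seq_const q)) ⊓
      in_ball (rcst (Frac num1 num0 N)) x (val (seq_const r)) ⊃
      forallN i j, N ≼ i ⊓ N ≼ j ⊃
        at_rat F q i (fun q' => with_frac q' (fun u =>
        at_rat F r j (fun r' => with_frac r' (fun v =>
          frac_abs (frac_sub u v) (fun w => frac_lt w e)))))).

(* The value [f(x) = (f(x_i)_i)_i]. *)
Definition app (F : stm) (x : ratseq) : seqexp :=
  val (fun i K => x i (fun q => at_rat F q i K)).

Definition in_unit_closed (x : seqexp) : fml := rle real0 x ⊓ rle x real1.
Definition in_unit_open (x : seqexp) : fml := rlt real0 x ⊓ rlt x real1.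

Definition continuous_on_unit (F : stm) : fml :=
  is_pcf F ⊓
  forallS X, is_real X ⊓ in_unit_closed (val (seq_of X)) ⊃
    in_dom F (val (seq_of X)).

Definition continuous_two_valued (F : stm) : fml :=
  is_pcf F ⊓
  (forallS X, is_real X ⊃ in_dom F (val (seq_of X))) ⊓
  (forallS X, is_real X ⊃
    req (app F (seq_of X)) real0 ⊔ req (app F (seq_of X)) real1).

Definition increasing_on_unit (F : stm) : fml :=
  forallS X Y,
    is_real X ⊓ in_unit_closed (val (seq_of X)) ⊓
    is_real Y ⊓ in_unit_closed (val (seq_of Y)) ⊓
    rlt (val (seq_of X)) (val (seq_of Y)) ⊃
    rlt (app F (seq_of X)) (app F (seq_of Y)).

Definition sign_change (F : stm) : fml :=
  rlt (rmul (app F (seq_const rat0)) (app F (seq_const rat1))) real0.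

Definition has_zero (F : stm) : fml :=
  existsS X, is_real X ⊓ in_unit_open (val (seq_of X)) ⊓
    req (app F (seq_of X)) real0.

(** * The four principles *)

Definition IPP : form := sentence (
  forallN N, forallS C, is_fun C any_num (fun j => j ≼ N) ⊃
    existsN n, n ≼ N ⊓ forallN m, existsN i, m ≺ i ⊓ pair i n ∊ C).

Definition IVT : form := sentence (
  forallS F, continuous_on_unit F ⊓ sign_change F ⊃ has_zero F).

Definition IVT_increasing : form := sentence (
  forallS F, continuous_on_unit F ⊓ increasing_on_unit F ⊓ sign_change F ⊃
    has_zero F).

Definition two_valued_constant : form := sentence (
  forallS F, continuous_two_valued F ⊃
    forallS X Y, is_real X ⊓ is_real Y ⊃
      req (app F (seq_of X)) (app F (seq_of Y))).

(* Main.v *)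
(* By Gödel's completeness theorem it suffices to prove the equivalences in an
   arbitrary, possibly nonstandard, model of RCA_0.

   The pigeonhole principle gives collection for Pi^0_1 formulas.  Hence
   bisection converges when, at stage s, the undecidable sign of f(q) is replaced
   by the sign of f(q)_s: the dyadic points of level n, being bounded in number,
   reach their final signs at a common stage.  This produces a zero of f, and it
   refutes the continuity of a nonconstant function with values in {0, 1}.

   Conversely, let c be a coloring all of whose colors are finite.  Let the digits
   of L(i) list the colors in the order of their last occurrence before i.  These
   bounded numbers do not converge, and yet each number is eventually below or
   eventually above them.  So for a bound K, the function q |-> [K q > L(i)], which
   steps from 0 to 1 on [0, 1], is continuous, for lack of a real at the step; and
   q |-> q - 2 + 4 [K q > L(i)] is continuous, increasing and without zero. *)
Require Import Defs.
From Stdlib Require Import List Lia Arith Cantor.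
From Stdlib Require Import Classical ClassicalEpsilon PropExtensionality FunctionalExtensionality.
Import ListNotations.

(** * Substitution *)

(** The numbers of a model may be nonstandard, and only $\Sigma^0_1$ induction is at hand. An
    induction, a least element or a search inside the model is legitimate only once its predicate is
    known to be recursive or $\Sigma^0_1$ with parameters; hence the constant care to bound
    quantifiers or to pull them to the front. Eventual statements lie beyond this class: that each
    of a bounded number of points stabilizes does not by itself yield a common stage, and this gap
    is what collection fills.

    Reals without a rate of convergence serve both directions. The diagonal sequence of the
    bisections is Cauchy although nothing computes when a sign has settled, and a cut that no Cauchy
    sequence of the model reaches lets a continuous function jump. Behind that cut are the places of
    the list of colors at and above which nothing moves any more: they form a nonempty class without
    a least element, hence one that no recursive predicate defines.

    Calculations take place in the ordered field of fractions of the model, where linear arithmetic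
    is available. *)

Lemma tsubst_ext (sg sg' : nat -> term) (t : term) :
  (forall i, sg i = sg' i) -> tsubst sg t = tsubst sg' t.
Proof. intros H; induction t; simpl; congruence. Qed.

Lemma tsubst_comp (sg sg' : nat -> term) (t : term) :
  tsubst sg (tsubst sg' t) = tsubst (fun i => tsubst sg (sg' i)) t.
Proof. induction t; simpl; congruence. Qed.

Lemma tsubst_id (t : term) : tsubst Var t = t.
Proof. induction t; simpl; congruence. Qed.

Lemma up_ext (sg sg' : nat -> term) :
  (forall i, sg i = sg' i) -> forall i, up sg i = up sg' i.
Proof. intros H [|i]; [reflexivity | unfold up; simpl; now rewrite H]. Qed.

Lemma upS_ext (rh rh' : nat -> nat) :
  (forall i, rh i = rh' i) -> forall i, upS rh i = upS rh' i.
Proof. intros H [|i]; [reflexivity | unfold upS; simpl; now rewrite H]. Qed.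

Lemma subst_ext (A : form) (sg sg' : nat -> term) (rh rh' : nat -> nat) :
  (forall i, sg i = sg' i) -> (forall X, rh X = rh' X) ->
  subst sg rh A = subst sg' rh' A.
Proof.
  revert sg sg' rh rh'; induction A; simpl; intros sg sg' rh rh' Hs Hr;
    rewrite ?(tsubst_ext sg sg' _ Hs), ?Hr; trivial; f_equal;
    auto using up_ext, upS_ext.
Qed.

Lemma tsubst_up (sg : nat -> term) (t : term) :
  tsubst (up sg) (tshift t) = tshift (tsubst sg t).
Proof. unfold tshift; rewrite !tsubst_comp; now apply tsubst_ext. Qed.

Lemma subst_comp (A : form) (sg sg' : nat -> term) (rh rh' : nat -> nat) :
  subst sg rh (subst sg' rh' A) =
  subst (fun i => tsubst sg (sg' i)) (fun X => rh (rh' X)) A.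
Proof.
  revert sg sg' rh rh'; induction A; simpl; intros sg sg' rh rh';
    rewrite ?tsubst_comp; trivial; f_equal; auto.
  1, 2: rewrite IHA; apply subst_ext; trivial; intros [|i]; trivial;
    apply tsubst_up.
  1, 2: rewrite IHA; apply subst_ext; trivial; intros [|i]; trivial.
Qed.

Lemma subst_id (A : form) (sg : nat -> term) (rh : nat -> nat) :
  (forall i, sg i = Var i) -> (forall X, rh X = X) -> subst sg rh A = A.
Proof.
  revert sg rh; induction A; simpl; intros sg rh Hs Hr;
    rewrite ?(tsubst_ext sg Var _ Hs), ?tsubst_id, ?Hr; trivial; f_equal; auto;
    apply IHA; trivial; intros [|i]; trivial; unfold up, upS; simpl;
    now rewrite ?Hs, ?Hr.
Qed.

Ltac subst_eq :=
  unfold inst, instS, shift, shiftS; rewrite ?subst_comp;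
  try (apply subst_ext; [intros [|?] | intros [|?]]; simpl;
       rewrite ?tsubst_comp, ?tsubst_id; trivial).

Lemma subst_inst (A : form) (t : term) (sg : nat -> term) (rh : nat -> nat) :
  subst sg rh (inst A t) = inst (subst (up sg) rh A) (tsubst sg t).
Proof. subst_eq; symmetry; unfold tshift; rewrite tsubst_comp; apply tsubst_id. Qed.

Lemma subst_instS (A : form) (X : nat) (sg : nat -> term) (rh : nat -> nat) :
  subst sg rh (instS A X) = instS (subst sg (upS rh) A) (rh X).
Proof. subst_eq; symmetry; apply tsubst_id. Qed.

Lemma subst_shift (A : form) (sg : nat -> term) (rh : nat -> nat) :
  subst (up sg) rh (shift A) = shift (subst sg rh A).
Proof. subst_eq. Qed.

Lemma subst_shiftS (A : form) (sg : nat -> term) (rh : nat -> nat) :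
  subst sg (upS rh) (shiftS A) = shiftS (subst sg rh A).
Proof. subst_eq; symmetry; apply tsubst_id. Qed.

Lemma inst_up_shift (A : form) :
  inst (subst (up (fun i => Var (S i))) (fun X => X) A) (Var 0) = A.
Proof. unfold inst; rewrite subst_comp; apply subst_id; trivial; now intros [|i]. Qed.

Lemma instS_upS_shiftS (A : form) : instS (subst Var (upS S) A) 0 = A.
Proof. unfold instS; rewrite subst_comp; apply subst_id; trivial; now intros [|i]. Qed.

(* The free variables of [A] are among the first [n] number and [l] set variables. *)
Definition supported (n l : nat) (A : form) : Prop :=
  forall sg sg' rh rh',
    (forall i, i < n -> sg i = sg' i) -> (forall X, X < l -> rh X = rh' X) ->
    subst sg rh A = subst sg' rh' A.

Lemma supported_le (n n' l l' : nat) (A : form) :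
  n <= n' -> l <= l' -> supported n l A -> supported n' l' A.
Proof. intros Hn Hl H sg sg' rh rh' Hs Hr; apply H; intros; [apply Hs | apply Hr]; lia. Qed.

Lemma tsupported_ex (t : term) : exists n, forall sg sg',
  (forall i, i < n -> sg i = sg' i) -> tsubst sg t = tsubst sg' t.
Proof.
  induction t as [i| | |s [n Hn] t [m Hm]|s [n Hn] t [m Hm]].
  - exists (S i); intros sg sg' H; apply H; lia.
  - now exists 0.
  - now exists 0.
  - exists (n + m); intros sg sg' H; simpl; f_equal; [apply Hn | apply Hm]; intros; apply H; lia.
  - exists (n + m); intros sg sg' H; simpl; f_equal; [apply Hn | apply Hm]; intros; apply H; lia.
Qed.

(** Finiteness is used twice: to reduce an arbitrary substitution in an axiom to finitely many
    instantiations, and to find fresh variables for Henkin witnesses. *)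
Lemma supported_ex (A : form) : exists n l, supported n l A.
Proof.
  induction A as [|s t|s t|t X|A [n [l H]] B [m [k H']]|A [n [l H]] B [m [k H']]
    |A [n [l H]] B [m [k H']]|A [n [l H]]|A [n [l H]]|A [n [l H]]|A [n [l H]]].
  2, 3: destruct (tsupported_ex s) as [n Hn], (tsupported_ex t) as [m Hm];
    exists (n + m), 0; intros sg sg' rh rh' Hs _; simpl;
    rewrite (Hn sg sg'), (Hm sg sg'); trivial; intros; apply Hs; lia.
  3-5: exists (n + m), (l + k); intros sg sg' rh rh' Hs Hr; simpl;
    f_equal; [apply H | apply H']; intros; try apply Hs; try apply Hr; lia.
  3-6: exists n, l; intros sg sg' rh rh' Hs Hr; simpl; f_equal; apply H; auto;
    intros [|i] Hi; trivial; unfold up, upS; simpl; rewrite ?Hs, ?Hr; trivial; lia.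
  - exists 0, 0; intros ? ? ? ? _ _; reflexivity.
  - destruct (tsupported_ex t) as [n Hn].
    exists n, (S X); intros sg sg' rh rh' Hs Hr; simpl; rewrite (Hn sg sg'), Hr; auto.
Qed.

Lemma supported_list_ex (G : list form) :
  exists n l, forall A, In A G -> supported n l A.
Proof.
  induction G as [|A G [n [l H]]].
  - exists 0, 0; intros A [].
  - destruct (supported_ex A) as [m [k H']]; exists (n + m), (l + k).
    intros B [<-|HB]; [eapply supported_le; [| |exact H'] | eapply supported_le;
      [| |exact (H B HB)]]; lia.
Qed.

(** * Derived rules *)

Lemma prv_weak (T : form -> Prop) (G G' : list form) (A : form) :
  prv T G A -> incl G G' -> prv T G' A.
Proof.
  assert (Hc : forall (B : form) (L L' : list form), incl L L' -> incl (B :: L) (B :: L'))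
    by (intros B L L' H C [<-|HC]; simpl; auto).
  assert (Hm : forall (f : form -> form) (L L' : list form),
    incl L L' -> incl (map f L) (map f L')) by (intros; now apply incl_map).
  intros H; revert G'; induction H; intros G' HG.
  - now apply prv_ax.
  - apply prv_hyp; auto.
  - apply prv_raa; auto.
  - apply prv_imp_i; auto.
  - eapply prv_imp_e; eauto.
  - apply prv_and_i; auto.
  - eapply prv_and_l; eauto.
  - eapply prv_and_r; eauto.
  - apply prv_or_l; auto.
  - apply prv_or_r; auto.
  - eapply prv_or_e; eauto.
  - apply prv_all_i; auto.
  - apply prv_all_e; auto.
  - eapply prv_ex_i; eauto.
  - eapply prv_ex_e; eauto.
  - apply prv_alls_i; auto.
  - apply prv_alls_e; auto.
  - eapply prv_exs_i; eauto.
  - eapply prv_exs_e; eauto.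
  - apply prv_eq_refl.
  - eapply prv_eq_subst; eauto.
Qed.

(** One variable at a time is generalized and instantiated. Generalizing is legitimate because [A]
    is derivable in every context. *)
Lemma prv_subst_num (T : form -> Prop) (n : nat) (A : form) (sg : nat -> term) :
  (forall i, sg (n + i) = Var i) -> (forall G, prv T G A) ->
  forall G, prv T G (subst sg (fun X => X) A).
Proof.
  revert A sg; induction n as [|n IH]; intros A sg Hs H G.
  - rewrite subst_id; auto.
  (* The variables of [sg 0] are raised by [n] because the [n] instantiations still to come lower
     them again. *)
  - set (s := tsubst (fun i => Var (n + i)) (sg 0)).
    assert (E : subst sg (fun X => X) A =
                subst (fun i => sg (S i)) (fun X => X) (inst A s)).
    { unfold inst; rewrite subst_comp; apply subst_ext; trivial.
      intros [|i]; trivial; simpl; unfold s; rewrite tsubst_comp.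
      rewrite (tsubst_ext _ Var); [symmetry; apply tsubst_id | intros i; apply (Hs i)]. }
    rewrite E; apply IH; [exact Hs|].
    intros G'; apply prv_all_e, prv_all_i, H.
Qed.

Lemma prv_subst_set (T : form -> Prop) (n : nat) (A : form) (rh : nat -> nat) :
  (forall i, rh (n + i) = i) -> (forall G, prv T G A) ->
  forall G, prv T G (subst Var rh A).
Proof.
  revert A rh; induction n as [|n IH]; intros A rh Hs H G.
  - rewrite subst_id; auto.
  - assert (E : subst Var rh A = subst Var (fun i => rh (S i)) (instS A (n + rh 0))).
    { unfold instS; rewrite subst_comp; apply subst_ext; trivial.
      intros [|i]; trivial; simpl; symmetry; apply (Hs (rh 0)). }
    rewrite E; apply IH; [exact Hs|].
    intros G'; apply prv_alls_e, prv_alls_i, H.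
Qed.

(* An axiom with free variables acts as its universal closure. *)
Lemma prv_ax_subst (T : form -> Prop) (G : list form) (A : form)
    (sg : nat -> term) (rh : nat -> nat) :
  T A -> prv T G (subst sg rh A).
Proof.
  intros HA; destruct (supported_ex A) as [n [l H]].
  (* Beyond the free variables of [A] the substitution is replaced by a shift, so that finitely many
     instantiations produce it. *)
  set (sg' := fun i => if i <? n then sg i else Var (i - n)).
  set (rh' := fun X => if X <? l then rh X else X - l).
  assert (E : subst sg rh A = subst sg' (fun X => X) (subst Var rh' A)).
  { rewrite subst_comp; simpl; apply H; unfold sg', rh'.
    - intros i Hi; apply Nat.ltb_lt in Hi; now rewrite Hi.
    - intros X HX; apply Nat.ltb_lt in HX; now rewrite HX. }
  rewrite E; apply (prv_subst_num T n); unfold sg', rh'.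
  - intros i; replace (n + i <? n) with false by (symmetry; apply Nat.ltb_ge; lia).
    f_equal; lia.
  - apply (prv_subst_set T l).
    + intros i; replace (l + i <? l) with false by (symmetry; apply Nat.ltb_ge; lia); lia.
    + intros G'; now apply prv_ax.
Qed.

(** Substituting in whole derivations will turn a fresh variable into the eigenvariable of an
    elimination rule. *)
Lemma prv_subst (T : form -> Prop) (G : list form) (A : form) :
  prv T G A -> forall sg rh, prv T (map (subst sg rh) G) (subst sg rh A).
Proof.
  assert (Hshift : forall sg rh L, map (subst (up sg) rh) (map shift L) =
                                   map shift (map (subst sg rh) L))
    by (intros; rewrite !map_map; apply map_ext; intros; apply subst_shift).
  assert (HshiftS : forall sg rh L, map (subst sg (upS rh)) (map shiftS L) =
                                   map shiftS (map (subst sg rh) L))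
    by (intros; rewrite !map_map; apply map_ext; intros; apply subst_shiftS).
  intros H; induction H; intros sg rh; simpl in *.
  - now apply prv_ax_subst.
  - apply prv_hyp; now apply in_map.
  - apply prv_raa; apply IHprv.
  - apply prv_imp_i; apply IHprv.
  - eapply prv_imp_e; eauto.
  - apply prv_and_i; auto.
  - eapply prv_and_l; eauto.
  - eapply prv_and_r; eauto.
  - apply prv_or_l; auto.
  - apply prv_or_r; auto.
  - eapply prv_or_e; eauto.
  - apply prv_all_i; rewrite <- Hshift; apply IHprv.
  - rewrite subst_inst; apply prv_all_e; apply IHprv.
  - eapply prv_ex_i; rewrite <- subst_inst; apply IHprv.
  - eapply prv_ex_e; [apply IHprv1|].
    rewrite <- Hshift, <- subst_shift; apply IHprv2.
  - apply prv_alls_i; rewrite <- HshiftS; apply IHprv.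
  - rewrite subst_instS; apply prv_alls_e; apply IHprv.
  - eapply prv_exs_i; rewrite <- subst_instS; apply IHprv.
  - eapply prv_exs_e; [apply IHprv1|].
    rewrite <- HshiftS, <- subst_shiftS; apply IHprv2.
  - apply prv_eq_refl.
  - rewrite subst_inst; eapply prv_eq_subst; [apply IHprv1|].
    rewrite <- subst_inst; apply IHprv2.
Qed.

(** * Semantics and completeness *)

Record structure : Type := Structure {
  num : Type;
  sets : Type;
  num_zero : num;
  num_one : num;
  num_add : num -> num -> num;
  num_mul : num -> num -> num;
  num_lt : num -> num -> Prop;
  num_mem : num -> sets -> Prop }.

Section Semantics.

Variable m : structure.

Fixpoint eval (e : nat -> num m) (t : term) : num m :=
  match t with
  | Var i => e i
  | Zero => num_zero m
  | One => num_one m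
  | Plus s t => num_add m (eval e s) (eval e t)
  | Times s t => num_mul m (eval e s) (eval e t)
  end.

Fixpoint sat (e : nat -> num m) (E : nat -> sets m) (A : form) : Prop :=
  match A with
  | Bot => False
  | Equal s t => eval e s = eval e t
  | Less s t => num_lt m (eval e s) (eval e t)
  | Mem t X => num_mem m (eval e t) (E X)
  | Imp A B => sat e E A -> sat e E B
  | And A B => sat e E A /\ sat e E B
  | Or A B => sat e E A \/ sat e E B
  | All A => forall a, sat (scons a e) E A
  | Ex A => exists a, sat (scons a e) E A
  | AllSet A => forall X, sat e (scons X E) A
  | ExSet A => exists X, sat e (scons X E) A
  end.

Definition satisfies (T : form -> Prop) : Prop := forall A, T A -> forall e E, sat e E A.

Lemma eval_ext (e e' : nat -> num m) (t : term) :
  (forall i, e i = e' i) -> eval e t = eval e' t.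
Proof. intros H; induction t; simpl; congruence. Qed.

Lemma eval_tsubst (e : nat -> num m) (sg : nat -> term) (t : term) :
  eval e (tsubst sg t) = eval (fun i => eval e (sg i)) t.
Proof. induction t; simpl; congruence. Qed.

Lemma eval_tshift (a : num m) (e : nat -> num m) (t : term) :
  eval (scons a e) (tshift t) = eval e t.
Proof. unfold tshift; now rewrite eval_tsubst. Qed.

Lemma sat_ext (A : form) (e e' : nat -> num m) (E E' : nat -> sets m) :
  (forall i, e i = e' i) -> (forall i, E i = E' i) -> sat e E A <-> sat e' E' A.
Proof.
  intros He HE; apply functional_extensionality in He, HE; subst; reflexivity.
Qed.

Lemma sat_subst (A : form) (e : nat -> num m) (E : nat -> sets m) sg rh :
  sat e E (subst sg rh A) <->
  sat (fun i => eval e (sg i)) (fun X => E (rh X)) A.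
Proof.
  revert e E sg rh; induction A; simpl; intros e E sg rh; rewrite ?eval_tsubst;
    rewrite ?IHA1, ?IHA2; try reflexivity.
  - split; intros H a; specialize (H a); [rewrite IHA in H | rewrite IHA];
      eapply sat_ext; [| |exact H| | |exact H]; trivial; intros [|i]; simpl;
      trivial; unfold up; simpl; now rewrite eval_tshift.
  - split; intros [a H]; exists a; [rewrite IHA in H | rewrite IHA];
      eapply sat_ext; [| |exact H| | |exact H]; trivial; intros [|i]; simpl;
      trivial; unfold up; simpl; now rewrite eval_tshift.
  - split; intros H X; specialize (H X); [rewrite IHA in H | rewrite IHA];
      eapply sat_ext; [| |exact H| | |exact H]; trivial; intros [|i]; simpl; trivial.
  - split; intros [X H]; exists X; [rewrite IHA in H | rewrite IHA];
      eapply sat_ext; [| |exact H| | |exact H]; trivial; intros [|i]; simpl; trivial.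
Qed.

End Semantics.

(** * An enumeration of the formulas *)

Fixpoint term_code (t : term) : nat :=
  match t with
  | Var i => to_nat (0, i)
  | Zero => to_nat (1, 0)
  | One => to_nat (2, 0)
  | Plus s t => to_nat (3, to_nat (term_code s, term_code t))
  | Times s t => to_nat (4, to_nat (term_code s, term_code t))
  end.

Fixpoint form_code (A : form) : nat :=
  match A with
  | Bot => to_nat (0, 0)
  | Equal s t => to_nat (1, to_nat (term_code s, term_code t))
  | Less s t => to_nat (2, to_nat (term_code s, term_code t))
  | Mem t X => to_nat (3, to_nat (term_code t, X))
  | Imp A B => to_nat (4, to_nat (form_code A, form_code B))
  | And A B => to_nat (5, to_nat (form_code A, form_code B))
  | Or A B => to_nat (6, to_nat (form_code A, form_code B))
  | All A => to_nat (7, form_code A)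
  | Ex A => to_nat (8, form_code A)
  | AllSet A => to_nat (9, form_code A)
  | ExSet A => to_nat (10, form_code A)
  end.

Lemma to_nat_inj p q : to_nat p = to_nat q -> p = q.
Proof. intros H; rewrite <- (cancel_of_to p), H; apply cancel_of_to. Qed.

Ltac code_inj :=
  repeat match goal with
  | H : to_nat _ = to_nat _ |- _ =>
      apply to_nat_inj, pair_equal_spec in H; destruct H; try discriminate; subst
  end.

Lemma term_code_inj s t : term_code s = term_code t -> s = t.
Proof.
  revert t; induction s; intros []; cbn -[to_nat]; intros; code_inj; f_equal; auto.
Qed.

Lemma form_code_inj A B : form_code A = form_code B -> A = B.
Proof.
  revert B; induction A; intros []; cbn -[to_nat]; intros; code_inj; f_equal;
    auto using term_code_inj.
Qed.

Definition form_enum (n : nat) : form :=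
  epsilon (inhabits Bot) (fun A => form_code A = n).

Lemma form_enum_code A : form_enum (form_code A) = A.
Proof. apply form_code_inj, (epsilon_spec (inhabits Bot) (fun B => form_code B = form_code A)); eauto. Qed.

(** * Henkin's completeness theorem *)

Section Completeness.

Variable T : form -> Prop.

Definition consistent (G : list form) : Prop := ~ prv T G Bot.

Lemma prv_bot G A : prv T G Bot -> prv T G A.
Proof. intros H; apply prv_raa; eapply prv_weak; [exact H | firstorder]. Qed.

Lemma prv_hyp0 G A : prv T (A :: G) A.
Proof. apply prv_hyp; now left. Qed.

Lemma prv_contra G A : prv T G A -> prv T G (Not A) -> prv T G Bot.
Proof. intros H H'; eapply prv_imp_e; eauto. Qed.

Lemma consistent_cons_or G A :
  consistent G -> consistent (A :: G) \/ prv T G (Not A).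
Proof.
  intros _; destruct (classic (prv T (A :: G) Bot)) as [H|H]; [right | now left].
  now apply prv_imp_i.
Qed.

(** A variable [Var n] beyond all free ones acts as the Henkin constant. If the instance were
    refutable, sending [Var n] to the bound variable 0 and shifting all others would give the second
    premise of existential elimination, hence a refutation of [G]. *)
Lemma fresh_num_witness G A :
  In (Ex A) G -> consistent G -> exists t, consistent (inst A t :: G).
Proof.
  intros HA HG; destruct (supported_list_ex (A :: G)) as [n [l H]].
  exists (Var n); intros Hp; apply HG.
  apply prv_ex_e with A; [now apply prv_hyp|].
  apply prv_subst with
    (sg := fun i => if i =? n then Var 0 else Var (S i)) (rh := fun X => X) in Hp.
  simpl in Hp; eapply prv_weak; [exact Hp|].
  intros B [<-|HB].
  - left; unfold inst; rewrite subst_comp.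
    transitivity (subst Var (fun X => X) A); [symmetry; now apply subst_id|].
    apply (H A (or_introl eq_refl)); trivial.
    intros [|i] Hi; simpl; [now rewrite Nat.eqb_refl|].
    replace (i =? n) with false by (symmetry; apply Nat.eqb_neq; lia); trivial.
  - right; apply in_map_iff in HB as [C [<- HC]]; apply in_map_iff; exists C.
    split; trivial; apply (H C (or_intror HC)); trivial.
    intros i Hi; replace (i =? n) with false by (symmetry; apply Nat.eqb_neq; lia); trivial.
Qed.

Lemma fresh_set_witness G A :
  In (ExSet A) G -> consistent G -> exists X, consistent (instS A X :: G).
Proof.
  intros HA HG; destruct (supported_list_ex (A :: G)) as [n [l H]].
  exists l; intros Hp; apply HG.
  apply prv_exs_e with A; [now apply prv_hyp|].
  apply prv_subst with
    (sg := Var) (rh := fun X => if X =? l then 0 else S X) in Hp.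
  simpl in Hp; eapply prv_weak; [exact Hp|].
  intros B [<-|HB].
  - left; unfold instS; rewrite subst_comp.
    transitivity (subst Var (fun X => X) A); [symmetry; now apply subst_id|].
    apply (H A (or_introl eq_refl)); trivial.
    intros [|i] Hi; simpl; [now rewrite Nat.eqb_refl|].
    replace (i =? l) with false by (symmetry; apply Nat.eqb_neq; lia); trivial.
  - right; apply in_map_iff in HB as [C [<- HC]]; apply in_map_iff; exists C.
    split; trivial; apply (H C (or_intror HC)); trivial.
    intros i Hi; replace (i =? l) with false by (symmetry; apply Nat.eqb_neq; lia); trivial.
Qed.

Lemma henkin_step G A : consistent G -> exists G',
  consistent G' /\ incl G G' /\ (In A G' \/ prv T G' (Not A)) /\
  (forall B, A = Ex B -> In A G' -> exists t, In (inst B t) G') /\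
  (forall B, A = ExSet B -> In A G' -> exists X, In (instS B X) G').
Proof.
  intros HG; destruct (consistent_cons_or G A HG) as [HA|HA].
  - destruct A as [|s t|s t|t X|A B|A B|A B|A|A|A|A];
      try (eexists; split; [exact HA | split; [firstorder | split;
        [left; now left | split; discriminate]]]).
    + destruct (fresh_num_witness (Ex A :: G) A (or_introl eq_refl) HA) as [t Ht].
      eexists; split; [exact Ht | split; [firstorder | split;
        [left; right; now left | split; [|discriminate]]]].
      intros B [= <-] _; exists t; now left.
    + destruct (fresh_set_witness (ExSet A :: G) A (or_introl eq_refl) HA) as [X HX].
      eexists; split; [exact HX | split; [firstorder | split;
        [left; right; now left | split; [discriminate|]]]].
      intros B [= <-] _; exists X; now left.
  - exists G; split; [exact HG | split; [firstorder | split; [now right | split]]];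
      intros B -> HB; destruct HG; apply prv_contra with (2 := HA); now apply prv_hyp.
Qed.

Section Henkin.

Variable G0 : list form.
Hypothesis G0_consistent : consistent G0.

Definition henkin_next (n : nat) (G : {G | consistent G}) : {G | consistent G}.
Proof.
  destruct (constructive_indefinite_description _
    (henkin_step (proj1_sig G) (form_enum n) (proj2_sig G))) as [G' HG'].
  exists G'; now destruct HG'.
Defined.

Fixpoint henkin_chain (n : nat) : {G | consistent G} :=
  match n with
  | 0 => exist _ G0 G0_consistent
  | S n => henkin_next n (henkin_chain n)
  end.

Definition chain (n : nat) : list form := proj1_sig (henkin_chain n).

Lemma chain_consistent n : consistent (chain n).
Proof. exact (proj2_sig (henkin_chain n)). Qed.

Lemma chain_step n (A := form_enum n) :
  incl (chain n) (chain (S n)) /\ (In A (chain (S n)) \/ prv T (chain (S n)) (Not A)) /\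
  (forall B, A = Ex B -> In A (chain (S n)) -> exists t, In (inst B t) (chain (S n))) /\
  (forall B, A = ExSet B -> In A (chain (S n)) -> exists X, In (instS B X) (chain (S n))).
Proof.
  unfold chain; simpl; unfold henkin_next.
  destruct constructive_indefinite_description as [G' HG']; simpl.
  now destruct HG'.
Qed.

Lemma chain_incl n k : n <= k -> incl (chain n) (chain k).
Proof.
  induction 1; [firstorder|]; eapply incl_tran; [eassumption | apply chain_step].
Qed.

(** The consequences of the whole chain form a complete theory with witnesses. The lemmas below show
    that membership in it commutes with connectives and quantifiers as truth does. *)
Definition th (A : form) : Prop := exists n, prv T (chain n) A.

Lemma th_weak n A : prv T (chain n) A -> forall k, n <= k -> prv T (chain k) A.
Proof. intros H k Hk; eapply prv_weak; [exact H | now apply chain_incl]. Qed.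

Lemma th_rule1 A B : (forall G, prv T G A -> prv T G B) -> th A -> th B.
Proof. intros H [n Hn]; exists n; auto. Qed.

Lemma th_rule2 A B C :
  (forall G, prv T G A -> prv T G B -> prv T G C) -> th A -> th B -> th C.
Proof.
  intros H [n Hn] [k Hk]; exists (n + k).
  apply H; [apply th_weak with n | apply th_weak with k]; trivial; lia.
Qed.

Lemma th_bot : ~ th Bot.
Proof. intros [n Hn]; now apply (chain_consistent n). Qed.

Lemma th_or_not A : th A \/ th (Not A).
Proof.
  destruct (chain_step (form_code A)) as [_ [H _]]; rewrite form_enum_code in H.
  destruct H as [H|H]; [left | right]; eexists; [apply prv_hyp|]; exact H.
Qed.

Lemma th_not A : th (Not A) <-> ~ th A.
Proof.
  split; [|destruct (th_or_not A); tauto].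
  intros H H'; apply th_bot; revert H' H; apply th_rule2; intros; now apply prv_contra with A.
Qed.

Lemma th_imp A B : th (Imp A B) <-> (th A -> th B).
Proof.
  split.
  - apply th_rule2; intros; eapply prv_imp_e; eauto.
  - intros H; destruct (th_or_not A) as [HA|HA].
    + apply H in HA; revert HA; apply th_rule1; intros G HG.
      apply prv_imp_i; eapply prv_weak; [exact HG | firstorder].
    + revert HA; apply th_rule1; intros G HG; apply prv_imp_i, prv_bot.
      apply prv_contra with A; [apply prv_hyp0 | eapply prv_weak; [exact HG | firstorder]].
Qed.

Lemma th_and A B : th (And A B) <-> th A /\ th B.
Proof.
  split.
  - intros H; split; revert H; apply th_rule1; intros; [eapply prv_and_l | eapply prv_and_r]; eauto.
  - intros [HA HB]; revert HA HB; apply th_rule2; intros; now apply prv_and_i.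
Qed.

Lemma th_or A B : th (Or A B) <-> th A \/ th B.
Proof.
  split.
  - intros H; apply NNPP; intros HN; apply not_or_and in HN as [HA HB].
    rewrite <- th_not in HA, HB; apply th_bot.
    apply (th_rule2 (And (Not A) (Not B)) (Or A B)); trivial; [|now apply th_and].
    intros G H1 H2; eapply prv_or_e; [exact H2 | |]; eapply prv_contra;
      try apply prv_hyp0.
    + eapply prv_and_l, prv_weak; [exact H1 | firstorder].
    + eapply prv_and_r, prv_weak; [exact H1 | firstorder].
  - intros [H|H]; revert H; apply th_rule1; intros; [now apply prv_or_l | now apply prv_or_r].
Qed.

Lemma th_in n A : th A -> ~ prv T (chain (S n)) (Not A).
Proof.
  intros HA HN; apply th_not in HA; trivial; now exists (S n).
Qed.

Lemma th_ex A : th (Ex A) <-> exists t, th (inst A t).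
Proof.
  split.
  - intros H; destruct (chain_step (form_code (Ex A))) as [_ [H1 [H2 _]]].
    rewrite form_enum_code in H1, H2.
    destruct H1 as [H1|H1]; [|destruct (th_in _ _ H H1)].
    destruct (H2 _ eq_refl H1) as [t Ht]; exists t; eexists; apply prv_hyp, Ht.
  - intros [t H]; revert H; apply th_rule1; intros; eapply prv_ex_i; eauto.
Qed.

Lemma th_exs A : th (ExSet A) <-> exists X, th (instS A X).
Proof.
  split.
  - intros H; destruct (chain_step (form_code (ExSet A))) as [_ [H1 [_ H2]]].
    rewrite form_enum_code in H1, H2.
    destruct H1 as [H1|H1]; [|destruct (th_in _ _ H H1)].
    destruct (H2 _ eq_refl H1) as [t Ht]; exists t; eexists; apply prv_hyp, Ht.
  - intros [t H]; revert H; apply th_rule1; intros; eapply prv_exs_i; eauto.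
Qed.

Lemma prv_not_all G A : prv T G (Not (All A)) -> prv T G (Ex (Not A)).
Proof.
  intros H; apply prv_raa; eapply prv_contra;
    [|eapply prv_weak; [exact H | firstorder]].
  apply prv_all_i, prv_raa; eapply prv_contra;
    [|apply prv_hyp; right; simpl; left; reflexivity].
  apply prv_ex_i with (Var 0); simpl.
  change (prv T (Not A :: map shift (Not (Ex (Not A)) :: G))
    (Not (inst (subst (up (fun i => Var (S i))) (fun X => X) A) (Var 0)))).
  rewrite inst_up_shift; apply prv_hyp0.
Qed.

Lemma prv_not_alls G A : prv T G (Not (AllSet A)) -> prv T G (ExSet (Not A)).
Proof.
  intros H; apply prv_raa; eapply prv_contra;
    [|eapply prv_weak; [exact H | firstorder]].
  apply prv_alls_i, prv_raa; eapply prv_contra;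
    [|apply prv_hyp; right; simpl; left; reflexivity].
  apply prv_exs_i with 0; simpl.
  change (prv T (Not A :: map shiftS (Not (ExSet (Not A)) :: G))
    (Not (instS (subst Var (upS S) A) 0))).
  rewrite instS_upS_shiftS; apply prv_hyp0.
Qed.

Lemma th_all A : th (All A) <-> forall t, th (inst A t).
Proof.
  split.
  - intros H t; revert H; apply th_rule1; intros; now apply prv_all_e.
  - intros H; destruct (th_or_not (All A)) as [|HN]; trivial.
    apply th_rule1 with (1 := fun G => prv_not_all G A), th_ex in HN as [t Ht].
    destruct (proj1 (th_not (inst A t)) Ht (H t)).
Qed.

Lemma th_alls A : th (AllSet A) <-> forall X, th (instS A X).
Proof.
  split.
  - intros H t; revert H; apply th_rule1; intros; now apply prv_alls_e.
  - intros H; destruct (th_or_not (AllSet A)) as [|HN]; trivial.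
    apply th_rule1 with (1 := fun G => prv_not_alls G A), th_exs in HN as [t Ht].
    destruct (proj1 (th_not (instS A t)) Ht (H t)).
Qed.

Lemma th_refl t : th (Equal t t).
Proof. exists 0; apply prv_eq_refl. Qed.

Lemma th_eq_subst A s t : th (Equal s t) -> th (inst A s) -> th (inst A t).
Proof. apply th_rule2; intros; eapply prv_eq_subst; eauto. Qed.

Lemma th_rewrite (A : term -> form) (A' : form) s t :
  (forall r, inst A' r = A r) -> th (Equal s t) -> th (A s) -> th (A t).
Proof. intros E; rewrite <- !E; apply th_eq_subst. Qed.

Lemma tsubst_scons_shift s t : tsubst (scons s Var) (tshift t) = t.
Proof. unfold tshift; rewrite tsubst_comp; apply tsubst_id. Qed.

Lemma th_sym s t : th (Equal s t) -> th (Equal t s).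
Proof.
  intros H; generalize (th_refl s); revert H; apply (th_rewrite (fun r => Equal r s) (Equal (Var 0) (tshift s))).
  intros; unfold inst; simpl; now rewrite tsubst_scons_shift.
Qed.

Lemma th_trans r s t : th (Equal r s) -> th (Equal s t) -> th (Equal r t).
Proof.
  intros H H'; revert H' H; apply (th_rewrite (fun u => Equal r u) (Equal (tshift r) (Var 0))).
  intros; unfold inst; simpl; now rewrite tsubst_scons_shift.
Qed.

Lemma th_cong2 (f : term -> term -> form) r r' s s' :
  (forall t, exists A', forall u, inst A' u = f u t) ->
  (forall t, exists A', forall u, inst A' u = f t u) ->
  th (Equal r r') -> th (Equal s s') -> th (f r s) -> th (f r' s').
Proof.
  intros H1 H2 Hr Hs H; destruct (H1 s) as [A1 E1], (H2 r') as [A2 E2].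
  apply (th_rewrite (f r') A2 s s' E2 Hs).
  now apply (th_rewrite (fun u => f u s) A1 r r' E1 Hr).
Qed.

(** [sat] reads [Equal] as equality in the carrier, so terms must be divided by provable equality.
    Provably equal terms define the same predicate, so the same representative is chosen for them,
    and the quotient becomes a subtype of the terms. *)
Definition term_rep (t : term) : term :=
  epsilon (inhabits Zero) (fun s => th (Equal s t)).

Lemma th_term_rep t : th (Equal (term_rep t) t).
Proof. apply (epsilon_spec (inhabits Zero) (fun s => th (Equal s t))); exists t; apply th_refl. Qed.

Lemma term_rep_eq s t : th (Equal s t) <-> term_rep s = term_rep t.
Proof.
  split.
  - intros H; unfold term_rep; f_equal; apply functional_extensionality; intros r.
    apply propositional_extensionality; split; intros Hr; eapply th_trans; eauto using th_sym.
  - intros H; eapply th_trans; [apply th_sym, th_term_rep | rewrite H; apply th_term_rep].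
Qed.

Lemma term_rep_idem t : term_rep (term_rep t) = term_rep t.
Proof. apply term_rep_eq, th_term_rep. Qed.

Definition cls (t : term) : {t | term_rep t = t} := exist _ (term_rep t) (term_rep_idem t).

Lemma cls_eq s t : cls s = cls t <-> th (Equal s t).
Proof.
  rewrite term_rep_eq; split; [now intros [=]|].
  intros H; apply eq_sig_hprop; [intros; apply proof_irrelevance | exact H].
Qed.

Lemma cls_surj (c : {t | term_rep t = t}) : c = cls (proj1_sig c).
Proof. apply eq_sig_hprop; [intros; apply proof_irrelevance | symmetry; apply (proj2_sig c)]. Qed.

Definition term_model : structure := {|
  num := {t | term_rep t = t};
  sets := nat;
  num_zero := cls Zero;
  num_one := cls One;
  num_add a b := cls (Plus (proj1_sig a) (proj1_sig b));
  num_mul a b := cls (Times (proj1_sig a) (proj1_sig b));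
  num_lt a b := th (Less (proj1_sig a) (proj1_sig b));
  num_mem a X := th (Mem (proj1_sig a) X) |}.

Lemma eval_term_model sg t :
  eval term_model (fun i => cls (sg i)) t = cls (tsubst sg t).
Proof.
  induction t as [i| | |s IHs t IHt|s IHs t IHt]; trivial; simpl; rewrite IHs, IHt; apply cls_eq.
  - apply (th_cong2 (fun u v => Equal (Plus u v) (Plus (tsubst sg s) (tsubst sg t)))
        (tsubst sg s) _ (tsubst sg t)); try (apply th_sym, th_term_rep); try apply th_refl; intros r.
    + exists (Equal (Plus (Var 0) (tshift r)) (tshift (Plus (tsubst sg s) (tsubst sg t)))).
      intros u; unfold inst; simpl; now rewrite !tsubst_scons_shift.
    + exists (Equal (Plus (tshift r) (Var 0)) (tshift (Plus (tsubst sg s) (tsubst sg t)))).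
      intros u; unfold inst; simpl; now rewrite !tsubst_scons_shift.
  - apply (th_cong2 (fun u v => Equal (Times u v) (Times (tsubst sg s) (tsubst sg t)))
        (tsubst sg s) _ (tsubst sg t)); try (apply th_sym, th_term_rep); try apply th_refl; intros r.
    + exists (Equal (Times (Var 0) (tshift r)) (tshift (Times (tsubst sg s) (tsubst sg t)))).
      intros u; unfold inst; simpl; now rewrite !tsubst_scons_shift.
    + exists (Equal (Times (tshift r) (Var 0)) (tshift (Times (tsubst sg s) (tsubst sg t)))).
      intros u; unfold inst; simpl; now rewrite !tsubst_scons_shift.
Qed.

Lemma scons_cls t sg i :
  scons (cls t) (fun j => cls (sg j)) i = cls (scons t sg i).
Proof. now destruct i. Qed.

(** The truth lemma. Every number of the term model is the class of a term and its sets are the set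
    variables, so quantifiers over the model are quantifiers over syntactic instances. *)
Lemma sat_term_model A sg rh :
  sat term_model (fun i => cls (sg i)) rh A <-> th (subst sg rh A).
Proof.
  revert sg rh; induction A as [|s t|s t|t X|A IHA B IHB|A IHA B IHB|A IHA B IHB
      |A IH|A IH|A IH|A IH]; intros sg rh; simpl; rewrite ?eval_term_model.
  8, 9: assert (K : forall t, sat term_model (scons (cls t) (fun i => cls (sg i))) rh A <->
      th (inst (subst (up sg) rh A) t)) by
      (intros t; rewrite (sat_ext term_model A _ _ rh rh (scons_cls t sg)) by reflexivity;
       rewrite IH; unfold inst; rewrite subst_comp;
       erewrite subst_ext; [reflexivity | | reflexivity];
       intros [|i]; trivial; symmetry; apply tsubst_scons_shift).
  10, 11: assert (K : forall X, sat term_model (fun i => cls (sg i)) (scons X rh) A <->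
      th (instS (subst sg (upS rh) A) X)) by
      (intros X; rewrite IH; unfold instS; rewrite subst_comp;
       erewrite subst_ext; [reflexivity | |]; [intros; symmetry; apply tsubst_id | now intros [|i]]).
  - split; [easy | apply th_bot].
  - apply cls_eq.
  - simpl; split; apply (th_cong2 Less); try (apply th_term_rep);
      try (apply th_sym, th_term_rep); intros r;
      solve [exists (Less (Var 0) (tshift r)); intros u; unfold inst; simpl; now rewrite tsubst_scons_shift
           | exists (Less (tshift r) (Var 0)); intros u; unfold inst; simpl; now rewrite tsubst_scons_shift].
  - simpl; split; apply (th_rewrite (fun r => Mem r (rh X)) (Mem (Var 0) (rh X)));
      trivial; [apply th_term_rep | apply th_sym, th_term_rep].
  - now rewrite IHA, IHB, th_imp.
  - now rewrite IHA, IHB, th_and.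
  - now rewrite IHA, IHB, th_or.
  - rewrite th_all; split; [intros H t; apply K, H | intros H a; rewrite (cls_surj a); apply K, H].
  - rewrite th_ex; split; [intros [a H]; exists (proj1_sig a) | intros [t H]; exists (cls t)]; apply K;
      trivial; now rewrite <- cls_surj.
  - rewrite th_alls; split; intros H X; apply K, H.
  - rewrite th_exs; split; intros [X H]; exists X; now apply K.
Qed.

Lemma term_model_satisfies : satisfies term_model T.
Proof.
  intros A HA e E.
  apply (sat_ext term_model A e (fun i => cls (proj1_sig (e i))) E E);
    [intros i; apply cls_surj | reflexivity |].
  apply sat_term_model; exists 0; now apply prv_ax_subst.
Qed.

End Henkin.

(** If [A] is not provable, its negation is consistent and holds in the term model of a Henkin
    extension, with every variable read as itself. *)
Theorem completeness (A : form) :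
  (forall m, satisfies m T -> forall e E, sat m e E A) -> provable T A.
Proof.
  intros H; apply prv_raa, NNPP; intros HN.
  assert (HS := H _ (term_model_satisfies _ HN) (fun i => cls _ HN (Var i)) (fun X => X)).
  apply sat_term_model in HS; rewrite subst_id in HS by trivial.
  apply th_not in HS; trivial; exists 0; apply prv_hyp0.
Qed.

End Completeness.

(** * Definability in a model of RCA0 *)

(** A structure may have no sets at all; [rca0_set] guarantees that assignments to set variables
    exist. *)
Record rca0_model : Type := RCA0Model {
  rca0_structure : structure;
  rca0_satisfies : satisfies rca0_structure RCA0;
  rca0_set : sets rca0_structure }.

Definition mnum (m : rca0_model) : Type := num (rca0_structure m).
Definition mset (m : rca0_model) : Type := sets (rca0_structure m).

Lemma Delta0_subst A : Delta0 A -> forall sg rh, Delta0 (subst sg rh A).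
Proof.
  intros H; induction H; intros sg rh; simpl; try (constructor; auto); rewrite tsubst_up;
    constructor; auto.
Qed.

Section Definability.

Variable m : rca0_model.
Notation M := (mnum m).
Notation env := (nat -> M).
Notation m0 := (num_zero (rca0_structure m) : M).
Notation m1 := (num_one (rca0_structure m) : M).
Notation madd := (num_add (rca0_structure m) : M -> M -> M).
Notation mmul := (num_mul (rca0_structure m) : M -> M -> M).

Definition mlt (a b : M) : Prop := num_lt (rca0_structure m) a b.
Definition mmem (a : M) (X : mset m) : Prop := num_mem (rca0_structure m) a X.

Definition tail {U : Type} (e : nat -> U) (i : nat) : U := e (S i).

(* [Delta0] predicates of the variables [e 0, e 1, ...], with parameters from
   the model. *)
Inductive PT : (env -> M) -> Prop :=
| PT_var i : PT (fun e => e i)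
| PT_cst c : PT (fun _ => c)
| PT_add_raw s t : PT s -> PT t -> PT (fun e => madd (s e) (t e))
| PT_mul_raw s t : PT s -> PT t -> PT (fun e => mmul (s e) (t e)).

Inductive D0 : (env -> Prop) -> Prop :=
| D0_bot : D0 (fun _ => False)
| D0_eq s t : PT s -> PT t -> D0 (fun e => s e = t e)
| D0_lt s t : PT s -> PT t -> D0 (fun e => mlt (s e) (t e))
| D0_mem t X : PT t -> D0 (fun e => mmem (t e) X)
| D0_imp P Q : D0 P -> D0 Q -> D0 (fun e => P e -> Q e)
| D0_and P Q : D0 P -> D0 Q -> D0 (fun e => P e /\ Q e)
| D0_or P Q : D0 P -> D0 Q -> D0 (fun e => P e \/ Q e)
| D0_ball t (P : M -> env -> Prop) :
    PT t -> D0 (fun e => P (e 0) (tail e)) -> D0 (fun e => forall y, mlt y (t e) -> P y e)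
| D0_bex t (P : M -> env -> Prop) :
    PT t -> D0 (fun e => P (e 0) (tail e)) -> D0 (fun e => exists y, mlt y (t e) /\ P y e).

(* [v] makes each variable of a formula a variable of the predicate or a parameter. *)
Definition lookup (v : nat -> nat + M) (e : env) (i : nat) : M :=
  match v i with inl j => e j | inr c => c end.

Definition merge {U : Type} (v w : nat -> U) (i : nat) : U :=
  if Nat.even i then v (Nat.div2 i) else w (Nat.div2 i).

Lemma merge_even U (v w : nat -> U) i : merge v w (2 * i) = v i.
Proof.
  unfold merge; rewrite Nat.even_mul; cbn [Nat.even orb].
  now rewrite Nat.div2_double.
Qed.

Lemma merge_odd U (v w : nat -> U) i : merge v w (S (2 * i)) = w i.
Proof.
  unfold merge; rewrite Nat.even_succ, <- Nat.negb_even, Nat.even_mul; cbn [Nat.even orb negb].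
  now rewrite Nat.div2_succ_double.
Qed.

Definition tright (t : term) : term := tsubst (fun i => Var (S (2 * i))) t.
Definition tleft (t : term) : term := tsubst (fun i => Var (2 * i)) t.
Definition fright (A : form) : form := subst (fun i => Var (S (2 * i))) (fun i => S (2 * i)) A.
Definition fleft (A : form) : form := subst (fun i => Var (2 * i)) (fun i => 2 * i) A.

Lemma eval_tleft v w e t :
  eval _ (lookup (merge v w) e) (tleft t) = eval (rca0_structure m) (lookup v e) t.
Proof.
  unfold tleft; rewrite eval_tsubst; apply eval_ext; intros i; cbn [eval].
  unfold lookup; now rewrite merge_even.
Qed.

Lemma eval_tright v w e t :
  eval _ (lookup (merge v w) e) (tright t) = eval (rca0_structure m) (lookup w e) t.
Proof.
  unfold tright; rewrite eval_tsubst; apply eval_ext; intros i; cbn [eval].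
  unfold lookup; now rewrite merge_odd.
Qed.

Lemma sat_fleft v w e E F A :
  sat _ (lookup (merge v w) e) (merge E F) (fleft A) <->
  sat (rca0_structure m) (lookup v e) E A.
Proof.
  unfold fleft; rewrite sat_subst; apply sat_ext; intros i; cbn [eval].
  - unfold lookup; now rewrite merge_even.
  - apply merge_even.
Qed.

Lemma sat_fright v w e E F A :
  sat _ (lookup (merge v w) e) (merge E F) (fright A) <->
  sat (rca0_structure m) (lookup w e) F A.
Proof.
  unfold fright; rewrite sat_subst; apply sat_ext; intros i; cbn [eval].
  - unfold lookup; now rewrite merge_odd.
  - apply merge_odd.
Qed.

Lemma PT_term s : PT s -> exists t v, forall e, eval (rca0_structure m) (lookup v e) t = s e.
Proof.
  intros H; induction H as [i|c|s t Hs [s' [v Hv]] Ht [t' [w Hw]]|s t Hs [s' [v Hv]] Ht [t' [w Hw]]].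
  - now exists (Var 0), (fun _ => inl i).
  - now exists (Var 0), (fun _ => inr c).
  - exists (Plus (tleft s') (tright t')), (merge v w); intros e; cbn [eval].
    now rewrite eval_tleft, eval_tright, Hv, Hw.
  - exists (Times (tleft s') (tright t')), (merge v w); intros e; cbn [eval].
    now rewrite eval_tleft, eval_tright, Hv, Hw.
Qed.

(* Variable [0] of the predicate becomes the variable bound by a quantifier. *)
Definition under_binder (v : nat -> nat + M) (i : nat) : term :=
  match v i with inl 0 => Var 0 | _ => Var (S i) end.
Definition outside (v : nat -> nat + M) (i : nat) : nat + M :=
  match v i with inl (S j) => inl j | inl 0 => inl 0 | inr c => inr c end.

Lemma sat_under_binder v e E y A :
  sat (rca0_structure m) (scons y (lookup (outside v) e)) E (subst (under_binder v) (fun X => X) A) <->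
  sat (rca0_structure m) (lookup v (scons y e)) E A.
Proof.
  rewrite sat_subst; apply sat_ext; trivial; intros i.
  unfold under_binder, lookup, outside; destruct (v i) as [[|j]|c] eqn:Hi; simpl; rewrite ?Hi; trivial.
Qed.

Lemma sat_bounded v w e E y A :
  sat (rca0_structure m) (scons y (lookup (merge (outside v) w) e)) E
    (subst (up (fun i => Var (2 * i))) (fun X => X) (subst (under_binder v) (fun X => X) A)) <->
  sat (rca0_structure m) (lookup v (scons y e)) E A.
Proof.
  rewrite sat_subst, <- sat_under_binder; apply sat_ext; trivial.
  intros [|i]; trivial; unfold up; cbn [scons]; rewrite eval_tshift; cbn [eval].
  unfold lookup; now rewrite merge_even.
Qed.

(** Definability is checked on predicates of Rocq, and this lemma leads back to syntax, where the
    axiom schemes live. Two subformulas bring assignments of their own, which [merge] interleaves on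
    even and odd indices. *)
Lemma D0_form P : D0 P ->
  exists A v E, Delta0 A /\ forall e, sat (rca0_structure m) (lookup v e) E A <-> P e.
Proof.
  intros H; induction H as [|s t Hs Ht|s t Hs Ht|t X Ht
    |P Q HP [A [v [E [HA HA']]]] HQ [B [w [F [HB HB']]]]
    |P Q HP [A [v [E [HA HA']]]] HQ [B [w [F [HB HB']]]]
    |P Q HP [A [v [E [HA HA']]]] HQ [B [w [F [HB HB']]]]
    |t P Ht HP [A [v [E [HA HA']]]]|t P Ht HP [A [v [E [HA HA']]]]].
  - exists Bot, (fun _ => inl 0), (fun _ => rca0_set m); split; [constructor | reflexivity].
  - destruct (PT_term s Hs) as [s' [v Hv]], (PT_term t Ht) as [t' [w Hw]].
    exists (Equal (tleft s') (tright t')), (merge v w), (fun _ => rca0_set m).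
    split; [constructor | intros e; cbn [sat]; now rewrite eval_tleft, eval_tright, Hv, Hw].
  - destruct (PT_term s Hs) as [s' [v Hv]], (PT_term t Ht) as [t' [w Hw]].
    exists (Less (tleft s') (tright t')), (merge v w), (fun _ => rca0_set m).
    split; [constructor | intros e; cbn [sat]; now rewrite eval_tleft, eval_tright, Hv, Hw].
  - destruct (PT_term t Ht) as [t' [w Hw]]; exists (Mem t' 0), w, (fun _ => X).
    split; [constructor | intros e; cbn [sat]; now rewrite Hw].
  - exists (Imp (fleft A) (fright B)), (merge v w), (merge E F).
    split; [constructor; now apply Delta0_subst | intros e; cbn [sat]].
    now rewrite sat_fleft, sat_fright, HA', HB'.
  - exists (And (fleft A) (fright B)), (merge v w), (merge E F).
    split; [constructor; now apply Delta0_subst | intros e; cbn [sat]].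
    now rewrite sat_fleft, sat_fright, HA', HB'.
  - exists (Or (fleft A) (fright B)), (merge v w), (merge E F).
    split; [constructor; now apply Delta0_subst | intros e; cbn [sat]].
    now rewrite sat_fleft, sat_fright, HA', HB'.
  - destruct (PT_term t Ht) as [t' [w Hw]].
    eexists (All (Imp (Less (Var 0) (tshift (tright t'))) _)), (merge (outside v) w), E.
    split; [constructor; now apply Delta0_subst, Delta0_subst, HA|].
    intros e; cbn [sat eval]; rewrite <- (Hw e).
    split; intros H y; specialize (H y);
      rewrite eval_tshift, eval_tright, sat_bounded, (HA' (scons y e)) in *; exact H.
  - destruct (PT_term t Ht) as [t' [w Hw]].
    eexists (Ex (And (Less (Var 0) (tshift (tright t'))) _)), (merge (outside v) w), E.
    split; [constructor; now apply Delta0_subst, Delta0_subst, HA|].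
    intros e; cbn [sat eval]; rewrite <- (Hw e).
    split; intros [y H]; exists y;
      rewrite eval_tshift, eval_tright, sat_bounded, (HA' (scons y e)) in *; exact H.
Qed.

Definition S1 (P : env -> Prop) : Prop :=
  exists Q : M -> env -> Prop,
    D0 (fun e => Q (e 0) (tail e)) /\ forall e, P e <-> exists y, Q y e.

Lemma S1_form (P : M -> Prop) : S1 (fun e => P (e 0)) ->
  exists A v E, Sigma1 A /\
    forall n, sat (rca0_structure m) (scons n v) E A <-> P n.
Proof.
  intros [Q [HQ HP]]; destruct (D0_form _ HQ) as [A [v [E [HA HA']]]].
  (* [P] reads variable 0 only, so the other variables may take any value. *)
  set (d := fun _ : nat => m0).
  exists (Ex (subst (up (under_binder (outside v))) (fun X => X)
    (subst (under_binder v) (fun X => X) A))),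
    (lookup (outside (outside v)) d), E.
  split; [constructor; now apply Delta0_subst, Delta0_subst|].
  intros n; cbn [sat]; rewrite (HP (scons n d)).
  enough (HE : forall y, sat (rca0_structure m)
    (scons y (scons n (lookup (outside (outside v)) d))) E
    (subst (up (under_binder (outside v))) (fun X => X) (subst (under_binder v) (fun X => X) A))
    <-> Q y (scons n d)) by (now split; intros [y H]; exists y; apply HE).
  intros y; rewrite sat_subst.
  change (Q y (scons n d)) with (Q (scons y (scons n d) 0) (tail (scons y (scons n d)))).
  rewrite <- (HA' (scons y (scons n d))), <- sat_under_binder.
  apply sat_ext; trivial.
  intros [|i]; trivial; unfold up; cbn [scons]; rewrite eval_tshift.
  unfold under_binder, lookup, outside; destruct (v i) as [[|[|j]]|c] eqn:Hi; simpl; rewrite ?Hi; trivial.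
Qed.

Lemma S1_ind (P : M -> Prop) : S1 (fun e => P (e 0)) ->
  P m0 -> (forall n, P n -> P (madd n m1)) -> forall n, P n.
Proof.
  intros HS H0 H1; destruct (S1_form P HS) as [A [v [E [HA HP]]]].
  assert (H := rca0_satisfies m _ (ax_Sigma1_induction A HA) v E); cbn [sat] in H.
  intros n; apply HP, H; clear n; split.
  - unfold inst; rewrite sat_subst; rewrite (sat_ext _ _ _ (scons m0 v) _ E);
      [now apply HP | now intros [|i] | reflexivity].
  - intros n Hn; apply HP, H1, HP in Hn; unfold at_succ; rewrite sat_subst.
    eapply sat_ext; [| |exact Hn]; trivial; now intros [|i].
Qed.

Lemma PT_subst s (f : nat -> env -> M) :
  (forall i, PT (f i)) -> PT s -> PT (fun e => s (fun i => f i e)).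
Proof.
  intros Hf H; induction H; [apply Hf | | |]; now constructor.
Qed.

Lemma D0_subst P (f : nat -> env -> M) :
  (forall i, PT (f i)) -> D0 P -> D0 (fun e => P (fun i => f i e)).
Proof.
  intros Hf H; revert f Hf.
  assert (HT : forall (f : nat -> env -> M), (forall i, PT (f i)) ->
    forall i, PT (scons (fun e => e 0) (fun i e => f i (tail e)) i)).
  { intros f Hf [|i]; simpl; [constructor|].
    apply (PT_subst (f i) (fun j e => e (S j))); [constructor | apply Hf]. }
  induction H as [|s t|s t|t X|P Q|P Q|P Q|t P Ht HP IH|t P Ht HP IH]; intros f Hf;
    try (constructor; auto using PT_subst).
  - exact (IH _ (HT f Hf)).
  - exact (IH _ (HT f Hf)).
Qed.

Lemma D0_tail P : D0 P -> D0 (fun e => P (tail e)).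
Proof. intros H; apply (D0_subst P (fun i e => e (S i))); trivial; constructor. Qed.

Lemma D0_ext P Q : D0 P -> (forall e, P e <-> Q e) -> D0 Q.
Proof.
  intros H HE; replace Q with P; trivial; apply functional_extensionality; intros e.
  apply propositional_extensionality, HE.
Qed.

Lemma D0_S1 P : D0 P -> S1 P.
Proof.
  intros H; exists (fun _ e => P e); split; [now apply D0_tail|].
  intros e; split; [now exists m0 | now intros [_ ?]].
Qed.

Lemma S1_ext P Q : S1 P -> (forall e, P e <-> Q e) -> S1 Q.
Proof. intros [R [HR HR']] H; exists R; split; trivial; intros e; now rewrite <- H. Qed.

Lemma comprehension (P : M -> Prop) :
  S1 (fun e => P (e 0)) -> S1 (fun e => ~ P (e 0)) -> exists X, forall n, mmem n X <-> P n.
Proof.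
  intros HP HN; destruct (S1_form P HP) as [A [v [E [[A0 HA] HA']]]].
  destruct (S1_form (fun n => ~ P n) HN) as [B [w [F [[B0 HB] HB']]]].
  (* The definitions of [P] and of its complement have separate parameters, which [f] and [g] place
     at the even and odd positions of one assignment; both keep variable 0 for the argument.
     Negating the definition of the complement yields the $\Pi^0_1$ formula that the axiom asks
     for. *)
  set (f := scons (Var 0) (fun i => Var (S (2 * i)))).
  set (g := scons (Var 0) (fun i => Var (S (S (2 * i))))).
  set (A1 := subst f (fun X => 2 * X) (Ex A0)).
  set (B1 := All (Not (subst (up g) (fun X => S (2 * X)) B0))).
  set (e := fun n => scons n (merge v w)).
  assert (EA : forall n, sat (rca0_structure m) (e n) (merge E F) A1 <-> P n).
  { intros n; unfold A1; rewrite sat_subst, <- HA'; apply sat_ext.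
    - intros [|i]; trivial; unfold f; cbn [scons eval]; apply merge_even.
    - intros X; apply merge_even. }
  assert (EB : forall n, sat (rca0_structure m) (e n) (merge E F) B1 <-> P n).
  { intros n; transitivity (~ sat (rca0_structure m) (e n) (merge E F)
      (subst g (fun X => S (2 * X)) (Ex B0))).
    - unfold B1; cbn [sat Not subst]; split; [now intros H [y Hy]; apply (H y) | ].
      intros H y Hy; apply H; now exists y.
    - enough (HE : sat (rca0_structure m) (e n) (merge E F) (subst g (fun X => S (2 * X)) (Ex B0)) <-> ~ P n)
        by (rewrite HE; split; [apply NNPP | tauto]).
      rewrite sat_subst, <- HB'; apply sat_ext.
      + intros [|i]; trivial; unfold g; cbn [scons eval]; apply merge_odd.
      + intros X; apply merge_odd. }
  assert (HD := rca0_satisfies m _ (ax_Delta1_comprehension A1 B1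
    (sigma1 _ (Delta0_subst _ HA _ _)) (pi1 _ (d0_imp _ _ (Delta0_subst _ HB _ _) d0_bot)))
    (merge v w) (merge E F)).
  cbn [sat Iff] in HD; destruct HD as [X HX].
  { intros n; fold (e n); rewrite EA, EB; tauto. }
  exists X; intros n; specialize (HX n); unfold shiftS in HX; rewrite sat_subst in HX.
  rewrite <- EA; unfold mmem; cbn [eval scons] in HX; exact (conj (proj1 HX) (proj2 HX)).
Qed.

End Definability.

(** * The four principles in a model *)

(* Mirrors of the definitions of the statement, with elements of the model for
   number and set terms: each principle is convertible to its satisfaction. *)
Section Principles.

Variable m : rca0_model.
Notation M := (mnum m).
Notation S := (mset m).
Notation m0 := (num_zero (rca0_structure m) : M).
Notation m1 := (num_one (rca0_structure m) : M).
Notation madd := (num_add (rca0_structure m) : M -> M -> M).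
Notation mmul := (num_mul (rca0_structure m) : M -> M -> M).
Notation mlt := (mlt m).
Notation mmem := (mmem m).

Definition mle (a b : M) : Prop := mlt a b \/ a = b.

Definition mpair (i j : M) : M := madd (mmul (madd i j) (madd i j)) i.

Definition m_is_fun (F : S) (A B : M -> Prop) : Prop :=
  (forall p, mmem p F -> exists i j, p = mpair i j /\ A i /\ B j) /\
  (forall i, A i -> exists j, mmem (mpair i j) F) /\
  (forall i j k, mmem (mpair i j) F /\ mmem (mpair i k) F -> j = k).

Definition m_any (n : M) : Prop := False -> False.

Record mfrac : Type := MFrac { mpos : M; mneg : M; mden : M }.

Definition mfrac0 : mfrac := MFrac m0 m0 m1.
Definition mfrac1 : mfrac := MFrac m1 m0 m1.
Definition mfrac_opp (u : mfrac) : mfrac := MFrac (mneg u) (mpos u) (mden u).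
Definition mfrac_add (u v : mfrac) : mfrac :=
  MFrac (madd (mmul (mpos u) (mden v)) (mmul (mpos v) (mden u)))
        (madd (mmul (mneg u) (mden v)) (mmul (mneg v) (mden u)))
        (mmul (mden u) (mden v)).
Definition mfrac_sub (u v : mfrac) : mfrac := mfrac_add u (mfrac_opp v).
Definition mfrac_mul (u v : mfrac) : mfrac :=
  MFrac (madd (mmul (mpos u) (mpos v)) (mmul (mneg u) (mneg v)))
        (madd (mmul (mpos u) (mneg v)) (mmul (mneg u) (mpos v)))
        (mmul (mden u) (mden v)).
Definition mfrac_eq (u v : mfrac) : Prop :=
  madd (mmul (mpos u) (mden v)) (mmul (mneg v) (mden u)) =
  madd (mmul (mpos v) (mden u)) (mmul (mneg u) (mden v)).
Definition mfrac_lt (u v : mfrac) : Prop :=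
  mlt (madd (mmul (mpos u) (mden v)) (mmul (mneg v) (mden u)))
      (madd (mmul (mpos v) (mden u)) (mmul (mneg u) (mden v))).
Definition mfrac_le (u v : mfrac) : Prop := mfrac_lt u v \/ mfrac_eq u v.
Definition mfrac_abs (u : mfrac) (K : mfrac -> Prop) : Prop :=
  (mfrac_le mfrac0 u /\ K u) \/ (mfrac_lt u mfrac0 /\ K (mfrac_opp u)).

Definition mcode (a b c : M) : M := mpair (mpair a b) c.
Definition m_with_frac (q : M) (K : mfrac -> Prop) : Prop :=
  exists a b c, q = mcode a b c /\ K (MFrac a b (madd c m1)).
Definition m_is_rat (q : M) : Prop :=
  m_with_frac q (fun u => forall a b c,
    mlt (mcode a b c) q -> mfrac_eq (MFrac a b (madd c m1)) u -> False).
Definition mrat1 : M := mcode m1 m0 m0.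
Definition mrat0 : M := mcode m0 m0 m0.
Definition m_forall_eps (K : mfrac -> Prop) : Prop :=
  forall q, m_is_rat q -> m_with_frac q (fun e => mfrac_lt mfrac0 e -> K e).

Definition m_ratseq : Type := M -> (M -> Prop) -> Prop.
Definition m_seqexp : Type := M -> (mfrac -> Prop) -> Prop.
Definition m_seq_of (X : S) : m_ratseq := fun n K => exists q, mmem (mpair n q) X /\ K q.
Definition m_seq_const (q : M) : m_ratseq := fun _ K => K q.
Definition m_val (x : m_ratseq) : m_seqexp := fun n K => x n (fun q => m_with_frac q K).
Definition m_rcst (u : mfrac) : m_seqexp := fun _ K => K u.
Definition m_rsub (x y : m_seqexp) : m_seqexp :=
  fun n K => x n (fun u => y n (fun v => K (mfrac_sub u v))).
Definition m_rmul (x y : m_seqexp) : m_seqexp :=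
  fun n K => x n (fun u => y n (fun v => K (mfrac_mul u v))).
Definition m_rabs (x : m_seqexp) : m_seqexp := fun n K => x n (fun u => mfrac_abs u K).

Definition m_is_cauchy (x : m_seqexp) : Prop :=
  m_forall_eps (fun e => exists N, forall i j, mle N i /\ mle N j ->
    x i (fun u => x j (fun v => mfrac_abs (mfrac_sub u v) (fun w => mfrac_lt w e)))).
Definition m_is_real (X : S) : Prop :=
  m_is_fun X m_any m_is_rat /\ m_is_cauchy (m_val (m_seq_of X)).
Definition m_rle (x y : m_seqexp) : Prop :=
  m_forall_eps (fun e => exists N, forall n, mle N n ->
    x n (fun u => y n (fun v => mfrac_le u (mfrac_add v e)))).
Definition m_req (x y : m_seqexp) : Prop := m_rle x y /\ m_rle y x.
Definition m_rlt (x y : m_seqexp) : Prop := m_rle x y /\ (m_req x y -> False).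
Definition m_real0 : m_seqexp := m_rcst mfrac0.
Definition m_real1 : m_seqexp := m_rcst mfrac1.
Definition m_in_ball (d y z : m_seqexp) : Prop := m_rlt (m_rabs (m_rsub y z)) d.

Definition m_is_rat_num_pair (p : M) : Prop := exists q i, p = mpair q i /\ m_is_rat q.
Definition m_is_pcf (F : S) : Prop := m_is_fun F m_is_rat_num_pair m_is_rat.
Definition m_at_rat (F : S) (q i : M) (K : M -> Prop) : Prop :=
  exists r, mmem (mpair (mpair q i) r) F /\ K r.
Definition m_in_dom (F : S) (x : m_seqexp) : Prop :=
  m_forall_eps (fun e => exists N, mlt m0 N /\
    forall q r,
      m_is_rat q /\ m_is_rat r /\
      m_in_ball (m_rcst (MFrac m1 m0 N)) x (m_val (m_seq_const q)) /\
      m_in_ball (m_rcst (MFrac m1 m0 N)) x (m_val (m_seq_const r)) ->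
      forall i j, mle N i /\ mle N j ->
        m_at_rat F q i (fun q' => m_with_frac q' (fun u =>
        m_at_rat F r j (fun r' => m_with_frac r' (fun v =>
          mfrac_abs (mfrac_sub u v) (fun w => mfrac_lt w e)))))).
Definition m_app (F : S) (x : m_ratseq) : m_seqexp :=
  m_val (fun i K => x i (fun q => m_at_rat F q i K)).
Definition m_in_unit_closed (x : m_seqexp) : Prop := m_rle m_real0 x /\ m_rle x m_real1.
Definition m_in_unit_open (x : m_seqexp) : Prop := m_rlt m_real0 x /\ m_rlt x m_real1.

Definition m_continuous_on_unit (F : S) : Prop :=
  m_is_pcf F /\
  forall X, m_is_real X /\ m_in_unit_closed (m_val (m_seq_of X)) ->
    m_in_dom F (m_val (m_seq_of X)).
Definition m_continuous_two_valued (F : S) : Prop :=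
  m_is_pcf F /\
  (forall X, m_is_real X -> m_in_dom F (m_val (m_seq_of X))) /\
  (forall X, m_is_real X ->
    m_req (m_app F (m_seq_of X)) m_real0 \/ m_req (m_app F (m_seq_of X)) m_real1).
Definition m_increasing_on_unit (F : S) : Prop :=
  forall X Y,
    m_is_real X /\ m_in_unit_closed (m_val (m_seq_of X)) /\
    m_is_real Y /\ m_in_unit_closed (m_val (m_seq_of Y)) /\
    m_rlt (m_val (m_seq_of X)) (m_val (m_seq_of Y)) ->
    m_rlt (m_app F (m_seq_of X)) (m_app F (m_seq_of Y)).
Definition m_sign_change (F : S) : Prop :=
  m_rlt (m_rmul (m_app F (m_seq_const mrat0)) (m_app F (m_seq_const mrat1))) m_real0.
Definition m_has_zero (F : S) : Prop :=
  exists X, m_is_real X /\ m_in_unit_open (m_val (m_seq_of X)) /\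
    m_req (m_app F (m_seq_of X)) m_real0.

Definition m_IPP : Prop :=
  forall (N : M) (C : S), m_is_fun C m_any (fun j => mle j N) ->
    exists n, mle n N /\ forall k, exists i, mlt k i /\ mmem (mpair i n) C.
Definition m_IVT : Prop :=
  forall F, m_continuous_on_unit F /\ m_sign_change F -> m_has_zero F.
Definition m_IVT_increasing : Prop :=
  forall F, m_continuous_on_unit F /\ m_increasing_on_unit F /\ m_sign_change F ->
    m_has_zero F.
Definition m_two_valued_constant : Prop :=
  forall F, m_continuous_two_valued F ->
    forall X Y, m_is_real X /\ m_is_real Y ->
      m_req (m_app F (m_seq_of X)) (m_app F (m_seq_of Y)).

Lemma sat_IPP e E : sat (rca0_structure m) e E IPP = m_IPP.
Proof. reflexivity. Qed.

Lemma sat_IVT e E : sat (rca0_structure m) e E IVT = m_IVT.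
Proof. reflexivity. Qed.

Lemma sat_IVT_increasing e E : sat (rca0_structure m) e E IVT_increasing = m_IVT_increasing.
Proof. reflexivity. Qed.

Lemma sat_two_valued_constant e E :
  sat (rca0_structure m) e E two_valued_constant = m_two_valued_constant.
Proof. reflexivity. Qed.

End Principles.

From HB Require Import structures.
From mathcomp Require Import all_boot all_order ssralg ssrnum.
From mathcomp Require Import ring lra.
Import Order.TTheory GRing.Theory Num.Theory.
Local Open Scope ring_scope.

(** * Arithmetic in a model *)

Definition decide (P : Prop) : bool := if excluded_middle_informative P then true else false.

Lemma decideP (P : Prop) : reflect P (decide P).
Proof. by rewrite /decide; case: excluded_middle_informative => H; constructor. Qed.

(** * Decidable equality and choice from classical logic *)

Section ClassicalChoice.

Variable T : Type.

Lemma classical_eqP : eq_axiom (fun x y : T => decide (x = y)).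
Proof. by move=> x y; apply: decideP. Qed.

Definition classical_find (P : pred T) (_ : nat) : option T :=
  if excluded_middle_informative (exists x, P x) is left H
  then Some (proj1_sig (constructive_indefinite_description P H)) else None.

Lemma classical_find_correct P n x : classical_find P n = Some x -> P x.
Proof.
rewrite /classical_find; case: excluded_middle_informative => // H [<-].
exact: (proj2_sig (constructive_indefinite_description P H)).
Qed.

Lemma classical_find_complete (P : pred T) : (exists x, P x) -> exists n, classical_find P n.
Proof. by move=> H; exists 0%N; rewrite /classical_find; case: excluded_middle_informative. Qed.

Lemma classical_find_ext (P Q : pred T) : P =1 Q -> classical_find P =1 classical_find Q.
Proof. by move=> /functional_extensionality ->. Qed.

Definition classical_hasDecEq := hasDecEq.Build T classical_eqP.
Definition classical_hasChoice := hasChoice.Build T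
  classical_find_correct classical_find_complete classical_find_ext.

End ClassicalChoice.

Section Arithmetic.

Variable m : rca0_model.
Notation M := (mnum m).
Notation m0 := (num_zero (rca0_structure m) : M).
Notation m1 := (num_one (rca0_structure m) : M).
Notation madd := (num_add (rca0_structure m) : M -> M -> M).
Notation mmul := (num_mul (rca0_structure m) : M -> M -> M).

Lemma m_axiom A : RCA0 A -> forall e, sat (rca0_structure m) e (fun _ => rca0_set m) A.
Proof. by move=> H e; apply: rca0_satisfies. Qed.

Lemma msucc_neq0 (a : M) : madd a m1 <> m0.
Proof. exact: (m_axiom _ ax_succ_ne0 (fun _ => a)). Qed.
Lemma msucc_inj (a b : M) : madd a m1 = madd b m1 -> a = b.
Proof. exact: (m_axiom _ ax_succ_inj (scons a (fun _ => b))). Qed.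
Lemma madd0 (a : M) : madd a m0 = a.
Proof. exact: (m_axiom _ ax_plus0 (fun _ => a)). Qed.
Lemma maddS (a b : M) : madd a (madd b m1) = madd (madd a b) m1.
Proof. exact: (m_axiom _ ax_plusS (scons a (fun _ => b))). Qed.
Lemma mmul0 (a : M) : mmul a m0 = m0.
Proof. exact: (m_axiom _ ax_times0 (fun _ => a)). Qed.
Lemma mmulS (a b : M) : mmul a (madd b m1) = madd (mmul a b) a.
Proof. exact: (m_axiom _ ax_timesS (scons a (fun _ => b))). Qed.
Lemma mlt0 (a : M) : ~ mlt m a m0.
Proof. exact: (m_axiom _ ax_lt0 (fun _ => a)). Qed.
Lemma mltS (a b : M) : mlt m a (madd b m1) <-> mle m a b.
Proof. have [H1 H2] := m_axiom _ ax_ltS (scons a (fun _ => b)); split; [exact: H1 | exact: H2]. Qed.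

Lemma delta0_induction (P : M -> Prop) : D0 m (fun e => P (e 0%N)) ->
  P m0 -> (forall n, P n -> P (madd n m1)) -> forall n, P n.
Proof. by move=> H; apply: S1_ind; apply: D0_S1. Qed.

Ltac pt := repeat first
  [ apply: (PT_var m) | apply: (PT_cst m)
  | apply: (PT_add_raw m) | apply: (PT_mul_raw m) ].

Lemma m0add a : madd m0 a = a.
Proof.
apply: (delta0_induction (fun a => madd m0 a = a)) => [||n IH]; [|exact: madd0|by rewrite maddS IH].
by apply: D0_eq; pt.
Qed.

Lemma mSadd a b : madd (madd a m1) b = madd (madd a b) m1.
Proof.
apply: (delta0_induction (fun b => madd (madd a m1) b = madd (madd a b) m1)) => [||n IH].
- by apply: D0_eq; pt.
- by rewrite !madd0.
- by rewrite !maddS IH.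
Qed.

Lemma maddC a b : madd a b = madd b a.
Proof.
apply: (delta0_induction (fun b => madd a b = madd b a)) => [||n IH].
- by apply: D0_eq; pt.
- by rewrite madd0 m0add.
- by rewrite maddS mSadd IH.
Qed.

Lemma maddA a b c : madd a (madd b c) = madd (madd a b) c.
Proof.
apply: (delta0_induction (fun c => madd a (madd b c) = madd (madd a b) c)) => [||n IH].
- by apply: D0_eq; pt.
- by rewrite !madd0.
- by rewrite !maddS IH.
Qed.

Lemma m0mul a : mmul m0 a = m0.
Proof.
apply: (delta0_induction (fun a => mmul m0 a = m0)) => [||n IH]; [|exact: mmul0|by rewrite mmulS IH madd0].
by apply: D0_eq; pt.
Qed.

Lemma mSmul a b : mmul (madd a m1) b = madd (mmul a b) b.
Proof.
apply: (delta0_induction (fun b => mmul (madd a m1) b = madd (mmul a b) b)) => [||n IH].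
- by apply: D0_eq; pt.
- by rewrite !mmul0 madd0.
- by rewrite !mmulS IH -!maddA; congr madd; rewrite !maddS (maddC n).
Qed.

Lemma mmulC a b : mmul a b = mmul b a.
Proof.
apply: (delta0_induction (fun b => mmul a b = mmul b a)) => [||n IH].
- by apply: D0_eq; pt.
- by rewrite mmul0 m0mul.
- by rewrite mmulS mSmul IH.
Qed.

Lemma mmulDl a b c : mmul (madd a b) c = madd (mmul a c) (mmul b c).
Proof.
apply: (delta0_induction (fun c => mmul (madd a b) c = madd (mmul a c) (mmul b c))) => [||n IH].
- by apply: D0_eq; pt.
- by rewrite !mmul0 madd0.
- rewrite !mmulS IH -!maddA; congr madd.
  by rewrite maddA [madd (mmul b n) a]maddC -maddA.
Qed.

Lemma mmulA a b c : mmul a (mmul b c) = mmul (mmul a b) c.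
Proof.
apply: (delta0_induction (fun c => mmul a (mmul b c) = mmul (mmul a b) c)) => [||n IH].
- by apply: D0_eq; pt.
- by rewrite !mmul0.
- by rewrite !mmulS -IH mmulC mmulDl !(mmulC _ a).
Qed.

Lemma m1mul a : mmul m1 a = a.
Proof. by rewrite -(m0add m1) mSmul m0mul m0add. Qed.


End Arithmetic.

HB.instance Definition _ (m : rca0_model) := classical_hasDecEq (mnum m).
HB.instance Definition _ (m : rca0_model) := classical_hasChoice (mnum m).
HB.instance Definition _ (m : rca0_model) :=
  GRing.isNmodule.Build (mnum m) (@maddA m) (@maddC m) (@m0add m).

Lemma m1_neq0 (m : rca0_model) : num_one (rca0_structure m) != 0 :> mnum m.
Proof.
apply/eqP => H; apply: (@msucc_neq0 m (num_zero (rca0_structure m))).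
by rewrite m0add H.
Qed.

HB.instance Definition _ (m : rca0_model) :=
  GRing.Nmodule_isComNzSemiRing.Build (mnum m) (@mmulA m) (@mmulC m) (@m1mul m) (@mmulDl m)
   (@m0mul m) (@m1_neq0 m).

Notation "a <m b" := (mlt _ a b) (at level 70) : ring_scope.
Notation "a <=m b" := (mle _ a b) (at level 70) : ring_scope.

(** * Order and cancellation for numbers *)

Section Order.

Variable m : rca0_model.
Notation M := (mnum m).
Notation env := (nat -> M).
Implicit Types a b c d : M.

Lemma PT_add (s t : env -> M) : PT m s -> PT m t -> PT m (fun e => s e + t e).
Proof. exact: PT_add_raw. Qed.
Lemma PT_mul (s t : env -> M) : PT m s -> PT m t -> PT m (fun e => s e * t e).
Proof. exact: PT_mul_raw. Qed.

Lemma m_ind (P : M -> Prop) : S1 m (fun e => P (e 0%N)) ->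
  P 0 -> (forall n, P n -> P (n + 1)) -> forall n, P n.
Proof. exact: S1_ind. Qed.

Lemma mlt_S a b : a <m b + 1 <-> a <=m b.
Proof. exact: mltS. Qed.

Lemma msucc_neq a : a + 1 <> 0.
Proof. exact: msucc_neq0. Qed.

Lemma m_nlt0 a : ~ a <m 0.
Proof. exact: mlt0. Qed.

Ltac pt := repeat first
  [ apply: (PT_var m) | apply: (PT_cst m) | apply: PT_add | apply: PT_mul ].

Lemma S1_exD (Q : M -> env -> Prop) :
  D0 m (fun e => Q (e 0%N) (tail e)) -> S1 m (fun e => exists y, Q y e).
Proof. by move=> H; exists Q; split. Qed.

Lemma m_case a : a = 0 \/ exists b, a = b + 1.
Proof.
suff [b Hb] : exists b, a = 0 \/ a = b + 1 by case: Hb; [left|right; exists b].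
apply: (m_ind (fun a => exists b, a = 0 \/ a = b + 1)) a => [||n _].
- apply: (S1_exD (fun b e => e 0%N = 0 \/ e 0%N = b + 1)).
  by apply: D0_or; apply: D0_eq; pt.
- by exists 0; left.
- by exists n; right.
Qed.

Lemma maddIr c a b : a + c = b + c -> a = b.
Proof.
apply: (m_ind (fun c => a + c = b + c -> a = b)) c => [||n IH].
- by apply/D0_S1/D0_imp; apply: D0_eq; pt.
- by rewrite !addr0.
- by rewrite !addrA => /msucc_inj.
Qed.

Lemma mltP a b : a <m b <-> exists c, b = a + c + 1.
Proof.
split=> [|[c ->]].
(* The existential quantifier stands in front of the implication to keep the induction formula
   $\Sigma^0_1$. *)
- suff [c Hc] : exists c, a <m b -> b = a + c + 1 by move=> /Hc; exists c.
  apply: (m_ind (fun b => exists c, a <m b -> b = a + c + 1)) b => [||n [c IH]].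
  + apply: (S1_exD (fun c e => a <m e 0%N -> e 0%N = a + c + 1)).
    by apply: D0_imp; [apply: D0_lt | apply: D0_eq]; pt.
  + by exists 0 => /m_nlt0.
  + case: (classic (a <m n)) => [/IH ->|H].
      by exists (c + 1); rewrite addrA.
    by exists 0 => /mlt_S [|->] //; rewrite addr0.
- apply: (m_ind (fun c => a <m a + c + 1)) c => [||n IH].
  + by apply/D0_S1/D0_lt; pt.
  + by apply/mlt_S; right; rewrite addr0.
  + by apply/mlt_S; left; rewrite addrA.
Qed.

Lemma mlt_total a b : [\/ a <m b, a = b | b <m a].
Proof.
suff H : a <m b \/ (a = b \/ b <m a) 
  by case: H => [|[]] H; [apply: Or31|apply: Or32|apply: Or33].
apply: (m_ind (fun a => a <m b \/ (a = b \/ b <m a))) a => [||n].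
- by apply/D0_S1/D0_or; [apply: D0_lt|apply: D0_or; [apply: D0_eq|apply: D0_lt]]; pt.
- case: (m_case b) => [->|[c ->]]; first by right; left.
  by left; apply/mltP; exists c; rewrite add0r.
- case=> [/mltP [c ->]|[->|H]].
  + case: (m_case c) => [->|[d ->]]; first by right; left; rewrite addr0.
    by left; apply/mltP; exists d; ring.
  + by right; right; apply/mlt_S; right.
  + by right; right; apply/mlt_S; left.
Qed.

Lemma maddI0 a b : a + b = 0 -> a = 0.
Proof. by case: (m_case a) => [//|[c ->]]; rewrite addrAC => /msucc_neq. Qed.

Lemma mmulIr c a b : a * (c + 1) = b * (c + 1) -> a = b.
Proof.
have H a' b' : a' <m b' -> a' * (c + 1) <> b' * (c + 1).
  move=> /mltP [d ->] E; have /esym/maddIr : 0 + a' * (c + 1) =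
    (d * c + d + c + 1) + a' * (c + 1) by rewrite add0r {1}E; ring.
  by apply: msucc_neq.
move=> E; case: (mlt_total a b) => // /H; first by case.
by move=> H'; case: H'.
Qed.

End Order.

(** * The ordered field of fractions *)

Section FractionField.

Variable m : rca0_model.
Notation M := (mnum m).

(* [(a, b, c)] stands for [(a - b) / (c + 1)]. *)
Notation triple := (M * M * M)%type.

Definition teq (x y : triple) : Prop :=
  x.1.1 * (y.2 + 1) + y.1.2 * (x.2 + 1) = y.1.1 * (x.2 + 1) + x.1.2 * (y.2 + 1).

Lemma teq_refl x : teq x x.
Proof. by rewrite /teq; ring. Qed.

Lemma teq_sym x y : teq x y -> teq y x.
Proof. by rewrite /teq => ->. Qed.

Lemma teq_trans y x z : teq x y -> teq y z -> teq x z.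
Proof.
case: x => [[a b] c]; case: y => [[a' b'] c']; case: z => [[a'' b''] c'']; rewrite /teq /=.
move=> H1 H2; apply: (@mmulIr m c').
apply: (@maddIr m (a' * (c + 1) * (c'' + 1) + b' * (c + 1) * (c'' + 1))).
transitivity ((a * (c' + 1) + b' * (c + 1)) * (c'' + 1) +
  (a' * (c'' + 1) + b'' * (c' + 1)) * (c + 1)); first by ring.
by rewrite H1 H2; ring.
Qed.

Definition canon (x : triple) : triple := epsilon (inhabits (0, 0, 0)) (teq x).

Lemma teq_canon x : teq x (canon x).
Proof. by apply: epsilon_spec; exists x; apply: teq_refl. Qed.

Lemma canon_eq x y : teq x y -> canon x = canon y.
Proof.
move=> H; rewrite /canon; congr epsilon; apply: functional_extensionality => z.
by apply: propositional_extensionality; split; apply: teq_trans => //; apply: teq_sym.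
Qed.

(** Differences and fractions are adjoined in one step: a triple holds a minuend, a subtrahend and a
    denominator. As for terms, a chosen representative replaces the equivalence class. The result
    serves both for reasoning about numbers and as the range of values of the rationals of the
    model. *)
Record mfield : Type := MField { frepr : triple; frepr_canon : canon frepr = frepr }.

Definition fpi (x : triple) : mfield :=
  MField (canon x) (esym (canon_eq _ _ (teq_canon x))).

Lemma fpiK u : fpi (frepr u) = u.
Proof.
case: u => x Hx; rewrite /fpi /=; move: (esym _); rewrite Hx => H.
by congr MField; apply: proof_irrelevance.
Qed.

Lemma fpi_eq x y : fpi x = fpi y <-> teq x y.
Proof.
split=> [[H]|H].
- by apply: (teq_trans (canon x)); [|rewrite H; apply: teq_sym]; apply: teq_canon.
- by rewrite -(fpiK (fpi x)) -(fpiK (fpi y)) /= (canon_eq _ _ H).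
Qed.

Lemma teq_frepr x : teq (frepr (fpi x)) x.
Proof. by apply/fpi_eq; rewrite fpiK. Qed.

(** The last entry [c] stands for the denominator $c + 1$, so a product of denominators appears as
    $cc' + c + c'$. *)
Definition tadd (x y : triple) : triple :=
  (x.1.1 * (y.2 + 1) + y.1.1 * (x.2 + 1), x.1.2 * (y.2 + 1) + y.1.2 * (x.2 + 1),
   x.2 * y.2 + x.2 + y.2).
Definition tmul (x y : triple) : triple :=
  (x.1.1 * y.1.1 + x.1.2 * y.1.2, x.1.1 * y.1.2 + x.1.2 * y.1.1, x.2 * y.2 + x.2 + y.2).
Definition topp (x : triple) : triple := (x.1.2, x.1.1, x.2).

Lemma tadd_teq x x' y : teq x x' -> teq (tadd x y) (tadd x' y).
Proof.
case: x => [[a b] c]; case: x' => [[a' b'] c']; case: y => [[d e] f]; rewrite /teq /= => H.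
transitivity ((f + 1) * (f + 1) * (a * (c' + 1) + b' * (c + 1)) +
  (f + 1) * (d + e) * (c + 1) * (c' + 1)); first by ring.
by rewrite H; ring.
Qed.

Lemma tmul_teq x x' y : teq x x' -> teq (tmul x y) (tmul x' y).
Proof.
case: x => [[a b] c]; case: x' => [[a' b'] c']; case: y => [[d e] f]; rewrite /teq /= => H.
transitivity ((f + 1) * d * (a * (c' + 1) + b' * (c + 1)) +
  (f + 1) * e * (a' * (c + 1) + b * (c' + 1))); first by ring.
by rewrite -H {1}H; ring.
Qed.

Lemma topp_teq x x' : teq x x' -> teq (topp x) (topp x').
Proof. by rewrite /teq /= => H; rewrite addrC -H addrC. Qed.

Definition fadd (u v : mfield) : mfield := fpi (tadd (frepr u) (frepr v)).
Definition fmul (u v : mfield) : mfield := fpi (tmul (frepr u) (frepr v)).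
Definition fopp (u : mfield) : mfield := fpi (topp (frepr u)).

Lemma taddC x y : tadd x y = tadd y x.
Proof. by rewrite /tadd; congr (_, _, _); ring. Qed.
Lemma tmulC x y : tmul x y = tmul y x.
Proof. by rewrite /tmul; congr (_, _, _); ring. Qed.

Lemma faddE x y : fadd (fpi x) (fpi y) = fpi (tadd x y).
Proof.
apply/fpi_eq/(teq_trans (tadd x (frepr (fpi y)))); first exact/tadd_teq/teq_frepr.
by rewrite !(taddC x); apply/tadd_teq/teq_frepr.
Qed.

Lemma fmulE x y : fmul (fpi x) (fpi y) = fpi (tmul x y).
Proof.
apply/fpi_eq/(teq_trans (tmul x (frepr (fpi y)))); first exact/tmul_teq/teq_frepr.
by rewrite !(tmulC x); apply/tmul_teq/teq_frepr.
Qed.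

Lemma foppE x : fopp (fpi x) = fpi (topp x).
Proof. exact/fpi_eq/topp_teq/teq_frepr. Qed.

Definition finj (a : M) : mfield := fpi (a, 0, 0).

Ltac by_repr :=
  repeat match goal with
  | |- forall u : mfield, _ => let u := fresh "u" in
      intros u; rewrite <- (fpiK u); generalize (frepr u); clear u;
      let a := fresh "a" in let b := fresh "b" in let c := fresh "c" in intros [[a b] c]
  end; rewrite /finj ?(faddE, fmulE, foppE); apply/fpi_eq; rewrite /teq /=; ring.

Lemma faddA u v w : fadd u (fadd v w) = fadd (fadd u v) w.
Proof. by move: u v w; by_repr. Qed.
Lemma faddC u v : fadd u v = fadd v u.
Proof. by move: u v; by_repr. Qed.
Lemma f0add u : fadd (finj 0) u = u.
Proof. by move: u; by_repr. Qed.
Lemma fNadd u : fadd (fopp u) u = finj 0.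
Proof. by move: u; by_repr. Qed.
Lemma fmulA u v w : fmul u (fmul v w) = fmul (fmul u v) w.
Proof. by move: u v w; by_repr. Qed.
Lemma fmulC u v : fmul u v = fmul v u.
Proof. by move: u v; by_repr. Qed.
Lemma f1mul u : fmul (finj 1) u = u.
Proof. by move: u; by_repr. Qed.
Lemma fmulDl u v w : fmul (fadd u v) w = fadd (fmul u w) (fmul v w).
Proof. by move: u v w; by_repr. Qed.

Lemma finj_eq a b : finj a = finj b -> a = b.
Proof. by move/fpi_eq; rewrite /teq /= !mul0r !addr0 !add0r !mulr1. Qed.

Lemma finv_ex (u : mfield) : exists v, u <> finj 0 -> fmul v u = finj 1.
Proof.
rewrite -(fpiK u); case: (frepr u) => [[a b] c].
case: (mlt_total m a b) => [/mltP [d ->]|->|/mltP [d ->]].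
(* The value of [u] is $-(d+1)/(c+1)$, with inverse $-(c+1)/(d+1)$. *)
- exists (fpi (0, c + 1, d)) => _; rewrite fmulE; apply/fpi_eq; rewrite /teq /=; ring.
- by exists (finj 0); case; apply/fpi_eq; rewrite /teq /=; ring.
- exists (fpi (c + 1, 0, d)) => _; rewrite fmulE; apply/fpi_eq; rewrite /teq /=; ring.
Qed.

Definition finv (u : mfield) : mfield :=
  if decide (u = finj 0) then finj 0
  else proj1_sig (constructive_indefinite_description _ (finv_ex u)).

Lemma fmulV u : u <> finj 0 -> fmul (finv u) u = finj 1.
Proof.
move=> H; rewrite /finv; case: decideP => // _.
by case: constructive_indefinite_description => v /= ->.
Qed.

Lemma finv0 : finv (finj 0) = finj 0.
Proof. by rewrite /finv; case: decideP. Qed.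

Definition fnonneg (u : mfield) : bool := decide (exists a c, u = fpi (a, 0, c)).

Lemma fnonneg_total u : fnonneg u || fnonneg (fopp u).
Proof.
rewrite -(fpiK u); case: (frepr u) => [[a b] c].
have Hb x y : fnonneg (fpi (x + y, x, c)).
  by apply/decideP; exists y, c; apply/fpi_eq; rewrite /teq /=; ring.
rewrite foppE /topp /=.
case: (mlt_total m a b) => [/mltP [d ->]|->|/mltP [d ->]].
- by rewrite -addrA Hb orbT.
- by rewrite -{1}[b]addr0 Hb.
- by rewrite -addrA Hb.
Qed.

End FractionField.

HB.instance Definition _ m := classical_hasDecEq (mfield m).
HB.instance Definition _ m := classical_hasChoice (mfield m).
HB.instance Definition _ m :=
  GRing.isZmodule.Build (mfield m) (@faddA m) (@faddC m) (@f0add m) (@fNadd m).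

Lemma f1_neq0 m : finj m 1 != 0.
Proof. by apply/eqP => /finj_eq /eqP; rewrite oner_eq0. Qed.

HB.instance Definition _ m :=
  GRing.Zmodule_isComNzRing.Build (mfield m) (@fmulA m) (@fmulC m) (@f1mul m) (@fmulDl m)
    (@f1_neq0 m).

Lemma fmulVf m (u : mfield m) : u != 0 -> finv m u * u = 1.
Proof. by move/eqP => H; apply: fmulV. Qed.

HB.instance Definition _ m :=
  GRing.ComNzRing_isField.Build (mfield m) (@fmulVf m) (@finv0 m).

Section FieldOrder.

Variable m : rca0_model.
Notation F := (mfield m).
Implicit Types u v : F.

Definition fle u v : bool := fnonneg m (v - u).
Definition flt u v : bool := (v != u) && fle u v.
Definition fnorm u : F := if fle 0 u then u else - u.

Lemma fnonnegP u : reflect (exists a c, u = fpi m (a, 0, c)) (fnonneg m u).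
Proof. exact: decideP. Qed.

Lemma fle0_add u v : fle 0 u -> fle 0 v -> fle 0 (u + v).
Proof.
rewrite /fle !subr0 => /fnonnegP [a [c ->]] /fnonnegP [a' [c' ->]].
apply/fnonnegP; exists (a * (c' + 1) + a' * (c + 1)), (c * c' + c + c').
by rewrite [LHS]faddE; apply/fpi_eq; rewrite /teq /=; ring.
Qed.

Lemma fle0_mul u v : fle 0 u -> fle 0 v -> fle 0 (u * v).
Proof.
rewrite /fle !subr0 => /fnonnegP [a [c ->]] /fnonnegP [a' [c' ->]].
apply/fnonnegP; exists (a * a'), (c * c' + c + c').
by rewrite [LHS]fmulE; apply/fpi_eq; rewrite /teq /=; ring.
Qed.

Lemma fle0_anti u : fle 0 u -> fle u 0 -> u = 0.
Proof.
rewrite /fle subr0 sub0r => /fnonnegP [a [c ->]] /fnonnegP [a' [c' H]].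
have {H} := congr1 -%R H; rewrite opprK => /esym; rewrite [LHS]foppE => /fpi_eq.
rewrite /teq /topp /= !mul0r add0r => H.
have H0 : a * (c' + 1) + a' * (c + 1) = 0 by rewrite -H; ring.
have /(mmulIr m c' a 0) -> : a * (c' + 1) = 0 * (c' + 1) by rewrite mul0r; apply: maddI0 H0.
by apply/fpi_eq; rewrite /teq /=; ring.
Qed.

Lemma fsub_ge0 u v : fle 0 (v - u) = fle u v.
Proof. by rewrite /fle subr0. Qed.

Lemma fle0_total u : fle 0 u || fle u 0.
Proof. by rewrite /fle subr0 sub0r; apply: fnonneg_total. Qed.

Lemma fnormN u : fnorm (- u) = fnorm u.
Proof.
rewrite /fnorm; have := fle0_total u; have := @fle0_anti u; rewrite /fle !subr0 !sub0r opprK.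
case: (fnonneg m u); case: (fnonneg m (- u)) => //= H _.
by rewrite H // oppr0.
Qed.

Lemma fge0_norm u : fle 0 u -> fnorm u = u.
Proof. by rewrite /fnorm => ->. Qed.

Lemma flt_def u v : flt u v = (v != u) && fle u v.
Proof. by []. Qed.

End FieldOrder.

HB.instance Definition _ m :=
  Num.IntegralDomain_isLeReal.Build (mfield m) (@fle0_add m) (@fle0_mul m) (@fle0_anti m)
    (@fsub_ge0 m) (@fle0_total m) (@fnormN m) (@fge0_norm m) (@flt_def m).

Lemma finj_is_nmod_morphism m : nmod_morphism (finj m).
Proof.
split=> // a b; rewrite /finj [RHS]faddE; apply/fpi_eq; rewrite /teq /=; ring.
Qed.

Lemma finj_is_monoid_morphism m : monoid_morphism (finj m).
Proof.
split=> // a b; rewrite /finj [RHS]fmulE; apply/fpi_eq; rewrite /teq /=; ring.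
Qed.

HB.instance Definition _ m := GRing.isNmodMorphism.Build (mnum m) (mfield m) (finj m)
  (@finj_is_nmod_morphism m).
HB.instance Definition _ m := GRing.isMonoidMorphism.Build (mnum m) (mfield m) (finj m)
  (@finj_is_monoid_morphism m).

Notation "a %:f" := (finj _ a) (at level 2, left associativity, format "a %:f") : ring_scope.

(** * The embedding of the numbers into the field *)

Section Embedding.

Variable m : rca0_model.
Notation M := (mnum m).
Notation F := (mfield m).
Implicit Types a b c : M.

Lemma finj_inj : injective (finj m).
Proof. exact: finj_eq. Qed.

Lemma fge0P (u : F) : 0 <= u <-> exists a c, u = a%:f / (c%:f + 1).
Proof.
have E a c : fpi m (a, 0, c) = a%:f / (c%:f + 1).
  have Hc : c%:f + 1 != 0 :> F.
    by rewrite -[1]/(1%:f) -rmorphD; apply/eqP => /finj_inj; apply: msucc_neq.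
  apply: (mulIf Hc); rewrite mulfVK //.
  rewrite -[1]/(1%:f) -rmorphD [LHS]fmulE; apply/fpi_eq; rewrite /teq /=; ring.
rewrite -[0 <= u]/(fle m 0 u) /fle subr0; split=> [/fnonnegP [a [c ->]]|[a [c ->]]].
- by exists a, c.
- by apply/fnonnegP; exists a, c.
Qed.

Lemma finj_ge0 a : 0 <= a%:f :> F.
Proof. by apply/fge0P; exists a, 0; rewrite rmorph0 add0r divr1. Qed.

(** Discreteness of the numbers. Strict inequalities among hypotheses are passed to the field in
    this form, since linear arithmetic there does not know that nothing lies between [a] and
    [a + 1]. *)
Lemma finj_ltS a b : a <m b <-> a%:f + 1 <= b%:f :> F.
Proof.
split=> [/mltP [c ->]|H].
- by rewrite !rmorphD rmorph1; have := finj_ge0 c; lra.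
- case: (mlt_total m a b) => // [E|/mltP [c E]]; move: H; rewrite {}E ?rmorphD ?rmorph1.
  + by move=> H; exfalso; lra.
  + by have := finj_ge0 c => H H'; exfalso; lra.
Qed.

Lemma finj_lt a b : a <m b <-> a%:f < b%:f :> F.
Proof.
split=> [/finj_ltS|H]; first by lra.
by case: (mlt_total m a b) => [//|E|/finj_ltS E]; [move: H; rewrite E ltxx|exfalso; lra].
Qed.

Lemma finj_le a b : a <=m b <-> a%:f <= b%:f :> F.
Proof.
split=> [[/finj_lt|->]|H]; [lra | by [] | ].
case: (mlt_total m a b) => [|E|/finj_lt E]; [by left | by right | by exfalso; lra].
Qed.

Lemma mleP a b : a <=m b <-> exists c, b = a + c.
Proof.
split=> [[/mltP [c ->]|->]|[c ->]]; first by exists (c + 1); ring.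
- by exists 0; ring.
- by apply/finj_le; have := finj_ge0 c; lra.
Qed.

End Embedding.

#[global] Opaque fadd fmul fopp finv finj fpi fle flt fnorm.

(* Linear arithmetic in a model, through its ordered field of fractions. *)
Ltac m_hyps :=
  repeat match goal with
  | H : mlt _ _ _ |- _ => apply finj_ltS in H
  | H : mle _ _ _ |- _ => apply finj_le in H
  | m : rca0_model, H : @eq ?T _ _ |- _ => unify T (mnum m); apply (f_equal (finj m)) in H
  | H : ~ mlt _ _ _ |- _ => rewrite finj_lt in H; move/negP: H; rewrite -leNgt => H
  | H : ~ mle _ _ _ |- _ => rewrite finj_le in H; move/negP: H; rewrite -ltNge => H
  end.
Ltac m_add_pos :=
  try match goal with
  | m : rca0_model |- _ =>
    repeat match goal with
    | a : mnum m |- _ =>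
      lazymatch goal with
      | H : is_true (0 <= finj m a) |- _ => fail
      | _ => have ? := finj_ge0 m a
      end
    end
  end.
(* The field tactics choke on equalities of numbers when the goal is [False]. *)
Ltac m_clear :=
  repeat match goal with
  | m : rca0_model, H : @eq ?T _ _ |- _ => unify T (mnum m); clear H
  end.
Ltac flra := intros; m_clear; lra.
Ltac fnra := intros; m_clear; nra.
Ltac m_to_field :=
  intros; try match goal with |- ~ _ => intro end; m_hyps; m_add_pos;
  lazymatch goal with
  | |- mlt _ _ _ => apply/finj_lt
  | |- mle _ _ _ => apply/finj_le
  | |- @eq (mnum _) _ _ => apply/finj_inj
  | |- _ => idtac
  end.
Ltac mlra := m_to_field; lra.
Ltac mnra := m_to_field; nra.

Section Order2.

Variable m : rca0_model.
Notation M := (mnum m).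
Notation F := (mfield m).
Implicit Types a b c : M.

Lemma mlt_le a b : a <m b -> a <=m b.
Proof. mlra. Qed.
Lemma mle_refl a : a <=m a.
Proof. mlra. Qed.
Lemma mle_trans b a c : a <=m b -> b <=m c -> a <=m c.
Proof. mlra. Qed.
Lemma mlt_le_trans b a c : a <m b -> b <=m c -> a <m c.
Proof. mlra. Qed.
Lemma mle_anti a b : a <=m b -> b <=m a -> a = b.
Proof. mlra. Qed.
Lemma mlt_or_le a b : a <m b \/ b <=m a.
Proof. by case: (mlt_total m a b) => H; [left|right; mlra|right; mlra]. Qed.
Lemma mltNge a b : ~ a <m b <-> b <=m a.
Proof. by split=> H; [case: (mlt_or_le a b)|mlra]. Qed.
Lemma mleNgt a b : ~ a <=m b <-> b <m a.
Proof. by split=> H; [case: (mlt_or_le b a)|mlra]. Qed.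
Lemma mle_S a b : a <=m b + 1 -> a <=m b \/ a = b + 1.
Proof. by case; [left; apply/mlt_S|right]. Qed.
Lemma mge0 a : 0 <=m a.
Proof. mlra. Qed.
Lemma m_pos_succ a : 0 <m a -> exists b, a = b + 1.
Proof. by move=> /mltP [c ->]; exists c; ring. Qed.

End Order2.

(** * Recursive predicates and functions of a model *)

Arguments D0_ext {m P Q}.
Arguments S1_ext {m P Q}.
Arguments D0_subst {m P}.

Section Recursive.

Variable m : rca0_model.
Notation M := (mnum m).
Notation env := (nat -> M).

Ltac pt := repeat first
  [ apply: (PT_var m) | apply: (PT_cst m) | apply: PT_add | apply: PT_mul ].

Lemma D0_not (P : env -> Prop) : D0 m P -> D0 m (fun e => ~ P e).
Proof. by move=> H; apply: D0_imp => //; apply: D0_bot. Qed.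

Lemma D0_subst2 (Q : M -> env -> Prop) (s : env -> M) (tau : nat -> env -> M) :
  PT m s -> (forall i, PT m (tau i)) ->
  D0 m (fun e => Q (e 0%N) (tail e)) -> D0 m (fun e => Q (s e) (fun i => tau i e)).
Proof.
move=> Hs Ht /(D0_subst (fun i => if i is S j then tau j else s)); apply.
by case.
Qed.

Lemma S1_subst (P : env -> Prop) (tau : nat -> env -> M) :
  (forall i, PT m (tau i)) -> S1 m P -> S1 m (fun e => P (fun i => tau i e)).
Proof.
move=> Ht [Q [HQ HP]]; exists (fun y e => Q y (fun i => tau i e)); split; last by move=> e.
apply: (D0_subst2 Q (fun e => e 0%N) (fun i e => tau i (tail e))); [by pt| |by []] => i.
by apply: (PT_subst m (tau i) (fun j e => e (S j))) => // j; pt.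
Qed.

(** One number [w] bounds both [x] and its witness, which contracts two unbounded quantifiers into
    one. *)
Lemma S1_ex (P : M -> env -> Prop) :
  S1 m (fun e => P (e 0%N) (tail e)) -> S1 m (fun e => exists x, P x e).
Proof.
move=> [Q [HQ HP]].
exists (fun w e => exists x, x <m w /\ exists y, y <m w /\ Q y (scons x e)); split.
- apply: D0_bex; first by pt.
  apply: D0_bex; first by pt.
  apply: (D0_subst2 Q (fun e => e 0%N) (fun i e => scons (e 1%N) (fun j => e j.+3) i)) => //.
  + by pt.
  + by case=> [|i]; pt.
- move=> e; have E x : P x e <-> exists y, Q y (scons x e) by apply: (HP (scons x e)).
  split=> [[x /E [y Hy]]|[w [x [_ [y [_ Hy]]]]]]; last by exists x; apply/E; exists y.
  by exists (x + y + 1), x; split; [mlra|exists y; split; [mlra|]].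
Qed.

Lemma S1_and (P Q : env -> Prop) : S1 m P -> S1 m Q -> S1 m (fun e => P e /\ Q e).
Proof.
move=> [P' [HP' HP]] [Q' [HQ' HQ]].
exists (fun w e => (exists x, x <m w /\ P' x e) /\ (exists x, x <m w /\ Q' x e)); split.
- have H R : D0 m (fun e => R (e 0%N) (tail e)) ->
    D0 m (fun e => exists x, x <m (e 0%N) /\ R x (tail e)).
    move=> HR; apply: D0_bex; first by pt.
    apply: (D0_subst2 R (fun e => e 0%N) (fun i e => e i.+2)) => //; first by pt.
    by move=> i; pt.
  by apply: D0_and; apply: H.
- move=> e; rewrite HP HQ; split=> [[[x Hx] [y Hy]]|[w [[x [_ Hx]] [y [_ Hy]]]]].
  + by exists (x + y + 1); split; [exists x|exists y]; split=> //; mlra.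
  + by split; [exists x|exists y].
Qed.

Lemma S1_or (P Q : env -> Prop) : S1 m P -> S1 m Q -> S1 m (fun e => P e \/ Q e).
Proof.
move=> [P' [HP' HP]] [Q' [HQ' HQ]].
exists (fun w e => P' w e \/ Q' w e); split; first exact: D0_or.
move=> e; rewrite HP HQ; split=> [[[x Hx]|[x Hx]]|[x [Hx|Hx]]].
- by exists x; left.
- by exists x; right.
- by left; exists x.
- by right; exists x.
Qed.

(* Bounded quantification needs collection: induction bounds the witnesses. *)
Lemma S1_ball (t : env -> M) (P : M -> env -> Prop) :
  PT m t -> S1 m (fun e => P (e 0%N) (tail e)) ->
  S1 m (fun e => forall x, x <m t e -> P x e).
Proof.
move=> Ht [Q [HQ HP]].
exists (fun w e => forall x, x <m t e -> exists y, y <m w /\ Q y (scons x e)); split.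
  apply: (D0_ball m (fun e => t (tail e)) (fun x e => exists y, y <m e 0%N /\ Q y (scons x (tail e)))).
    by apply: (PT_subst m t (fun j e => e (S j))) => // j; pt.
  apply: D0_bex; first by pt.
  apply: (D0_subst2 Q (fun e => e 0%N) (fun i e => scons (e 1%N) (fun j => e j.+3) i)) => //.
  - by pt.
  - by case=> [|i]; pt.
move=> e; have E x : P x e <-> exists y, Q y (scons x e) by apply: (HP (scons x e)).
split=> [H|[w H] x /H [y [_ Hy]]]; last by apply/E; exists y.
pose B n w := forall x, x <m n -> x <m t e -> exists y, y <m w /\ Q y (scons x e).
suff [w Hw] : exists w, B (t e) w by exists w => x Hx; apply: Hw.
apply: (m_ind m (fun n => exists w, B n w)) (t e) => [||n [w Hw]].
- apply: (S1_exD m (fun w e' => B (e' 0%N) w)); apply: D0_ball; first by pt.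
  apply: D0_imp; first by apply: D0_lt; pt.
  apply: D0_bex; first by pt.
  apply: (D0_subst2 Q (fun e => e 0%N) (fun i e' => scons (e' 1%N) e i)) => //.
  + by pt.
  + by case=> [|i]; pt.
- by exists 0 => x /m_nlt0.
- case: (classic (n <m t e)) => [/H /E [y Hy]|Hn].
  + exists (w + y + 1) => x /mlt_S [Hx|->] Hx'.
    * by case: (Hw x Hx Hx') => z [Hz HQz]; exists z; split=> //; mlra.
    * by exists y; split=> //; mlra.
  + exists w => x /mlt_S [|->] //; exact: Hw.
Qed.

Definition D1 (P : env -> Prop) : Prop := S1 m P /\ S1 m (fun e => ~ P e).

(** A $\Sigma^0_1$ graph is enough: since [f] is total, a condition on [f e] can be stated by its
    value existentially, and so can its negation. Composition with such functions thus preserves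
    [D1]. *)
Definition isF (f : env -> M) : Prop := S1 m (fun e => e 0%N = f (tail e)).

Lemma D1_S1 P : D1 P -> S1 m P.
Proof. by case. Qed.

Lemma D0_D1 P : D0 m P -> D1 P.
Proof. by move=> H; split; apply: D0_S1 => //; apply: D0_not. Qed.

Lemma D1_ext P Q : D1 P -> (forall e, P e <-> Q e) -> D1 Q.
Proof.
move=> [H H'] E; split; [apply: S1_ext H _ | apply: S1_ext H' _] => e; rewrite E //.
Qed.

Arguments D1_ext {P Q}.

Lemma D1_not P : D1 P -> D1 (fun e => ~ P e).
Proof. by move=> [H H']; split=> //; apply: S1_ext H _ => e; split; [tauto|apply: NNPP]. Qed.

Lemma D1_and P Q : D1 P -> D1 Q -> D1 (fun e => P e /\ Q e).
Proof.
move=> [H H'] [K K']; split; first exact: S1_and.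
by apply: S1_ext (S1_or _ _ H' K') _ => e; tauto.
Qed.

Lemma D1_or P Q : D1 P -> D1 Q -> D1 (fun e => P e \/ Q e).
Proof.
move=> [H H'] [K K']; split; first exact: S1_or.
by apply: S1_ext (S1_and _ _ H' K') _ => e; tauto.
Qed.

Lemma D1_imp P Q : D1 P -> D1 Q -> D1 (fun e => P e -> Q e).
Proof.
move=> HP HQ; apply: D1_ext (D1_or _ _ (D1_not _ HP) HQ) _ => e; tauto.
Qed.

Lemma D1_iff P Q : D1 P -> D1 Q -> D1 (fun e => P e <-> Q e).
Proof. by move=> HP HQ; apply: D1_and; apply: D1_imp. Qed.

Lemma S1_comp (P : M -> env -> Prop) f :
  isF f -> S1 m (fun e => P (e 0%N) (tail e)) -> S1 m (fun e => P (f e) e).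
Proof.
move=> Hf HP; apply: S1_ext (S1_ex (fun y e => y = f e /\ P y e) _) _.
- exact: S1_and.
- by move=> e; split=> [[y [-> //]]|H]; exists (f e).
Qed.

Lemma D1_comp (P : M -> env -> Prop) f :
  isF f -> D1 (fun e => P (e 0%N) (tail e)) -> D1 (fun e => P (f e) e).
Proof.
move=> Hf [H H']; split; first exact: S1_comp.
exact: (S1_comp (fun y e => ~ P y e)).
Qed.

Lemma D1_subst (P : env -> Prop) (tau : nat -> env -> M) :
  (forall i, PT m (tau i)) -> D1 P -> D1 (fun e => P (fun i => tau i e)).
Proof.
by move=> H [H1 H2]; split; [apply: S1_subst | apply: (S1_subst (fun e => ~ P e))].
Qed.

Lemma isF_subst (f : env -> M) (tau : nat -> env -> M) :
  (forall i, PT m (tau i)) -> isF f -> isF (fun e => f (fun i => tau i e)).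
Proof.
move=> H Hf.
apply: (S1_subst _ (fun i e => scons (e 0%N) (fun j => tau j (tail e)) i)) Hf => -[|i]; first by pt.
by apply: (PT_subst m (tau i) (fun j e => e (S j))) => // j; pt.
Qed.

Lemma isF_comp (g : M -> env -> M) f :
  isF f -> isF (fun e => g (e 0%N) (tail e)) -> isF (fun e => g (f e) e).
Proof.
move=> Hf Hg; apply: (S1_comp (fun y e => e 0%N = g y (tail e)) (fun e => f (tail e))).
- by apply: (isF_subst f (fun j e => e (S j))) => // j; pt.
- apply: (S1_subst _ (fun i e => scons (e 1%N) (scons (e 0%N) (fun j => e j.+2)) i)) Hg.
  by case=> [|[|i]]; pt.
Qed.

Lemma isF_PT f : PT m f -> isF f.
Proof.
move=> Hf; apply/D0_S1/D0_eq; first by pt.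
by apply: (PT_subst m f (fun j e => e (S j))) => // j; pt.
Qed.

Lemma isF_var i : isF (fun e => e i).
Proof. by apply: isF_PT; pt. Qed.

Lemma isF_cst c : isF (fun _ => c).
Proof. by apply: isF_PT; pt. Qed.

Lemma isF_graph (R : M -> env -> Prop) f :
  (forall e y, R y e <-> y = f e) -> S1 m (fun e => R (e 0%N) (tail e)) -> isF f.
Proof. by move=> E H; apply: S1_ext H _ => e; rewrite E. Qed.

Lemma isF_ext f g : f =1 g -> isF f -> isF g.
Proof. by move=> E; rewrite (functional_extensionality _ _ E). Qed.

Lemma D1_app1 (P : M -> Prop) s : D1 (fun e => P (e 0%N)) -> isF s -> D1 (fun e => P (s e)).
Proof.
move=> HP Hs; apply: (D1_comp (fun y e => P y)) => //.
Qed.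

Lemma D1_app2 (P : M -> M -> Prop) s t :
  D1 (fun e => P (e 0%N) (e 1%N)) -> isF s -> isF t -> D1 (fun e => P (s e) (t e)).
Proof.
move=> HP Hs Ht; apply: (D1_comp (fun y e => P y (t e))) => //.
apply: (D1_comp (fun y e => P (e 0%N) y) (fun e => t (tail e))).
- by apply: (isF_subst t (fun j e => e (S j))) => // j; pt.
- by apply: (D1_subst _ (fun i e => scons (e 1%N) (scons (e 0%N) (fun j => e j.+2)) i)) HP => -[|[|i]]; pt.
Qed.

Lemma isF_app1 (g : M -> M) s : isF (fun e => g (e 0%N)) -> isF s -> isF (fun e => g (s e)).
Proof. by move=> Hg Hs; apply: (isF_comp (fun y e => g y)). Qed.

Lemma isF_app2 (g : M -> M -> M) s t :
  isF (fun e => g (e 0%N) (e 1%N)) -> isF s -> isF t -> isF (fun e => g (s e) (t e)).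
Proof.
move=> Hg Hs Ht; apply: (isF_comp (fun y e => g y (t e))) => //.
apply: (isF_comp (fun y e => g (e 0%N) y) (fun e => t (tail e))).
- by apply: (isF_subst t (fun j e => e (S j))) => // j; pt.
- by apply: (isF_subst _ (fun i e => scons (e 1%N) (scons (e 0%N) (fun j => e j.+2)) i)) Hg => -[|[|i]]; pt.
Qed.

Lemma isF_app3 (g : M -> M -> M -> M) r s t :
  isF (fun e => g (e 0%N) (e 1%N) (e 2%N)) -> isF r -> isF s -> isF t ->
  isF (fun e => g (r e) (s e) (t e)).
Proof.
have Hl f : isF f -> isF (fun e => f (tail e)).
  by move=> Hf; apply: (isF_subst f (fun j e => e (S j))) => // j; pt.
move=> Hg Hr Hs Ht; apply: (isF_comp (fun y e => g y (s e) (t e))) => //.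
apply: (isF_comp (fun y e => g (e 0%N) y (t (tail e))) (fun e => s (tail e))); first exact: Hl.
apply: (isF_comp (fun y e => g (e 1%N) (e 0%N) y) (fun e => t (tail (tail e)))).
- by apply: (Hl (fun e => t (tail e))); apply: Hl.
- by apply: (isF_subst _ (fun i e => scons (e 2%N) (scons (e 1%N) (scons (e 0%N) (fun j => e j.+3))) i)) Hg
     => -[|[|[|i]]]; pt.
Qed.

Lemma D1_app3 (P : M -> M -> M -> Prop) r s t :
  D1 (fun e => P (e 0%N) (e 1%N) (e 2%N)) -> isF r -> isF s -> isF t ->
  D1 (fun e => P (r e) (s e) (t e)).
Proof.
have Hl f : isF f -> isF (fun e => f (tail e)).
  by move=> Hf; apply: (isF_subst f (fun j e => e (S j))) => // j; pt.
move=> HP Hr Hs Ht; apply: (D1_comp (fun y e => P y (s e) (t e))) => //.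
apply: (D1_comp (fun y e => P (e 0%N) y (t (tail e))) (fun e => s (tail e))); first exact: Hl.
apply: (D1_comp (fun y e => P (e 1%N) (e 0%N) y) (fun e => t (tail (tail e)))).
- by apply: (Hl (fun e => t (tail e))); apply: Hl.
- by apply: (D1_subst _ (fun i e => scons (e 2%N) (scons (e 1%N) (scons (e 0%N) (fun j => e j.+3))) i)) HP
     => -[|[|[|i]]]; pt.
Qed.

Lemma isF_add s t : isF s -> isF t -> isF (fun e => s e + t e).
Proof. by apply: (isF_app2 +%R); apply: isF_PT; pt. Qed.

Lemma isF_mul s t : isF s -> isF t -> isF (fun e => s e * t e).
Proof. by apply: (isF_app2 *%R); apply: isF_PT; pt. Qed.

Lemma isF_pair s t : isF s -> isF t -> isF (fun e => mpair m (s e) (t e)).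
Proof. by apply: (isF_app2 (mpair m)); apply: isF_PT; rewrite /mpair; pt. Qed.

Lemma D1_eq s t : isF s -> isF t -> D1 (fun e => s e = t e).
Proof. by apply: (D1_app2 eq); apply/D0_D1/D0_eq; pt. Qed.

Lemma D1_lt s t : isF s -> isF t -> D1 (fun e => s e <m t e).
Proof. by apply: (D1_app2 (mlt m)); apply/D0_D1/D0_lt; pt. Qed.

Lemma D1_le s t : isF s -> isF t -> D1 (fun e => s e <=m t e).
Proof. by move=> Hs Ht; apply: D1_or; [apply: D1_lt | apply: D1_eq]. Qed.

Lemma D1_mem s X : isF s -> D1 (fun e => mmem m (s e) X).
Proof. by apply: (D1_app1 (fun x => mmem m x X)); apply/D0_D1/D0_mem; pt. Qed.

Lemma D1_cst (P : Prop) : D1 (fun _ => P).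
Proof.
have H (Q : Prop) : S1 m (fun _ => Q).
  apply: D0_S1; case: (classic Q) => HQ.
  - by apply: D0_ext (D0_not _ (D0_bot m)) _; tauto.
  - by apply: D0_ext (D0_bot m) _; tauto.
by split.
Qed.

Lemma S1_ballF (t : env -> M) (P : M -> env -> Prop) :
  isF t -> S1 m (fun e => P (e 0%N) (tail e)) ->
  S1 m (fun e => forall x, x <m t e -> P x e).
Proof.
move=> Ht HP; apply: (S1_comp (fun y e => forall x, x <m y -> P x e)) => //.
apply: S1_ball; first by pt.
by apply: (S1_subst _ (fun i e => scons (e 0%N) (fun j => e j.+2) i)) HP => -[|i]; pt.
Qed.

Lemma S1_bexF (t : env -> M) (P : M -> env -> Prop) :
  isF t -> S1 m (fun e => P (e 0%N) (tail e)) ->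
  S1 m (fun e => exists x, x <m t e /\ P x e).
Proof.
move=> Ht HP; apply: S1_ex; apply: S1_and => //.
apply/D1_S1/D1_lt; first exact: isF_var.
by apply: (isF_subst t (fun j e => e (S j))) => // j; pt.
Qed.

Lemma D1_ball (t : env -> M) (P : M -> env -> Prop) :
  isF t -> D1 (fun e => P (e 0%N) (tail e)) ->
  D1 (fun e => forall x, x <m t e -> P x e).
Proof.
move=> Ht [HP HN]; split; first exact: S1_ballF.
apply: S1_ext (S1_bexF t (fun x e => ~ P x e) Ht HN) _ => e; split=> [[x [H H']] K|H].
- exact/H'/K.
- apply: NNPP => K; apply: H => x Hx; apply: NNPP => H'; apply: K; by exists x.
Qed.

Lemma D1_bex (t : env -> M) (P : M -> env -> Prop) :
  isF t -> D1 (fun e => P (e 0%N) (tail e)) ->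
  D1 (fun e => exists x, x <m t e /\ P x e).
Proof.
move=> Ht [HP HN]; split; first exact: S1_bexF.
apply: S1_ext (S1_ballF t (fun x e => ~ P x e) Ht HN) _ => e.
by split=> [H [x [Hx Hx']]|H x Hx Hx']; [exact: H Hx Hx' | apply: H; exists x].
Qed.

Lemma D1_balle (t : env -> M) (P : M -> env -> Prop) :
  isF t -> D1 (fun e => P (e 0%N) (tail e)) ->
  D1 (fun e => forall x, x <=m t e -> P x e).
Proof.
move=> Ht HP; apply: D1_ext (D1_ball (fun e => t e + 1) P _ HP) _ => [|e].
  by apply: isF_add => //; apply: isF_cst.
by split=> H x Hx; apply: H; apply/mlt_S.
Qed.

Lemma D1_bexe (t : env -> M) (P : M -> env -> Prop) :
  isF t -> D1 (fun e => P (e 0%N) (tail e)) ->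
  D1 (fun e => exists x, x <=m t e /\ P x e).
Proof.
move=> Ht HP; apply: D1_ext (D1_bex (fun e => t e + 1) P _ HP) _ => [|e].
  by apply: isF_add => //; apply: isF_cst.
by split=> -[x [Hx H]]; exists x; split=> //; apply/mlt_S.
Qed.

Lemma isF_if (P : env -> Prop) s t :
  D1 P -> isF s -> isF t -> isF (fun e => if decide (P e) then s e else t e).
Proof.
have Hl f : isF f -> isF (fun e => f (tail e)).
  by move=> Hf; apply: (isF_subst f (fun j e => e (S j))) => // j; pt.
have HDl Q : D1 Q -> D1 (fun e => Q (tail e)).
  by move=> HQ; apply: (D1_subst Q (fun j e => e (S j))) => // j; pt.
move=> HP Hs Ht.
apply: (isF_graph (fun y e => (P e /\ y = s e) \/ (~ P e /\ y = t e))).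
  by move=> e y; case: decideP; tauto.
apply: D1_S1; apply: D1_or; apply: D1_and; try apply: D1_eq; try apply: isF_var;
  try apply: D1_not; by [apply: HDl | apply: Hl].
Qed.

Lemma D1_decide (P : env -> Prop) : D1 P -> D1 (fun e => decide (P e)).
Proof. by move=> H; apply: D1_ext H _ => e; split=> /decideP. Qed.

Lemma rec_ind (P : M -> Prop) : D1 (fun e => P (e 0%N)) ->
  P 0 -> (forall n, P n -> P (n + 1)) -> forall n, P n.
Proof. by move=> /D1_S1; apply: m_ind. Qed.

Lemma rec_strong_ind (P : M -> Prop) : D1 (fun e => P (e 0%N)) ->
  (forall n, (forall k, k <m n -> P k) -> P n) -> forall n, P n.
Proof.
move=> HP H n; apply: (H); apply: (rec_ind (fun n => forall k, k <m n -> P k)) n.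
- apply: D1_ball; first exact: isF_var.
  by apply: (D1_subst _ (fun i e => e 0%N)) HP => i; pt.
- by move=> k /m_nlt0.
- by move=> n IH k /mlt_S [/IH|->] //; apply: H.
Qed.

Lemma rec_least (P : M -> Prop) : D1 (fun e => P (e 0%N)) ->
  (exists n, P n) -> exists n, P n /\ forall k, k <m n -> ~ P k.
Proof.
move=> HP [n Hn]; apply: NNPP => H; suff HN : forall n, ~ P n by case: (HN n).
apply: (rec_strong_ind (fun n => ~ P n)) => [|k IH Hk]; last by apply: H; exists k.
exact: (D1_not (fun e => P (e 0%N))).
Qed.

Lemma rec_comprehension (P : M -> Prop) : D1 (fun e => P (e 0%N)) ->
  exists X, forall n, mmem m n X <-> P n.
Proof. by case; apply: comprehension. Qed.

(** Unbounded search. Choosing the least witness makes the choice recursive, since leastness is a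
    bounded condition. *)
Lemma isF_search (P : M -> M -> Prop) : D1 (fun e => P (e 0%N) (e 1%N)) ->
  (forall x, exists y, P x y) ->
  exists f : M -> M, isF (fun e => f (e 0%N)) /\ forall x, P x (f x).
Proof.
move=> HP H.
have HP' x : D1 (fun e => P x (e 0%N)).
  by apply: (D1_app2 P (fun _ => x) (fun e => e 0%N)) => //; [apply: isF_cst|apply: isF_var].
have H' x : exists y, P x y /\ forall k, k <m y -> ~ P x k by apply: rec_least.
pose f x := proj1_sig (constructive_indefinite_description _ (H' x)).
have Hf x : P x (f x) /\ forall k, k <m f x -> ~ P x k.
  by rewrite /f; case: constructive_indefinite_description.
exists f; split=> [|x]; last by case: (Hf x).
apply: (isF_graph (fun y e => P (e 0%N) y /\ forall k, k <m y -> ~ P (e 0%N) k)).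
  move=> e y; split=> [[H1 H2]|->]; last exact: Hf.
  case: (Hf (e 0%N)) => H3 H4; case: (mlt_total m y (f (e 0%N))) => // K.
  - by case: (H4 _ K).
  - by case: (H2 _ K).
apply: D1_S1; apply: D1_and.
  by apply: (D1_app2 P (fun e => e 1%N) (fun e => e 0%N)) => //; apply: isF_var.
apply: D1_ball; first exact: isF_var.
apply: D1_not; by apply: (D1_app2 P (fun e => e 2%N) (fun e => e 0%N)) => //; apply: isF_var.
Qed.

End Recursive.

Definition Rec1 m (f : mnum m -> mnum m) : Prop := isF m (fun e => f (e 0%N)).
Definition Rec2 m (f : mnum m -> mnum m -> mnum m) : Prop := isF m (fun e => f (e 0%N) (e 1%N)).
Definition Rec3 m (f : mnum m -> mnum m -> mnum m -> mnum m) : Prop :=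
  isF m (fun e => f (e 0%N) (e 1%N) (e 2%N)).
Definition Dec1 m (P : mnum m -> Prop) : Prop := D1 m (fun e => P (e 0%N)).
Definition Dec2 m (P : mnum m -> mnum m -> Prop) : Prop := D1 m (fun e => P (e 0%N) (e 1%N)).

Create HintDb rec.

(* Follows the shape of an expression; what it says on functions and predicates
   other than the built-in ones must be in the hypotheses or the hint database. *)
Ltac rec_fold :=
  lazymatch goal with
  | |- isF ?m (fun e => ?g (e 0%N) (e 1%N) (e 2%N)) => change (Rec3 m g)
  | |- isF ?m (fun e => ?g (e 0%N) (e 1%N)) => change (Rec2 m g)
  | |- isF ?m (fun e => ?g (e 0%N)) => change (Rec1 m g)
  | |- D1 ?m (fun e => ?P (e 0%N) (e 1%N)) => change (Dec2 m P)
  | |- D1 ?m (fun e => ?P (e 0%N)) => change (Dec1 m P)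
  end.
Ltac rec_known := rec_fold; solve [eassumption | auto with rec nocore].
Ltac rec :=
  cbv beta delta [tail];
  lazymatch goal with
  | |- Rec1 _ _ => red; rec
  | |- Rec2 _ _ => red; rec
  | |- Rec3 _ _ => red; rec
  | |- Dec1 _ _ => red; rec
  | |- Dec2 _ _ => red; rec
  | |- isF _ _ => first
    [ assumption | apply: isF_cst | apply: isF_var
    | apply: isF_add; rec | apply: isF_mul; rec | apply: isF_pair; rec
    | apply: isF_if; rec
    | apply: isF_app1; [rec_known | rec]
    | apply: isF_app2; [rec_known | rec | rec]
    | apply: isF_app3; [rec_known | rec | rec | rec] ]
  | |- D1 _ _ => first
    [ assumption | apply: D1_cst
    | apply: D1_ball; rec | apply: D1_bex; rec | apply: D1_balle; rec | apply: D1_bexe; rec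
    | apply: D1_le; rec
    | apply: D1_and; rec | apply: D1_or; rec | apply: D1_not; rec
    | apply: D1_eq; rec | apply: D1_lt; rec
    | apply: D1_mem; rec | apply: D1_decide; rec
    | apply: D1_app1; [rec_known | rec]
    | apply: D1_app2; [rec_known | rec | rec]
    | apply: D1_imp; rec ]
  end.

(** * Coding of finite sets and primitive recursion *)

Section Coding.

Variable m : rca0_model.
Notation M := (mnum m).
Notation F := (mfield m).
Implicit Types a b c i j k n u v w : M.
Notation pr := (mpair m).

Lemma mpairE i j : (pr i j)%:f = (i%:f + j%:f) * (i%:f + j%:f) + i%:f :> F.
Proof. by rewrite -[pr i j]/((i + j) * (i + j) + i) !rmorphD rmorphM rmorphD. Qed.

Lemma mpair_ge i j : i <=m pr i j /\ j <=m pr i j.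
Proof.
have Hs : i + j = 0 \/ exists s, i + j = s + 1 by apply: m_case.
have [Hi Hj] := (finj_ge0 m i, finj_ge0 m j).
split; apply/finj_le; rewrite mpairE; first by nra.
case: Hs => [|[s]] /(f_equal (finj m)); rewrite !rmorphD ?rmorph1 ?rmorph0 => E; first by nra.
by rewrite E; have Hs := finj_ge0 m s; nra.
Qed.

Lemma mpair_le i j i' j' : i <=m i' -> j <=m j' -> pr i j <=m pr i' j'.
Proof.
move=> /finj_le H /finj_le H'; apply/finj_le; rewrite !mpairE.
have [Hi Hj] := (finj_ge0 m i, finj_ge0 m j); nra.
Qed.

Lemma mpair_sum_le i j i' j' : pr i j = pr i' j' -> i + j <=m i' + j'.
Proof.
move=> /(f_equal (finj m)); rewrite !mpairE => E.
apply/mltNge => /finj_ltS; rewrite !rmorphD => H.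
have := (finj_ge0 m i, finj_ge0 m j); have := (finj_ge0 m i', finj_ge0 m j').
move=> [Hi' Hj'] [Hi Hj]; nra.
Qed.

Lemma mpair_inj i j i' j' : pr i j = pr i' j' -> i = i' /\ j = j'.
Proof.
move=> E; have H := mle_anti _ _ _ (mpair_sum_le _ _ _ _ E) (mpair_sum_le _ _ _ _ (esym E)).
move/(f_equal (finj m)): E; move/(f_equal (finj m)): H; rewrite !mpairE !rmorphD => H; rewrite H => E.
by split; apply: finj_inj; lra.
Qed.

Definition munpair p : M * M := if decide (exists i j, p = pr i j)
  then epsilon (inhabits (0, 0)) (fun x => p = pr x.1 x.2) else (0, 0).
Definition mfst p := (munpair p).1.
Definition msnd p := (munpair p).2.

Lemma munpair_pair i j : munpair (pr i j) = (i, j).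
Proof.
rewrite /munpair; case: decideP => [_|[]]; last by exists i, j.
have /mpair_inj [E1 E2] := epsilon_spec (inhabits (0, 0)) (fun x => pr i j = pr x.1 x.2)
  (ex_intro _ (i, j) erefl).
by rewrite [LHS]surjective_pairing -E1 -E2.
Qed.

Lemma mfst_pair i j : mfst (pr i j) = i.
Proof. by rewrite /mfst munpair_pair. Qed.

Lemma msnd_pair i j : msnd (pr i j) = j.
Proof. by rewrite /msnd munpair_pair. Qed.

Lemma rec_munpair (f : M -> M -> M) : Rec2 m f -> Rec1 m (fun p => f (munpair p).1 (munpair p).2).
Proof.
move=> Hf.
apply: (isF_graph m (fun y e =>
   (exists i, i <=m e 0%N /\ exists j, j <=m e 0%N /\ (e 0%N = pr i j /\ y = f i j)) \/
   (~ (exists i, i <=m e 0%N /\ exists j, j <=m e 0%N /\ e 0%N = pr i j)) /\ y = f 0 0)); last first.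
  by apply: D1_S1; rec.
move=> e y; case: (classic (exists i j, e 0%N = pr i j)) => [[i [j E]]|H].
- rewrite E munpair_pair; have [Hi Hj] := mpair_ge i j; split=> [|->]; last first.
    by left; exists i; split=> //; exists j.
  case=> [[i' [_ [j' [_ [/mpair_inj [-> ->] ->]]]]] //|[H _]].
  by case: H; exists i; split=> //; exists j.
- rewrite /munpair; case: decideP => // _; split=> [[[i [_ [j [_ [E _]]]]]|[]] //|->].
  + by case: H; exists i, j.
  + by right; split=> // -[i [_ [j [_ E]]]]; apply: H; exists i, j.
Qed.

Lemma rec_mfst : Rec1 m mfst.
Proof. by apply: (rec_munpair (fun i _ => i)); rec. Qed.

Lemma rec_msnd : Rec1 m msnd.
Proof. by apply: (rec_munpair (fun _ j => j)); rec. Qed.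

Definition mdvd (d a : M) : Prop := exists z, z <=m a /\ a = z * d.

Lemma mdvd_intro d a z : 0 <m d -> a = z * d -> mdvd d a.
Proof.
move=> /m_pos_succ [d' ->] ->; exists z; split=> //; apply/finj_le; rewrite !(rmorphM, rmorphD) rmorph1.
by have := (finj_ge0 m z, finj_ge0 m d') => -[Hz Hd]; nra.
Qed.

Lemma dec_mdvd : Dec2 m mdvd.
Proof. by rewrite /mdvd; rec. Qed.
Hint Resolve dec_mdvd : rec.

(** This takes the place of the factorial in Gödel's coding. The factorial function itself would
    require the recursion that the coding is meant to provide, whereas the existence of a multiple
    is a $\Sigma^0_1$ induction. *)
Lemma common_multiple n : exists b, 0 <m b /\ forall j, j <m n -> mdvd (j + 1) b.
Proof.
apply: (m_ind m (fun n => exists b, 0 <m b /\ forall j, j <m n -> mdvd (j + 1) b)) n => [||n [b [Hb H]]].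
- by apply: S1_ex; apply: D1_S1; rec.
- by exists 1; split=> [|j /m_nlt0 //]; apply/finj_lt; rewrite rmorph0 rmorph1; lra.
- exists (b * (n + 1)); split=> [|j /mlt_S [/H [z [_ ->]]|->]].
  + apply/finj_lt; rewrite rmorphM rmorphD rmorph0 rmorph1.
    by move/finj_ltS: Hb; rewrite rmorph0 => Hb; have := finj_ge0 m n; nra.
  + by apply: (mdvd_intro _ _ (z * (n + 1))); [mlra | ring].
  + by apply: (mdvd_intro _ _ b); [mlra | ring].
Qed.

Lemma mdvd_addl d a b : mdvd d a -> mdvd d (a + b) -> mdvd d b.
Proof.
case: (m_case m d) => [->|[d' E]].
  by move=> [x [_ ->]] [y [_]]; rewrite !mulr0 add0r => ->; exists 0; split; [mlra | rewrite mulr0].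
move=> [x [_ ->]] [y [_ Ey]]; have Hd : 0 <m d by rewrite E; mlra.
have Hxy : x <=m y.
  apply/mltNge => /mltP [z Ez]; move/(f_equal (finj m)): Ey; rewrite Ez E.
  rewrite !(rmorphM, rmorphD) rmorph1.
  have := (finj_ge0 m b, finj_ge0 m z, finj_ge0 m d', finj_ge0 m y) => -[[[? ?] ?] ?]; nra.
have [z Ez] := proj1 (mleP _ _ _) Hxy.
apply: (mdvd_intro _ _ z) => //; apply: (maddIr m (x * d)).
by rewrite addrC Ey Ez; ring.
Qed.

Lemma mdvd_mull d a b : mdvd d a -> mdvd d (b * a).
Proof.
move=> [x [_ ->]]; case: (m_case m d) => [->|[d' ->]].
  by rewrite !mulr0; exists 0; split; [mlra | rewrite mulr0].
by apply: (mdvd_intro _ _ (b * x)); [mlra | ring].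
Qed.

(* The moduli of the coding are pairwise coprime: a multiple of [j - i] is
   obtained from [1 + (i + 1) b] and [1 + (j + 1) b], and [j - i] divides [b]. *)
Lemma modulus_dvd b n i j a :
  (forall k, k <m n -> mdvd (k + 1) b) -> i <m n -> j <m n -> i <> j ->
  mdvd (1 + (j + 1) * b) (a * (1 + (i + 1) * b)) -> mdvd (1 + (j + 1) * b) a.
Proof.
move=> Hb Hi Hj Hij H; set d := 1 + (j + 1) * b in H *.
have [k [Hk Hd]] : exists k, k <m n /\ mdvd d ((k + 1) * a).
  have Hd' : mdvd d d.
    by apply: (mdvd_intro _ _ 1); [rewrite /d; have := mge0 m ((j + 1) * b); mlra | rewrite mul1r].
  case: (mlt_total m i j) => // /mltP [k E]; exists k; (split; first by clear -Hi Hj E; mlra).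
  - apply: (mdvd_addl _ ((i + 1) * a * d)); first exact: mdvd_mull.
    rewrite [X in mdvd _ X](_ : _ = (j + 1) * (a * (1 + (i + 1) * b))); first exact: mdvd_mull.
    by rewrite /d E; ring.
  - apply: (mdvd_addl _ ((j + 1) * (a * (1 + (i + 1) * b)))); first exact: mdvd_mull.
    rewrite [X in mdvd _ X](_ : _ = (i + 1) * a * d); first exact: mdvd_mull.
    by rewrite /d E; ring.
(* As $k + 1$ divides $b$, the modulus $d$ divides $(j+1)ba$, and $d a = (j+1)ba + a$. *)
have [z [_ E]] := Hb _ Hk.
apply: (mdvd_addl _ ((j + 1) * (z * ((k + 1) * a)))); first by do 2!apply: mdvd_mull.
rewrite [X in mdvd _ X](_ : _ = a * d); last by rewrite /d E; ring.
by apply: mdvd_mull; apply: (mdvd_intro _ _ 1); [rewrite /d; have := mge0 m ((j + 1) * b); mlra | rewrite mul1r].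
Qed.

(** A variant of Gödel's beta function for sets: membership of [i] is divisibility by the modulus of
    [i], so a code is a product of moduli and no simultaneous congruences have to be solved. *)
Definition coded (a b i : M) : Prop := mdvd (1 + (i + 1) * b) a.

(** The moduli of the members are multiplied one after the other. By [modulus_dvd] a new factor
    makes no further modulus divide the product. *)
Lemma coded_ex (P : M -> Prop) n : Dec1 m P ->
  exists a b, forall i, i <m n -> (coded a b i <-> P i).
Proof.
move=> HP; have [b [Hb0 Hb]] := common_multiple n.
suff [a Ha] : exists a, forall i, i <m n -> (coded a b i <-> i <m n /\ P i).
  by exists a, b => i Hi; rewrite Ha //; split=> [[]|].
suff H k : exists a, forall i, i <m n -> (coded a b i <-> i <m k /\ P i) by [].
apply: (m_ind m (fun k => exists a, forall i, i <m n -> (coded a b i <-> i <m k /\ P i))) k => [||k [a IH]].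
- apply: S1_ex; apply: D1_S1; rewrite /coded.
  by apply: D1_ball; [rec | apply: D1_and; apply: D1_imp; rec].
- exists 1 => i _; split=> [[z [_ E]]|[/m_nlt0 //]].
  case: (m_case m z) => [Ez|[z' Ez]]; move: E; rewrite Ez.
    by rewrite mul0r => E; mlra.
  have [b' Eb] := m_pos_succ _ _ Hb0; rewrite Eb => /(f_equal (finj m)).
  rewrite !(rmorphM, rmorphD) rmorph1.
  have [[Hi Hz] Hb'] := (finj_ge0 m i, finj_ge0 m z', finj_ge0 m b').
  have : 1 <= (i%:f + 1) * (b'%:f + 1) :> F by nra.
  by move: (_ * (b'%:f + 1)) => t Ht E; exfalso; mnra.
- case: (classic (P k)) => [Hk|Hk]; last first.
    exists a => i Hi; rewrite (IH i Hi); split=> -[H1 H2]; split=> //; first by mlra.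
    by move/mlt_S: H1 => [//|E]; move: H2; rewrite E.
  case: (mlt_or_le m k n) => Hkn; last first.
    exists a => i Hi; rewrite (IH i Hi); split=> -[H1 H2]; split=> //; first by mlra.
    by mlra.
  exists (a * (1 + (k + 1) * b)) => i Hi; split.
  + move=> H; case: (classic (i = k)) => [->|Hik]; first by split=> //; mlra.
    have [] : i <m k /\ P i; last by split=> //; mlra.
    by apply/IH => //; apply: (modulus_dvd b n k i) => // E; apply: Hik.
  + move=> [/mlt_S [H|->] HPi]; last first.
      apply: mdvd_mull; apply: (mdvd_intro _ _ 1); last by rewrite mul1r.
      by have := mge0 m ((k + 1) * b); mlra.
    by rewrite /coded [X in mdvd _ X]mulrC; apply: mdvd_mull; apply/(IH i Hi).
Qed.

Section PrimitiveRecursion.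

Variables (x0 : M -> M) (G : M -> M -> M -> M).
Hypothesis rec_x0 : Rec1 m x0.
Hypothesis rec_G : Rec3 m G.

(* [(a, b)] codes a set of pairs that contains the graph on [[0, n]] of the
   function defined by recursion, and is functional for values below [B]. *)
Definition computation (u n a b B : M) : Prop :=
  (forall k, k <=m n -> forall v, v <m B -> forall w, w <m B ->
     coded a b (pr k v) /\ coded a b (pr k w) -> v = w) /\
  (coded a b (pr 0 (x0 u)) /\ x0 u <m B) /\
  (forall k, k <m n -> exists v, v <m B /\
     (coded a b (pr k v) /\ coded a b (pr (k + 1) (G u k v)) /\ G u k v <m B)).

Definition computes (u n v : M) : Prop :=
  exists a b B, computation u n a b B /\ (v <m B /\ coded a b (pr n v)).

(** The bound [B] in a computation makes all quantifiers over values bounded. What remains unbounded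
    is [a], [b] and [B], so induction may establish that computations exist. *)
Lemma S1_computes : S1 m (fun e => computes (e 0%N) (e 1%N) (e 2%N)).
Proof.
do 3!apply: S1_ex; apply: D1_S1; rewrite /computation /coded.
apply: D1_and; last by rec.
apply: D1_and; last by rec.
apply: D1_balle; first by rec.
apply: D1_ball; first by rec.
apply: D1_ball; first by rec.
by apply: D1_imp; rec.
Qed.

Lemma computes_0 u : computes u 0 (x0 u).
Proof.
have [a [b Hab]] := coded_ex (fun p => p = pr 0 (x0 u)) (pr 0 (x0 u) + 1) ltac:(rec).
have Hc v : v <=m x0 u -> (coded a b (pr 0 v) <-> v = x0 u).
  move=> Hv; rewrite Hab; last by apply/mlt_S/mpair_le => //; apply: mle_refl.
  by split=> [/mpair_inj [_ ->]|->].
exists a, b, (x0 u + 1); split; last by split; [mlra | apply/Hc => //; mlra].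
split; [|split].
- move=> k Hk; have -> : k = 0 by apply: mle_anti => //; apply: mge0.
  by move=> v /mlt_S Hv w /mlt_S Hw [/(Hc _ Hv) -> /(Hc _ Hw) ->].
- by split; [apply/Hc => //|]; mlra.
- by move=> k /m_nlt0.
Qed.

Lemma computes_S u n v : computes u n v -> computes u (n + 1) (G u n v).
Proof.
move=> [a [b [B [[H1 [[H2 H2'] H3]] [HvB Hv]]]]]; set w := G u n v.
(* Only places up to [n] and values below [B] are copied. The old code is known to be functional
   there and may contain stray pairs elsewhere. *)
pose P p := (exists k, k <=m n /\ exists v', v' <m B /\ (p = pr k v' /\ coded a b (pr k v')))
  \/ p = pr (n + 1) w.
have HP : Dec1 m P by rewrite /P /coded; rec.
have [a' [b' Hab]] := coded_ex P (pr (n + 1) (B + w) + 1) HP.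
have Hc k v' : k <=m n + 1 -> v' <m B + w + 1 ->
    (coded a' b' (pr k v') <-> (k <=m n /\ v' <m B /\ coded a b (pr k v')) \/ (k = n + 1 /\ v' = w)).
  move=> Hk Hv'; rewrite Hab; last by apply/mlt_S/mpair_le => //; mlra.
  split=> [[[k' [Hk' [v'' [Hv'' [/mpair_inj [-> ->] H]]]]]|/mpair_inj [-> ->]]|[[K1 [K2 K3]]|[-> ->]]].
  - by left.
  - by right.
  - by left; exists k; split=> //; exists v'.
  - by right.
have HwB : w <m B + w + 1 by mlra.
exists a', b', (B + w + 1); split; last by split=> //; apply/Hc; [mlra | | right].
split; [|split].
- move=> k Hk v1 Hv1 v2 Hv2 [/Hc E1 /Hc E2]; case: E1 => // [[K1 [K2 K3]]|[K1 K2]]; case: E2 => // [[L1 [L2 L3]]|[L1 L2]].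
  + by apply: (H1 k).
  + by exfalso; mlra.
  + by exfalso; mlra.
  + by rewrite K2 L2.
- by split; [apply/Hc; [mlra|mlra|left; split; [mlra|]] | mlra].
- move=> k /mlt_S [Hk|->].
  + have [v' [K1 [K2 [K3 K4]]]] := H3 k Hk; exists v'; split; first by mlra.
    split; first by apply/Hc; [mlra|mlra|left; split; [mlra|]].
    by split; [apply/Hc; [mlra|mlra|left; split; [mlra|]] | mlra].
  + exists v; split; first by mlra.
    split; first by apply/Hc; [mlra|mlra|left; split; [mlra|]].
    by split=> //; apply/Hc; [mlra | | right].
Qed.

Lemma computes_ex u n : exists v, computes u n v.
Proof.
apply: (m_ind m (fun n => exists v, computes u n v)) n => [||n [v H]].
- apply: S1_ex.
  refine (S1_subst m _ (fun l e => scons u (scons (e 1%N) (scons (e 0%N) e)) l) _ S1_computes).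
  by case=> [|[|[|l]]]; [exact: PT_cst|exact: (PT_var m 1)|exact: (PT_var m 0)|exact: (PT_var m l)].
- by exists (x0 u); apply: computes_0.
- by exists (G u n v); apply: computes_S.
Qed.

(** Two computations are compared place by place. Bounding the values by [B] and [B'] keeps the
    induction statement decidable. *)
Lemma computes_inj u n v v' : computes u n v -> computes u n v' -> v = v'.
Proof.
move=> [a [b [B [[H1 [[H2 H2'] H3]] [HvB Hv]]]]] [a' [b' [B' [[K1 [[K2 K2'] K3]] [KvB Kv]]]]].
suff H k : k <=m n -> forall v, v <m B -> forall v', v' <m B' ->
    coded a b (pr k v) /\ coded a' b' (pr k v') -> v = v'.
  by apply: (H n) => //; apply: mle_refl.
apply: (rec_ind m (fun k => k <=m n -> forall v, v <m B -> forall v', v' <m B' ->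
    coded a b (pr k v) /\ coded a' b' (pr k v') -> v = v')) k => [|_|k IH Hk] {v v' HvB Hv KvB Kv}.
- by rewrite /coded; apply: D1_imp; rec.
- move=> v Hv v' Hv' [L1 L2].
  rewrite (H1 0 (mge0 _ _) v Hv (x0 u)) //.
  by rewrite (K1 0 (mge0 _ _) v' Hv' (x0 u)).
- move=> v Hv v' Hv' [L1 L2].
  have Hkn : k <m n by mlra.
  have [z [Hz [Hz' [Hz'' HGz]]]] := H3 k Hkn; have [z' [Kz [Kz' [Kz'' KGz]]]] := K3 k Hkn.
  rewrite (H1 (k + 1) Hk v Hv (G u k z)) //.
  rewrite (K1 (k + 1) Hk v' Hv' (G u k z')) //.
  by rewrite (IH _ z Hz z' Kz) //; mlra.
Qed.

Theorem primitive_recursion : exists f : M -> M -> M, Rec2 m f /\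
  forall u, f u 0 = x0 u /\ forall n, f u (n + 1) = G u n (f u n).
Proof.
pose f u n := proj1_sig (constructive_indefinite_description _ (computes_ex u n)).
have Hf u n : computes u n (f u n) by rewrite /f; case: constructive_indefinite_description.
exists f; split; last first.
  move=> u; split=> [|n]; apply: (computes_inj _ _ _ _ (Hf _ _)); first exact: computes_0.
  exact: computes_S.
apply: (isF_graph m (fun y e => computes (e 0%N) (e 1%N) y)).
  by move=> e y; split=> [H|->]; [apply: (computes_inj _ _ _ _ H)|].
refine (S1_subst m _ (fun l e => scons (e 1%N) (scons (e 2%N) (scons (e 0%N) e)) l) _ S1_computes).
by case=> [|[|[|l]]]; [exact: (PT_var m 1)|exact: (PT_var m 2)|exact: (PT_var m 0)|exact: (PT_var m l)].
Qed.

End PrimitiveRecursion.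

End Coding.

#[export] Hint Resolve rec_mfst rec_msnd : rec.

(** * Rational codes and the field *)

Lemma cross_eq (R : realFieldType) (x y d e : R) : d != 0 -> e != 0 ->
  x * d * e = y * e * d <-> x = y.
Proof.
move=> Hd He; split=> [|->]; last by ring.
by rewrite -mulrA [y * e]mulrC -[e * y * d]mulrA [e * _]mulrC -mulrA => /(mulIf (mulf_neq0 Hd He)).
Qed.

Lemma cross_lt (R : realFieldType) (x y d e : R) : 0 < d -> 0 < e ->
  (x * d * e < y * e * d) = (x < y).
Proof.
move=> Hd He; rewrite -mulrA [y * e]mulrC -[e * y * d]mulrA [e * _]mulrC -mulrA.
by rewrite ltr_pM2r // mulr_gt0.
Qed.

Section Rationals.

Variable m : rca0_model.
Notation M := (mnum m).
Notation F := (mfield m).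
Implicit Types (q r : M) (u v w : mfrac m).

Lemma finj_raw_add (a b : M) : (num_add (rca0_structure m) a b)%:f = a%:f + b%:f :> F.
Proof. exact: (rmorphD (finj m)). Qed.
Lemma finj_raw_mul (a b : M) : (num_mul (rca0_structure m) a b)%:f = a%:f * b%:f :> F.
Proof. exact: (rmorphM (finj m)). Qed.
Lemma finj_raw_0 : (num_zero (rca0_structure m) : M)%:f = 0 :> F.
Proof. exact: (rmorph0 (finj m)). Qed.
Lemma finj_raw_1 : (num_one (rca0_structure m) : M)%:f = 1 :> F.
Proof. exact: (rmorph1 (finj m)). Qed.
Lemma finj_0 : (0 : M)%:f = 0 :> F.
Proof. exact: (rmorph0 (finj m)). Qed.
Lemma finj_1 : (1 : M)%:f = 1 :> F.
Proof. exact: (rmorph1 (finj m)). Qed.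
Lemma finj_add (a b : M) : (a + b)%:f = a%:f + b%:f :> F.
Proof. exact: (rmorphD (finj m)). Qed.
Lemma finj_mul (a b : M) : (a * b)%:f = a%:f * b%:f :> F.
Proof. exact: (rmorphM (finj m)). Qed.
Definition finjE := (finj_raw_add, finj_raw_mul, finj_raw_0, finj_raw_1, finj_0, finj_1, finj_add, finj_mul).

Definition fracval u : F := ((mpos m u)%:f - (mneg m u)%:f) / (mden m u)%:f.
Definition posden u : Prop := 0 <m mden m u.

Lemma posden_gt0 u : posden u -> 0 < (mden m u)%:f :> F.
Proof. by move=> /finj_lt; rewrite finj_0. Qed.

Lemma posden_neq0 u : posden u -> (mden m u)%:f != 0 :> F.
Proof. by move=> /posden_gt0 H; rewrite gt_eqF. Qed.

Lemma fracvalM u : posden u -> fracval u * (mden m u)%:f = (mpos m u)%:f - (mneg m u)%:f.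
Proof. by move=> /posden_neq0 H; rewrite /fracval mulfVK. Qed.

Lemma fracval_eq u v : posden u -> posden v -> mfrac_eq m u v <-> fracval u = fracval v.
Proof.
move=> Hu Hv; have [Du Dv] := (posden_neq0 _ Hu, posden_neq0 _ Hv).
transitivity (fracval u * (mden m u)%:f * (mden m v)%:f = fracval v * (mden m v)%:f * (mden m u)%:f).
- rewrite (fracvalM u Hu) (fracvalM v Hv) /mfrac_eq; split=> [/(f_equal (finj m))|H].
  + by rewrite !finjE => H; lra.
  + by apply: finj_inj; rewrite !finjE; lra.
- exact: cross_eq.
Qed.

Lemma fracval_lt u v : posden u -> posden v -> mfrac_lt m u v <-> fracval u < fracval v.
Proof.
move=> Hu Hv; have [Du Dv] := (posden_gt0 _ Hu, posden_gt0 _ Hv).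
transitivity (fracval u * (mden m u)%:f * (mden m v)%:f < fracval v * (mden m v)%:f * (mden m u)%:f).
- rewrite (fracvalM u Hu) (fracvalM v Hv) /mfrac_lt; split=> [/finj_lt|H].
  + by rewrite !finjE => H; lra.
  + by apply/finj_lt; rewrite !finjE; lra.
- by rewrite cross_lt.
Qed.

Lemma fracval_le u v : posden u -> posden v -> mfrac_le m u v <-> fracval u <= fracval v.
Proof.
move=> Hu Hv; rewrite /mfrac_le fracval_lt // fracval_eq // le_eqVlt; split.
- by case=> [->|->]; rewrite ?orbT ?eqxx.
- by move=> /orP[/eqP|]; [right|left].
Qed.

Lemma posden_mul (a b : M) : 0 <m a -> 0 <m b -> 0 <m num_mul (rca0_structure m) a b.
Proof.
move=> /finj_lt; rewrite finj_0 => Ha /finj_lt; rewrite finj_0 => Hb.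
by apply/finj_lt; rewrite !finjE mulr_gt0.
Qed.

Lemma fracval_add u v : posden u -> posden v ->
  posden (mfrac_add m u v) /\ fracval (mfrac_add m u v) = fracval u + fracval v.
Proof.
move=> Hu Hv; split; first exact: posden_mul.
have [Du Dv] := (posden_neq0 _ Hu, posden_neq0 _ Hv).
by rewrite /fracval /= !finjE; field; rewrite Du Dv.
Qed.

Lemma fracval_mul u v : posden u -> posden v ->
  posden (mfrac_mul m u v) /\ fracval (mfrac_mul m u v) = fracval u * fracval v.
Proof.
move=> Hu Hv; split; first exact: posden_mul.
have [Du Dv] := (posden_neq0 _ Hu, posden_neq0 _ Hv).
by rewrite /fracval /= !finjE; field; rewrite Du Dv.
Qed.

Lemma fracval_opp u : fracval (mfrac_opp m u) = - fracval u.
Proof. by rewrite /fracval /= -opprB mulNr. Qed.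

Lemma fracval_sub u v : posden u -> posden v ->
  posden (mfrac_sub m u v) /\ fracval (mfrac_sub m u v) = fracval u - fracval v.
Proof. by move=> Hu Hv; rewrite -fracval_opp; apply: fracval_add. Qed.

Lemma posden_0 : posden (mfrac0 m).
Proof. by apply/finj_lt; rewrite !finjE. Qed.
Lemma posden_1 : posden (mfrac1 m).
Proof. by apply/finj_lt; rewrite !finjE. Qed.
Lemma fracval_0 : fracval (mfrac0 m) = 0.
Proof. by rewrite /fracval /= !finjE subrr mul0r. Qed.
Lemma fracval_1 : fracval (mfrac1 m) = 1.
Proof. by rewrite /fracval /= !finjE subr0 divr1. Qed.

Lemma fracval_abs u K (k : F -> Prop) : posden u ->
  (forall v, posden v -> (K v <-> k (fracval v))) -> mfrac_abs m u K <-> k `|fracval u|.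
Proof.
move=> Hu HK; have Hopp : posden (mfrac_opp m u) by [].
rewrite /mfrac_abs fracval_le ?fracval_lt ?fracval_0 ?HK ?fracval_opp //; try exact: posden_0.
case: lerP => H; [rewrite ger0_norm // | rewrite ltr0_norm //].
- by split=> [[[]|[]]|]; [| |left].
- by split=> [[[]|[]]|]; [| |right].
Qed.

(* The value of a code, with junk values on numbers that are not codes. *)
Definition rval q : F :=
  ((mfst m (mfst m q))%:f - (msnd m (mfst m q))%:f) / ((msnd m q)%:f + 1).

Lemma den_gt0 (c : M) : 0 < c%:f + 1 :> F.
Proof. by have := finj_ge0 m c; lra. Qed.
Lemma den_neq0 (c : M) : c%:f + 1 != 0 :> F.
Proof. by rewrite gt_eqF // den_gt0. Qed.

Lemma rval_code a b c : rval (mcode m a b c) = (a%:f - b%:f) / (c%:f + 1).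
Proof. by rewrite /rval /mcode !(mfst_pair, msnd_pair). Qed.

Definition dec_code q : mfrac m :=
  MFrac m (mfst m (mfst m q)) (msnd m (mfst m q)) (msnd m q + 1).

Lemma posden_S a b c : posden (MFrac m a b (c + 1)).
Proof. by apply/finj_lt; rewrite !finjE den_gt0. Qed.

Lemma posden_dec q : posden (dec_code q).
Proof. exact: posden_S. Qed.

Lemma fracval_S a b c : fracval (MFrac m a b (c + 1)) = (a%:f - b%:f) / (c%:f + 1).
Proof. by rewrite /fracval /= !finjE. Qed.

Lemma rval_dec q : rval q = fracval (dec_code q).
Proof. by rewrite /dec_code fracval_S. Qed.

Lemma dec_rval_eq : Dec2 m (fun q r => rval q = rval r).
Proof.
apply: (@D1_ext m (fun e => mfrac_eq m (dec_code (e 0%N)) (dec_code (e 1%N)))).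
- rewrite /mfrac_eq /=; apply: D1_eq; apply: isF_add; apply: isF_mul; rec.
- by move=> e; rewrite !rval_dec fracval_eq //; apply: posden_dec.
Qed.

Lemma dec_rval_lt : Dec2 m (fun q r => rval q < rval r).
Proof.
apply: (@D1_ext m (fun e => mfrac_lt m (dec_code (e 0%N)) (dec_code (e 1%N)))).
- rewrite /mfrac_lt /=; apply: D1_lt; apply: isF_add; apply: isF_mul; rec.
- by move=> e; rewrite !rval_dec fracval_lt //; apply: posden_dec.
Qed.

Definition is_code q : Prop := exists a, a <=m q /\ exists b, b <=m q /\ exists c, c <=m q /\ q = mcode m a b c.

Lemma is_codeP q : is_code q <-> exists a b c, q = mcode m a b c.
Proof.
split=> [[a [_ [b [_ [c [_ E]]]]]]|[a [b [c ->]]]]; first by exists a, b, c.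
have [H1 H2] := mpair_ge m (mpair m a b) c; have [H3 H4] := mpair_ge m a b.
exists a; split; first exact: mle_trans H3 H1.
exists b; split; first exact: mle_trans H4 H1.
by exists c.
Qed.

Lemma dec_is_code : Dec1 m is_code.
Proof. by rewrite /is_code /mcode; rec. Qed.

Lemma is_ratP q : m_is_rat m q <-> is_code q /\ forall r, r <m q -> ~ (is_code r /\ rval r = rval q).
Proof.
rewrite is_codeP; split=> [[a [b [c [-> H]]]]|[[a [b [c E]]] H]].
- split=> [|r Hr]; first by exists a, b, c.
  rewrite is_codeP => -[[a' [b' [c' E]]]]; move: Hr; rewrite E => Hr; rewrite !rval_code -!fracval_S.
  by move/(fracval_eq _ _ (posden_S _ _ _) (posden_S _ _ _)); apply: H.
- exists a, b, c; split=> // a' b' c' H' E'; case: (H _ H'); split; first by apply/is_codeP; exists a', b', c'.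
  by rewrite E !rval_code -!fracval_S; apply: (proj1 (fracval_eq _ _ (posden_S _ _ _) (posden_S _ _ _)) E').
Qed.

Lemma is_rat_is_code q : m_is_rat m q -> is_code q.
Proof. by move/is_ratP; case. Qed.

Lemma dec_is_rat : Dec1 m (m_is_rat m).
Proof.
have H1 := dec_is_code; have H2 := dec_rval_eq.
apply: (@D1_ext m (fun e => is_code (e 0%N) /\ forall r, r <m e 0%N -> ~ (is_code r /\ rval r = rval (e 0%N)))).
- apply: D1_and; first by rec.
  apply: D1_ball; first by rec.
  apply: D1_not; apply: D1_and; first by rec.
  by apply: (D1_app2 m (fun q r => rval q = rval r) _ _ dec_rval_eq); rec.
- by move=> e; rewrite is_ratP.
Qed.

Lemma is_rat_inj q r : m_is_rat m q -> m_is_rat m r -> rval q = rval r -> q = r.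
Proof.
move=> /is_ratP [H1 H2] /is_ratP [H3 H4] E.
case: (mlt_total m q r) => // H; first by case: (H4 _ H).
by case: (H2 _ H).
Qed.

Lemma field_frac (x : F) : exists a b c : M, x = (a%:f - b%:f) / (c%:f + 1).
Proof.
case: (lerP 0 x) => [/fge0P [a [c ->]]|H]; first by exists a, 0, c; rewrite finj_0 subr0.
have /fge0P [b [c E]] : 0 <= - x by lra.
by exists 0, b, c; rewrite finj_0 sub0r mulNr -E opprK.
Qed.

Lemma rat_code_ex (x : F) : exists q, m_is_rat m q /\ rval q = x.
Proof.
have [a [b [c E]]] := field_frac x; pose q0 := mcode m a b c.
have [||q [[H1 H2] H3]] := rec_least m (fun q => is_code q /\ rval q = rval q0).
- have K1 := dec_is_code; have K2 := dec_rval_eq.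
  apply: D1_and; first by rec.
  by apply: (D1_app2 m (fun q r => rval q = rval r) _ _ dec_rval_eq); rec.
- by exists q0; split=> //; apply/is_codeP; exists a, b, c.
- exists q; split; last by rewrite H2 rval_code E.
  by apply/is_ratP; split=> // r /H3 Hr; rewrite H2.
Qed.

(** Each field element is the value of exactly one rational of the model. Sequences and functions
    can therefore take values in the field; they count as recursive when their composition with
    [rcode] is. *)
Definition rcode (x : F) : M := epsilon (inhabits 0) (fun q => m_is_rat m q /\ rval q = x).

Lemma rcode_rat x : m_is_rat m (rcode x).
Proof. by case: (epsilon_spec (inhabits 0) _ (rat_code_ex x)). Qed.
Lemma rcodeK x : rval (rcode x) = x.
Proof. by case: (epsilon_spec (inhabits 0) _ (rat_code_ex x)). Qed.
Lemma rvalK q : m_is_rat m q -> rcode (rval q) = q.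
Proof. by move=> H; apply: is_rat_inj => //; [apply: rcode_rat | rewrite rcodeK]. Qed.
Lemma rcode_eq q x : q = rcode x <-> m_is_rat m q /\ rval q = x.
Proof. by split=> [->|[H <-]]; [split; [apply: rcode_rat | apply: rcodeK] | rewrite rvalK]. Qed.

Lemma rec_normalize : Rec1 m (fun q => rcode (rval q)).
Proof.
have K1 := dec_is_rat; have K2 := dec_rval_eq.
apply: (isF_graph m (fun r e => m_is_rat m r /\ rval r = rval (e 0%N))).
- by move=> e r; rewrite rcode_eq.
- apply: D1_S1; apply: D1_and; first by rec.
  by apply: (D1_app2 m (fun q r => rval q = rval r) _ _ dec_rval_eq); rec.
Qed.

Lemma isF_rcode (s : (nat -> M) -> M) (x : (nat -> M) -> F) :
  (forall e, rval (s e) = x e) -> isF m s -> isF m (fun e => rcode (x e)).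
Proof.
move=> E Hs; apply: (isF_ext m (fun e => rcode (rval (s e)))) => [e|]; first by rewrite E.
exact: (isF_app1 m (fun q => rcode (rval q))) rec_normalize Hs.
Qed.

Lemma isF_rcode_frac (a b c : (nat -> M) -> M) : isF m a -> isF m b -> isF m c ->
  isF m (fun e => rcode (((a e)%:f - (b e)%:f) / ((c e)%:f + 1))).
Proof.
move=> Ha Hb Hc; apply: (isF_rcode (fun e => mcode m (a e) (b e) (c e))).
- by move=> e; apply: rval_code.
- by rewrite /mcode; apply: isF_pair; [apply: isF_pair|].
Qed.

Lemma with_fracP q K (k : F -> Prop) : is_code q ->
  (forall u, posden u -> (K u <-> k (fracval u))) -> m_with_frac m q K <-> k (rval q).
Proof.
move=> /is_codeP [a [b [c E]]] HK; rewrite E rval_code -fracval_S -HK; last exact: posden_S.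
rewrite /m_with_frac; split=> [[a' [b' [c' [E' H]]]]|H]; last by exists a, b, c.
by move: E' => /mpair_inj [/mpair_inj [-> ->] ->].
Qed.

Lemma forall_epsP K (k : F -> Prop) :
  (forall u, posden u -> (K u <-> k (fracval u))) ->
  m_forall_eps m K <-> forall x, 0 < x -> k x.
Proof.
move=> HK; have HQ q : m_is_rat m q ->
    (m_with_frac m q (fun e => mfrac_lt m (mfrac0 m) e -> K e) <-> (0 < rval q -> k (rval q))).
  move=> Hq; apply: (with_fracP q _ (fun x => 0 < x -> k x)); first exact: is_rat_is_code.
  by move=> u Hu; rewrite fracval_lt // ?HK ?fracval_0 //; apply: posden_0.
split=> [H x|H q Hq]; last exact/(HQ q Hq)/H.
by rewrite -(rcodeK x); apply/HQ; [apply: rcode_rat | apply: H; apply: rcode_rat].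
Qed.

(* To a continuation that depends only on the values of fractions, [s n] is [x n]. *)
Definition denotes (s : m_seqexp m) (x : M -> F) : Prop :=
  forall n K (k : F -> Prop), (forall u, posden u -> (K u <-> k (fracval u))) ->
    (s n K <-> k (x n)).

Lemma denotes_rcst u : posden u -> denotes (m_rcst m u) (fun _ => fracval u).
Proof. by move=> Hu n K k HK; apply: HK. Qed.

Lemma denotes_0 : denotes (m_real0 m) (fun _ => 0).
Proof. by rewrite -fracval_0; apply/denotes_rcst/posden_0. Qed.
Lemma denotes_1 : denotes (m_real1 m) (fun _ => 1).
Proof. by rewrite -fracval_1; apply/denotes_rcst/posden_1. Qed.

Lemma denotes_rsub (s t : m_seqexp m) (x y : M -> F) : denotes s x -> denotes t y ->
  denotes (m_rsub m s t) (fun n => x n - y n).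
Proof.
move=> Hs Ht n K k HK; apply: (Hs n _ (fun a => k (a - y n))) => u Hu.
apply: (Ht n _ (fun b => k (fracval u - b))) => v Hv.
by have [Hp <-] := fracval_sub u v Hu Hv; apply: HK.
Qed.

Lemma denotes_rmul (s t : m_seqexp m) (x y : M -> F) : denotes s x -> denotes t y ->
  denotes (m_rmul m s t) (fun n => x n * y n).
Proof.
move=> Hs Ht n K k HK; apply: (Hs n _ (fun a => k (a * y n))) => u Hu.
apply: (Ht n _ (fun b => k (fracval u * b))) => v Hv.
by have [Hp <-] := fracval_mul u v Hu Hv; apply: HK.
Qed.

Lemma denotes_rabs (s : m_seqexp m) (x : M -> F) : denotes s x -> denotes (m_rabs m s) (fun n => `|x n|).
Proof. by move=> Hs n K k HK; apply: (Hs n _ (fun a => k `|a|)) => u Hu; apply: fracval_abs. Qed.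

Definition eventually (P : M -> Prop) : Prop := exists b, forall s, b <=m s -> P s.

Definition sle (x y : M -> F) : Prop :=
  forall eps, 0 < eps -> eventually (fun n => x n <= y n + eps).
Definition seqv (x y : M -> F) : Prop := sle x y /\ sle y x.
Definition slt (x y : M -> F) : Prop := sle x y /\ ~ seqv x y.
Definition scauchy (x : M -> F) : Prop :=
  forall eps, 0 < eps -> exists N, forall i j, N <=m i /\ N <=m j -> `|x i - x j| < eps.

Lemma rleP s t x y : denotes s x -> denotes t y -> m_rle m s t <-> sle x y.
Proof.
move=> Hs Ht; apply: (forall_epsP _ (fun eps => eventually (fun n => x n <= y n + eps))) => e He.
have H n : s n (fun u => t n (fun v => mfrac_le m u (mfrac_add m v e))) <-> x n <= y n + fracval e.
  apply: (Hs n _ (fun a => a <= y n + fracval e)) => u Hu.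
  apply: (Ht n _ (fun b => fracval u <= b + fracval e)) => v Hv.
  by have [Hp <-] := fracval_add v e Hv He; apply: fracval_le.
by split=> -[N HN]; exists N => n Hn; apply/H/HN.
Qed.

Lemma reqP s t x y : denotes s x -> denotes t y -> m_req m s t <-> seqv x y.
Proof. by move=> Hs Ht; rewrite /m_req (rleP _ _ _ _ Hs Ht) (rleP _ _ _ _ Ht Hs). Qed.

Lemma rltP s t x y : denotes s x -> denotes t y -> m_rlt m s t <-> slt x y.
Proof.
by move=> Hs Ht; rewrite /m_rlt (rleP _ _ _ _ Hs Ht) (reqP _ _ _ _ Hs Ht).
Qed.

Lemma is_cauchyP s x : denotes s x -> m_is_cauchy m s <-> scauchy x.
Proof.
move=> Hs; apply: (forall_epsP _ (fun eps => exists N, forall i j, N <=m i /\ N <=m j -> `|x i - x j| < eps)) => e He.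
have H i j : s i (fun u => s j (fun v => mfrac_abs m (mfrac_sub m u v) (fun w => mfrac_lt m w e)))
    <-> `|x i - x j| < fracval e.
  apply: (Hs i _ (fun a => `|a - x j| < fracval e)) => u Hu.
  apply: (Hs j _ (fun b => `|fracval u - b| < fracval e)) => v Hv.
  have [Hp <-] := fracval_sub u v Hu Hv.
  by apply: (fracval_abs _ _ (fun a => a < fracval e)) => // w Hw; apply: fracval_lt.
by split=> -[N HN]; exists N => i j Hij; apply/H/HN.
Qed.

Definition seq_graph (X : mset m) (x : M -> F) : Prop :=
  forall n q, mmem m (mpair m n q) X <-> q = rcode (x n).

Lemma denotes_seq X x : seq_graph X x -> denotes (m_val m (m_seq_of m X)) x.
Proof.
move=> HX n K k HK; rewrite -(rcodeK (x n)).
rewrite -(with_fracP _ K k) //; last exact/is_rat_is_code/rcode_rat.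
split=> [[q [/HX -> //]]|H]; by exists (rcode (x n)); split=> //; apply/HX.
Qed.

Lemma denotes_const q : is_code q -> denotes (m_val m (m_seq_const m q)) (fun _ => rval q).
Proof. by move=> Hq n K k HK; apply: with_fracP. Qed.

Lemma is_real_seq X : m_is_real m X -> exists x,
  seq_graph X x /\ scauchy x /\ Rec1 m (fun n => rcode (x n)).
Proof.
move=> [[H1 [H2 H3]] HC]; have H2' n : exists q, mmem m (mpair m n q) X by apply: H2.
pose x n := rval (epsilon (inhabits 0) (fun q => mmem m (mpair m n q) X)).
have HX : seq_graph X x.
  move=> n q; have Hn := epsilon_spec (inhabits 0) _ (H2' n); rewrite -/(x n) in Hn.
  have Hr : m_is_rat m (epsilon (inhabits 0) (fun q => mmem m (mpair m n q) X)).
    by have [i [j [/mpair_inj [_ E] [_ Hj]]]] := H1 _ Hn; rewrite E.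
  rewrite /x rvalK //; split=> [H|-> //].
  by apply: (H3 n); split.
exists x; split=> //; split; first by apply/(is_cauchyP _ _ (denotes_seq X x HX)).
apply: (isF_graph m (fun q e => mmem m (mpair m (e 0%N) q) X)) => [e q|]; first exact: HX.
by apply: D1_S1; rec.
Qed.

Lemma seq_is_real X x : seq_graph X x -> (forall p, mmem m p X -> exists n q, p = mpair m n q) ->
  scauchy x -> m_is_real m X.
Proof.
move=> HX HXp HC; split; last by apply/(is_cauchyP _ _ (denotes_seq X x HX)).
split; [|split].
- move=> p Hp; have [n [q E]] := HXp p Hp; exists n, q; split=> //; split=> //.
  by move: Hp; rewrite E => /HX ->; apply: rcode_rat.
- by move=> n _; exists (rcode (x n)); apply/HX.
- by move=> n q r [/HX -> /HX ->].
Qed.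

Lemma real_ex (x : M -> F) : Rec1 m (fun n => rcode (x n)) -> scauchy x ->
  exists X, m_is_real m X /\ seq_graph X x.
Proof.
move=> Hx HC; pose g n := rcode (x n); have Hg : Rec1 m g := Hx.
have [X HX] := rec_comprehension m
  (fun p => exists n, n <=m p /\ exists q, q <=m p /\ (p = mpair m n q /\ q = g n))
  ltac:(rec).
have HG : seq_graph X x.
  move=> n q; rewrite HX; split=> [[n' [_ [q' [_ [/mpair_inj [-> ->]]]]]] //|E].
  by have [H1 H2] := mpair_ge m n q; exists n; split=> //; exists q.
exists X; split=> //; apply: (seq_is_real X x) => // p /HX [n [_ [q [_ [E _]]]]].
by exists n, q.
Qed.

Definition fun_graph (G : mset m) (f : F -> M -> F) : Prop :=
  forall q i r, mmem m (mpair m (mpair m q i) r) G <-> m_is_rat m q /\ r = rcode (f (rval q) i).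

Definition rec_fun (f : F -> M -> F) : Prop := Rec2 m (fun q i => rcode (f (rval q) i)).

Lemma is_pcf_fun G : m_is_pcf m G -> exists f, fun_graph G f /\ rec_fun f.
Proof.
move=> [H1 [H2 H3]].
have H2' q i : m_is_rat m q -> exists r, mmem m (mpair m (mpair m q i) r) G.
  by move=> Hq; apply: H2; exists q, i.
pose f x i := rval (epsilon (inhabits 0) (fun r => mmem m (mpair m (mpair m (rcode x) i) r) G)).
have HG : fun_graph G f.
  move=> q i r; split=> [H|[Hq ->]].
  - have [p [j [/mpair_inj [<- <-] [[q' [i' [/mpair_inj [<- _] Hq]]] Hr]]]] := H1 _ H.
    split=> //; have Hn := epsilon_spec (inhabits 0) _ (H2' q i Hq).
    by rewrite /f (rvalK q Hq) (H3 _ _ _ (conj Hn H)) rvalK.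
  - have Hn := epsilon_spec (inhabits 0) _ (H2' q i Hq); rewrite /f (rvalK q Hq) rvalK //.
    by have [p [j [/mpair_inj [_ E] [_ Hj]]]] := H1 _ Hn; rewrite E.
exists f; split=> //.
apply: (isF_graph m (fun r e => mmem m (mpair m (mpair m (rcode (rval (e 0%N))) (e 1%N)) r) G)).
- move=> e r; rewrite HG rcodeK; split=> [[]|] //; by split=> //; apply: rcode_rat.
- apply: D1_S1; apply: D1_mem; apply: isF_pair; last by rec.
  apply: isF_pair; last by rec.
  exact: (isF_app1 m (fun q => rcode (rval q)) (fun e => e 1%N) rec_normalize (isF_var m 1)).
Qed.

Lemma pcf_ex (f : F -> M -> F) : rec_fun f -> exists G, m_is_pcf m G /\ fun_graph G f.
Proof.
move=> Hf; have Hr := dec_is_rat.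
pose g q i := rcode (f (rval q) i); have Hg : Rec2 m g := Hf.
have [G HG] := rec_comprehension m
  (fun p => exists q, q <=m p /\ exists i, i <=m p /\ exists r, r <=m p /\
     (p = mpair m (mpair m q i) r /\ (m_is_rat m q /\ r = g q i)))
  ltac:(rec).
have HG' : fun_graph G f.
  move=> q i r; rewrite HG; split=> [[q' [_ [i' [_ [r' [_ [/mpair_inj [/mpair_inj [-> ->] ->]]]]]]]] //|H].
  have [H1 H2] := mpair_ge m (mpair m q i) r; have [H3 H4] := mpair_ge m q i.
  exists q; split; first exact: mle_trans H3 H1.
  exists i; split; first exact: mle_trans H4 H1.
  by exists r.
exists G; split=> //; split; [|split].
- move=> p /HG [q [_ [i [_ [r [_ [E [Hq Er]]]]]]]]; exists (mpair m q i), r; split=> //.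
  by split; [exists q, i | rewrite Er; apply: rcode_rat].
- move=> p [q [i [-> Hq]]]; exists (rcode (f (rval q) i)); by apply/HG'.
- move=> p r r' [K1 K2]; have [q [_ [i [_ [r1 [_ [/mpair_inj [E _] _]]]]]]] := proj1 (HG _) K1.
  by move: K1 K2; rewrite E => /HG' [_ ->] /HG' [_ ->].
Qed.

Lemma at_ratP G f q i K : fun_graph G f -> m_is_rat m q ->
  m_at_rat m G q i K <-> K (rcode (f (rval q) i)).
Proof.
move=> HG Hq; split=> [[r [/HG [_ ->] //]]|H].
by exists (rcode (f (rval q) i)); split=> //; apply/HG.
Qed.

Lemma at_rat_fracP G f q i K (k : F -> Prop) : fun_graph G f -> m_is_rat m q ->
  (forall u, posden u -> (K u <-> k (fracval u))) ->
  m_at_rat m G q i (fun r => m_with_frac m r K) <-> k (f (rval q) i).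
Proof.
move=> HG Hq HK; rewrite (at_ratP G f) // -(rcodeK (f (rval q) i)) rcodeK.
by rewrite (with_fracP _ K k) // ?rcodeK //; apply/is_rat_is_code/rcode_rat.
Qed.

Lemma denotes_app G f X x : fun_graph G f -> seq_graph X x ->
  denotes (m_app m G (m_seq_of m X)) (fun n => f (x n) n).
Proof.
move=> HG HX n K k HK.
transitivity (m_at_rat m G (rcode (x n)) n (fun r => m_with_frac m r K)).
- split=> [[q [/HX -> //]]|H]; by exists (rcode (x n)); split=> //; apply/HX.
- by rewrite (at_rat_fracP G f _ _ K k) // ?rcodeK //; apply: rcode_rat.
Qed.

Lemma denotes_app_const G f q : fun_graph G f -> m_is_rat m q ->
  denotes (m_app m G (m_seq_const m q)) (fun n => f (rval q) n).
Proof. by move=> HG Hq n K k HK; apply: (at_rat_fracP G f q n K k). Qed.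

Definition near (x : M -> F) (d y : F) : Prop := slt (fun n => `|x n - y|) (fun _ => d).

Definition in_domain (f : F -> M -> F) (x : M -> F) : Prop :=
  forall eps, 0 < eps -> exists N : M, 0 <m N /\ forall y z,
    near x N%:f^-1 y -> near x N%:f^-1 z ->
    forall i j, N <=m i /\ N <=m j -> `|f y i - f z j| < eps.

Lemma in_domP G f s x : fun_graph G f -> denotes s x -> m_in_dom m G s <-> in_domain f x.
Proof.
move=> HG Hs; apply: (forall_epsP _ (fun eps => exists N : M, 0 <m N /\ forall y z,
    near x N%:f^-1 y -> near x N%:f^-1 z ->
    forall i j, N <=m i /\ N <=m j -> `|f y i - f z j| < eps)) => e He.
have Hball (N : M) q : 0 <m N -> m_is_rat m q ->
    (m_in_ball m (m_rcst m (MFrac m (num_one (rca0_structure m)) (num_zero (rca0_structure m)) N)) s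
      (m_val m (m_seq_const m q)) <-> near x N%:f^-1 (rval q)).
  move=> HN Hq; apply: rltP.
  - apply: denotes_rabs; apply: denotes_rsub => //.
    exact/denotes_const/is_rat_is_code.
  - have -> : N%:f^-1 = fracval (MFrac m (num_one (rca0_structure m)) (num_zero (rca0_structure m)) N).
      by rewrite /fracval /= !finjE subr0 mul1r.
    exact: denotes_rcst.
have Happ q r i j : m_is_rat m q -> m_is_rat m r ->
    (m_at_rat m G q i (fun q' => m_with_frac m q' (fun u =>
       m_at_rat m G r j (fun r' => m_with_frac m r' (fun v =>
         mfrac_abs m (mfrac_sub m u v) (fun w => mfrac_lt m w e)))))
     <-> `|f (rval q) i - f (rval r) j| < fracval e).
  move=> Hq Hr; apply: (at_rat_fracP G f _ _ _ (fun a => `|a - f (rval r) j| < fracval e)) => // u Hu.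
  apply: (at_rat_fracP G f _ _ _ (fun b => `|fracval u - b| < fracval e)) => // v Hv.
  have [Hp <-] := fracval_sub u v Hu Hv.
  by apply: (fracval_abs _ _ (fun a => a < fracval e)) => // w Hw; apply: fracval_lt.
split=> -[N [HN H]]; exists N; split=> //.
- move=> y z Hy Hz i j Hij; rewrite -(rcodeK y) -(rcodeK z).
  apply/Happ; try exact: rcode_rat.
  apply: H => //; split; first exact: rcode_rat.
  split; first exact: rcode_rat.
  by split; apply/Hball; rewrite ?rcodeK //; apply: rcode_rat.
- move=> q r [Hq [Hr [Bq Br]]] i j Hij; apply/Happ => //.
  by apply: H => //; apply/Hball.
Qed.

End Rationals.

(** * The four principles in terms of the field *)

Section FieldPrinciples.

Variable m : rca0_model.
Notation M := (mnum m).
Notation F := (mfield m).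

Definition creal (x : M -> F) : Prop := Rec1 m (fun n => rcode m (x n)) /\ scauchy m x.

Definition cvalue (f : F -> M -> F) (x : M -> F) : M -> F := fun n => f (x n) n.

Definition cst (a : F) : M -> F := fun _ => a.

Definition in_unit (x : M -> F) : Prop := sle m (cst 0) x /\ sle m x (cst 1).

Definition cont_on_unit (f : F -> M -> F) : Prop :=
  forall x, creal x -> in_unit x -> in_domain m f x.

Definition sign_changes (f : F -> M -> F) : Prop :=
  slt m (fun n => f 0 n * f 1 n) (cst 0).

Definition strictly_increasing (f : F -> M -> F) : Prop :=
  forall x y, creal x -> in_unit x -> creal y -> in_unit y ->
    slt m x y -> slt m (cvalue f x) (cvalue f y).

Definition zero_exists (f : F -> M -> F) : Prop :=
  exists x, creal x /\ (slt m (cst 0) x /\ slt m x (cst 1)) /\ seqv m (cvalue f x) (cst 0).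

Definition two_valued (f : F -> M -> F) : Prop :=
  (forall x, creal x -> in_domain m f x) /\
  forall x, creal x -> seqv m (cvalue f x) (cst 0) \/ seqv m (cvalue f x) (cst 1).

Lemma is_rat_0 : m_is_rat m (mrat0 m) /\ rval m (mrat0 m) = 0.
Proof.
split; last by rewrite rval_code !finjE subrr mul0r.
apply/is_ratP; split; first by apply/is_codeP; do 3!eexists; reflexivity.
move=> r Hr; case: (m_nlt0 m r); move: Hr.
by have -> : mrat0 m = 0 by apply: finj_inj; rewrite /mrat0 /mcode !mpairE !finjE; ring.
Qed.

Lemma is_rat_1 : m_is_rat m (mrat1 m) /\ rval m (mrat1 m) = 1.
Proof.
have E1 : rval m (mrat1 m) = 1 by rewrite rval_code !finjE subr0 add0r divr1.
split=> //; apply/is_ratP; split; first by apply/is_codeP; do 3!eexists; reflexivity.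
move=> r Hr [/is_codeP [a [b [c E]]]]; rewrite {}E1; move: Hr; rewrite E rval_code => /finj_lt.
rewrite /mrat1 /mcode !mpairE !finjE => Hr H.
have {H} : (a%:f - b%:f) / (c%:f + 1) * (c%:f + 1) = c%:f + 1 :> F by rewrite H mul1r.
rewrite mulfVK ?den_neq0 // => H.
have [[Ha Hb] Hc] := (finj_ge0 m a, finj_ge0 m b, finj_ge0 m c).
(* A fraction of value 1 has $a = b + c + 1 \geq 1$. Its inner pair is then at least 2 and its code
   at least $2^2 + 2 = 6$, the code of [mrat1]. *)
have Ha1 : 1 <= a%:f :> F by lra.
have Hp : 2 <= (a%:f + b%:f) * (a%:f + b%:f) + a%:f :> F by nra.
by move: Hr; move: (_ + a%:f) Hp => p Hp Hr; clear E; nra.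
Qed.

Section Graphs.

Variables (G : mset m) (f : F -> M -> F).
Hypothesis HG : fun_graph m G f.

Lemma creal_of X : m_is_real m X -> exists x, seq_graph m X x /\ creal x.
Proof. by move=> /is_real_seq [x [H1 [H2 H3]]]; exists x. Qed.

Lemma creal_ex x : creal x -> exists X, m_is_real m X /\ seq_graph m X x.
Proof. by case=> H1 H2; apply: real_ex. Qed.

Lemma in_unit_closedP X x : seq_graph m X x ->
  m_in_unit_closed m (m_val m (m_seq_of m X)) <-> in_unit x.
Proof.
move=> HXx; have HX := denotes_seq m X x HXx; rewrite /m_in_unit_closed.
by rewrite (rleP _ _ _ _ _ (denotes_0 m) HX) (rleP _ _ _ _ _ HX (denotes_1 m)).
Qed.

Lemma continuous_on_unitP :
  (forall X, m_is_real m X /\ m_in_unit_closed m (m_val m (m_seq_of m X)) ->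
    m_in_dom m G (m_val m (m_seq_of m X))) <-> cont_on_unit f.
Proof.
split=> [H x /creal_ex [X [HX HXx]] Hu|H X [/creal_of [x [HXx Hx]] /(in_unit_closedP X x HXx) Hu]].
- apply/(in_domP m _ _ _ _ HG (denotes_seq m _ _ HXx))/H; split=> //.
  exact/(in_unit_closedP X x HXx).
- exact/(in_domP m _ _ _ _ HG (denotes_seq m _ _ HXx))/H.
Qed.

Lemma increasing_on_unitP : m_increasing_on_unit m G <-> strictly_increasing f.
Proof.
split=> [H x y /creal_ex [X [HX HXx]] Hu /creal_ex [Y [HY HYy]] Hv Hxy|H X Y
  [/creal_of [x [HXx Hx]] [/(in_unit_closedP X x HXx) Hu [/creal_of [y [HYy Hy]]
    [/(in_unit_closedP Y y HYy) Hv Hxy]]]]].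
- apply/(rltP m _ _ _ _ (denotes_app m _ _ _ _ HG HXx) (denotes_app m _ _ _ _ HG HYy))/H.
  split=> //; split; first exact/(in_unit_closedP X x HXx).
  split=> //; split; first exact/(in_unit_closedP Y y HYy).
  exact/(rltP m _ _ _ _ (denotes_seq m _ _ HXx) (denotes_seq m _ _ HYy)).
- apply/(rltP m _ _ _ _ (denotes_app m _ _ _ _ HG HXx) (denotes_app m _ _ _ _ HG HYy)).
  apply: H => //; exact/(rltP m _ _ _ _ (denotes_seq m _ _ HXx) (denotes_seq m _ _ HYy)).
Qed.

Lemma sign_changeP : m_sign_change m G <-> sign_changes f.
Proof.
have [[H0 E0] [H1 E1]] := (is_rat_0, is_rat_1).
rewrite /m_sign_change (rltP m _ _ _ _ (denotes_rmul m _ _ _ _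
  (denotes_app_const m G f _ HG H0) (denotes_app_const m G f _ HG H1)) (denotes_0 m)).
by rewrite E0 E1.
Qed.

Lemma has_zeroP : m_has_zero m G <-> zero_exists f.
Proof.
split=> [[X [/creal_of [x [HXx Hx]] [[H1 H2] H3]]]|[x [/creal_ex [X [HX HXx]] [[H1 H2] H3]]]].
- exists x; split=> //; split; [split|].
  + exact/(rltP m _ _ _ _ (denotes_0 m) (denotes_seq m _ _ HXx)).
  + exact/(rltP m _ _ _ _ (denotes_seq m _ _ HXx) (denotes_1 m)).
  + exact/(reqP m _ _ _ _ (denotes_app m _ _ _ _ HG HXx) (denotes_0 m)).
- exists X; split=> //; split; [split|].
  + exact/(rltP m _ _ _ _ (denotes_0 m) (denotes_seq m _ _ HXx)).
  + exact/(rltP m _ _ _ _ (denotes_seq m _ _ HXx) (denotes_1 m)).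
  + exact/(reqP m _ _ _ _ (denotes_app m _ _ _ _ HG HXx) (denotes_0 m)).
Qed.

Lemma two_valuedP :
  ((forall X, m_is_real m X -> m_in_dom m G (m_val m (m_seq_of m X))) /\
   (forall X, m_is_real m X -> m_req m (m_app m G (m_seq_of m X)) (m_real0 m) \/
     m_req m (m_app m G (m_seq_of m X)) (m_real1 m))) <-> two_valued f.
Proof.
split=> -[K1 K2]; split.
- move=> x /creal_ex [X [HX HXx]].
  exact/(in_domP m _ _ _ _ HG (denotes_seq m _ _ HXx))/K1.
- move=> x /creal_ex [X [HX HXx]].
  case: (K2 X HX) => H; [left|right].
  + exact/(reqP m _ _ _ _ (denotes_app m _ _ _ _ HG HXx) (denotes_0 m)).
  + exact/(reqP m _ _ _ _ (denotes_app m _ _ _ _ HG HXx) (denotes_1 m)).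
- move=> X /creal_of [x [HXx Hx]].
  exact/(in_domP m _ _ _ _ HG (denotes_seq m _ _ HXx))/K1.
- move=> X /creal_of [x [HXx Hx]]; case: (K2 x Hx) => H; [left|right].
  + exact/(reqP m _ _ _ _ (denotes_app m _ _ _ _ HG HXx) (denotes_0 m)).
  + exact/(reqP m _ _ _ _ (denotes_app m _ _ _ _ HG HXx) (denotes_1 m)).
Qed.

End Graphs.

Lemma IVT_fieldP : m_IVT m <->
  forall f, rec_fun m f -> cont_on_unit f -> sign_changes f -> zero_exists f.
Proof.
split=> [H f /pcf_ex [G [HG Hf]] Hc Hs|H G [[/is_pcf_fun [f [Hf Hr]] Hc] Hs]].
- apply/(has_zeroP G f Hf)/H; split; last exact/(sign_changeP G f Hf).
  by split=> //; apply/(continuous_on_unitP G f Hf).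
- apply/(has_zeroP G f Hf)/H => //; last exact/(sign_changeP G f Hf).
  exact/(continuous_on_unitP G f Hf).
Qed.

Lemma IVT_increasing_fieldP : m_IVT_increasing m <->
  forall f, rec_fun m f -> cont_on_unit f -> strictly_increasing f -> sign_changes f ->
    zero_exists f.
Proof.
split=> [H f /pcf_ex [G [HG Hf]] Hc Hi Hs|H G [[/is_pcf_fun [f [Hf Hr]] Hc] [Hi Hs]]].
- apply/(has_zeroP G f Hf)/H; split.
    by split=> //; apply/(continuous_on_unitP G f Hf).
  by split; [apply/(increasing_on_unitP G f Hf) | apply/(sign_changeP G f Hf)].
- apply/(has_zeroP G f Hf)/H => //.
  + exact/(continuous_on_unitP G f Hf).
  + exact/(increasing_on_unitP G f Hf).
  + exact/(sign_changeP G f Hf).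
Qed.

Lemma two_valued_constant_fieldP : m_two_valued_constant m <->
  forall f, rec_fun m f -> two_valued f ->
    forall x y, creal x -> creal y -> seqv m (cvalue f x) (cvalue f y).
Proof.
split=> [H f /pcf_ex [G [HG Hf]] H2 x y /creal_ex [X [HX HXx]] /creal_ex [Y [HY HYy]]
  |H G [/is_pcf_fun [f [Hf Hr]] H2] X Y [/creal_of [x [HXx Hx]] /creal_of [y [HYy Hy]]]].
- apply/(reqP m _ _ _ _ (denotes_app m _ _ _ _ Hf HXx) (denotes_app m _ _ _ _ Hf HYy))/H => //.
  by split=> //; apply/(two_valuedP G f Hf).
- apply/(reqP m _ _ _ _ (denotes_app m _ _ _ _ Hf HXx) (denotes_app m _ _ _ _ Hf HYy))/H => //.
  exact/(two_valuedP G f Hf).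
Qed.

Lemma IPP_fieldP : m_IPP m <->
  forall N c, Rec1 m c -> (forall i, c i <=m N) ->
    exists n, n <=m N /\ forall k, exists i, k <m i /\ c i = n.
Proof.
split=> [H N c Hc HcN|H N C [H1 [H2 H3]]].
- have [C HC] := rec_comprehension m
    (fun p => exists i, i <=m p /\ p = mpair m i (c i)) ltac:(rec).
  have HCc i j : mmem m (mpair m i j) C <-> j = c i.
    rewrite HC; split=> [[i' [_ /mpair_inj [-> ->]]] //|->].
    by exists i; split=> //; case: (mpair_ge m i (c i)).
  have [|n [Hn Hn']] := H N C.
  + split; [|split].
    * by move=> p /HC [i [_ ->]]; exists i, (c i); rewrite /m_any.
    * by move=> i _; exists (c i); apply/HCc.
    * by move=> i j k [/HCc -> /HCc ->].
  + by exists n; split=> // k; have [i [Hi /HCc E]] := Hn' k; exists i.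
- have H2' i : exists j, mmem m (mpair m i j) C by apply: H2.
  have [|c [Hc HcC]] := isF_search m (fun i j => mmem m (mpair m i j) C) _ H2'; first by rec.
  have [//||n [Hn Hn']] := H N c.
  + by move=> i; have [i' [j [/mpair_inj [_ ->] [_ Hj]]]] := H1 _ (HcC i).
  + exists n; split=> // k; have [i [Hi E]] := Hn' k; exists i; split=> //.
    by rewrite -E.
Qed.

End FieldPrinciples.

(** * The pigeonhole principle and collection *)

Section Collection.

Variable m : rca0_model.
Notation M := (mnum m).

(** Collection for a decidable matrix follows from $\Sigma^0_1$ induction on the range of [y]: the
    assertion that a bound exists is itself $\Sigma^0_1$. *)
Lemma rec_bounding (P : M -> M -> Prop) (b : M) : Dec2 m P ->
  (forall y, y <=m b -> exists z, P y z) -> exists w, forall y, y <=m b -> exists z, z <=m w /\ P y z.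
Proof.
move=> HP H.
suff K n : exists w, forall y, y <=m n -> y <=m b -> exists z, z <=m w /\ P y z.
  by have [w Hw] := K b; exists w => y Hy; apply: Hw.
apply: (m_ind m (fun n => exists w, forall y, y <=m n -> y <=m b -> exists z, z <=m w /\ P y z)) n => [||{}n [w Hw]].
- apply: S1_ex; apply: D1_S1; apply: D1_balle; first by rec.
  by apply: D1_imp; rec.
- have [z Hz] := H 0 (mge0 m b); exists z => y Hy _; exists z; split; first exact: mle_refl.
  by rewrite (mle_anti _ _ _ Hy (mge0 m y)).
- case: (classic (n + 1 <=m b)) => [/H [z Hz]|Hn].
  + exists (w + z) => y /mle_S [Hy|->] Hyb.
    * by have [z' [Hz' Hz'']] := Hw y Hy Hyb; exists z'; split=> //; mlra.
    * by exists z; split=> //; mlra.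
  + by exists w => y /mle_S [Hy|->] // Hyb; apply: Hw.
Qed.

(* If no [b] bounded the witnesses [y], a counterexample [k] could be computed
   from [b]; the pigeonhole principle makes one [k] a counterexample for all [b]. *)
Lemma IPP_collection (P : M -> M -> M -> Prop) (n : M) : m_IPP m ->
  D1 m (fun e => P (e 0%N) (e 1%N) (e 2%N)) ->
  (forall k, k <=m n -> exists y, forall z, P k y z) ->
  exists b, forall k, k <=m n -> exists y, y <=m b /\ forall z, P k y z.
Proof.
move=> /IPP_fieldP HIPP HP H; apply: NNPP => HN.
have HPp s t u := D1_app3 m P s t u HP.
(* [f b] codes a counterexample [k] together with a bound on the numbers [z] that refute all
   [y <= b]. The bound makes the condition decidable, so that it can be searched for. *)
have [|b|f [Hf Hfb]] := isF_search m
  (fun b p => mfst m p <=m n /\ forall y, y <=m b -> exists z, z <=m msnd m p /\ ~ P (mfst m p) y z).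
- apply: D1_and; first by rec.
  apply: D1_balle; first by rec.
  apply: D1_bexe; first by rec.
  by apply: D1_not; apply: HPp; rec.
- have [k [Hk Hkb]] : exists k, k <=m n /\ forall y, y <=m b -> exists z, ~ P k y z.
    apply: NNPP => K; apply: HN; exists b => k Hk; apply: NNPP => L; apply: K.
    exists k; split=> // y Hy; apply: NNPP => L'; apply: L; exists y; split=> // z.
    by apply: NNPP => L''; apply: L'; exists z.
  have [|w Hw] := rec_bounding (fun y z => ~ P k y z) b _ Hkb.
    by apply: D1_not; apply: HPp; rec.
  by exists (mpair m k w); rewrite mfst_pair msnd_pair.
- have [||k [Hk Hkinf]] := HIPP n (fun b => mfst m (f b)); first by rec.
    by move=> b; case: (Hfb b).
  (* The color [k] recurs at a stage [b] beyond a witness [y] for [k], yet [f b] claims to refute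
     this [y]. *)
  have [y Hy] := H k Hk; have [b [Hb Eb]] := Hkinf y.
  have [_ K] := Hfb b; have [|z [_]] := K y; first exact: mlt_le.
  by rewrite Eb; apply; apply: Hy.
Qed.

End Collection.

(** * Bisection *)

Section Exponential.

Variable m : rca0_model.
Notation M := (mnum m).
Notation F := (mfield m).

Lemma mexp_ex : exists f : M -> M -> M, Rec2 m f /\
  forall u, f u 0 = 1 /\ forall n, f u (n + 1) = f u n * u.
Proof.
have H1 : Rec1 m (fun _ => 1) by rec.
have H2 : Rec3 m (fun u _ v => v * u) by rec.
by have [f [Hf E]] := primitive_recursion m _ _ H1 H2; exists f.
Qed.

Definition mexp : M -> M -> M := proj1_sig (constructive_indefinite_description _ mexp_ex).

Lemma mexp_spec : Rec2 m mexp /\ forall u, mexp u 0 = 1 /\ forall n, mexp u (n + 1) = mexp u n * u.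
Proof. by rewrite /mexp; case: constructive_indefinite_description. Qed.

Lemma rec_mexp : Rec2 m mexp.
Proof. by case: mexp_spec. Qed.

Lemma mexp0 u : mexp u 0 = 1.
Proof. by case: mexp_spec => _ H; case: (H u). Qed.

Lemma mexpS u n : mexp u (n + 1) = mexp u n * u.
Proof. by case: mexp_spec => _ H; case: (H u). Qed.

End Exponential.

#[export] Hint Resolve rec_mexp : rec.

(** * Eventual properties *)

Section Limits.

Variable m : rca0_model.
Notation M := (mnum m).
Notation F := (mfield m).
Notation eventually := (eventually m).

Lemma eventually_and P Q : eventually P -> eventually Q -> eventually (fun s => P s /\ Q s).
Proof.
by move=> [b Hb] [c Hc]; exists (b + c) => s Hs; split; [apply: Hb | apply: Hc]; mlra.
Qed.

Lemma eventually_mono (P Q : M -> Prop) : (forall s, P s -> Q s) -> eventually P -> eventually Q.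
Proof. by move=> H [b Hb]; exists b => s /Hb /H. Qed.

Lemma eventually_ge n : eventually (fun s => n <=m s).
Proof. by exists n. Qed.

Lemma eventually_ex P : eventually P -> exists s, P s.
Proof. by move=> [b Hb]; exists b; apply: Hb; apply: mle_refl. Qed.

Definition stable (P : M -> Prop) : Prop := eventually P \/ eventually (fun s => ~ P s).

(** The field is Archimedean relative to the possibly nonstandard numbers of the model: a positive
    $a/(c+1)$ has $a \geq 1$. *)
Lemma archimedean (eps : F) : 0 < eps -> exists n : M, (n%:f + 1)^-1 < eps.
Proof.
move=> He; have /fge0P [a [c E]] : 0 <= eps by lra.
have Hc := den_gt0 m c.
have Ha : 0 <m a.
  by apply/finj_lt; rewrite finj_0; move: He; rewrite E pmulr_lgt0 // invr_gt0.
exists (c + 1); rewrite E finjE finj_1 ltr_pdivlMr // mulrC.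
rewrite ltr_pdivrMr; last by lra.
by move/finj_ltS: Ha; rewrite finj_0 => Ha; nra.
Qed.

End Limits.

Section Bisection.

Variable m : rca0_model.
Notation M := (mnum m).
Notation F := (mfield m).
Notation E := (mexp m (1 + 1)).

Lemma pow2_S n : (E (n + 1))%:f = (E n)%:f + (E n)%:f :> F.
Proof. by rewrite mexpS !finjE; ring. Qed.

Lemma pow2_gt n : n <m E n.
Proof.
apply: (rec_ind m (fun n => n <m E n)) n => [||n IH]; first by rec.
- by rewrite mexp0; mlra.
- by apply/finj_lt; rewrite pow2_S finjE finj_1; move/finj_ltS: IH; have := finj_ge0 m n; lra.
Qed.

Lemma pow2_gt0 n : 0 < (E n)%:f :> F.
Proof. by have /finj_lt := pow2_gt n; have := finj_ge0 m n; lra. Qed.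

Lemma pow2_le n n' : n <=m n' -> E n <=m E n'.
Proof.
move=> /mleP [d ->].
apply: (rec_ind m (fun d => E n <=m E (n + d))) d => [||d IH]; first by rec.
- by rewrite addr0; apply: mle_refl.
- apply: (mle_trans _ _ _ _ IH); apply/finj_le.
  by rewrite addrA pow2_S; have := pow2_gt0 (n + d); lra.
Qed.

(** [P q s] is the guess at stage [s] about the rational [q], such as whether $f(q)_s$ is positive.
    The guess is eventually false at [a] and eventually true at [b]; these end points may come in
    either order. *)
Variables (P : F -> M -> Prop) (a b : F).
Hypothesis HIPP : m_IPP m.
Hypothesis dec_P : Dec2 m (fun q s => P (rval m q) s).

Definition segment (t : F) : F := a + (b - a) * t.

Definition dyadic (n k : M) : F := segment (k%:f / (E n)%:f).

Hypothesis P_stable : forall t, 0 <= t -> t <= 1 -> stable m (P (segment t)).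
Hypothesis P_a : eventually m (fun s => ~ P a s).
Hypothesis P_b : eventually m (P b).

Lemma isF_dyadic (n k : (nat -> M) -> M) : isF m n -> isF m k ->
  isF m (fun e => rcode m (dyadic (n e) (k e))).
Proof.
move=> Hn Hk.
have [a1 [a2 [a3 Ea]]] := field_frac m a; have [b1 [b2 [b3 Eb]]] := field_frac m b.
(* A code stores its denominator diminished by 1, so a recursive predecessor of [E n] is required.
   Below, [A], [B] and [D] write the point over the common denominator of [a], [b] and [E n]. *)
have [p Hp] : exists p : M -> M, Rec1 m p /\ forall n, E n = p n + 1.
  have H n' : exists q, E n' = q + 1.
    by apply: m_pos_succ; apply/finj_lt; rewrite finj_0; apply: pow2_gt0.
  by have [|p [Hp Hp']] := isF_search m (fun n q => E n = q + 1) _ H; [rec | exists p].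
case: Hp => rec_p Hp.
pose A e := a1 * (b3 + 1) * E (n e) + b1 * (a3 + 1) * k e + a2 * (b3 + 1) * k e.
pose B e := a2 * (b3 + 1) * E (n e) + b2 * (a3 + 1) * k e + a1 * (b3 + 1) * k e.
pose D e := (a3 * b3 + a3 + b3) * E (n e) + p (n e).
apply: (isF_ext m (fun e => rcode m (((A e)%:f - (B e)%:f) / ((D e)%:f + 1)))); last first.
  by apply: isF_rcode_frac; rewrite /A /B /D; rec.
move=> e; congr rcode; rewrite /dyadic /segment Ea Eb.
have [[Ha Hb] HE] := (den_neq0 m a3, den_neq0 m b3, lt0r_neq0 (pow2_gt0 (n e))).
have -> : (D e)%:f + 1 = (a3%:f + 1) * (b3%:f + 1) * (E (n e))%:f.
  by rewrite /D !finjE (Hp (n e)) !finjE; ring.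
rewrite /A /B !finjE; field.
by rewrite Ha Hb HE.
Qed.

(** The midpoint between the points [k] and [k + 1] of level [n] is the point $2k + 1$ of level $n +
    1$. If the guess there is true, the change from false to true takes place in the left half. *)
Definition go_left (s n k : M) : Prop := P (dyadic (n + 1) ((1 + 1) * k + 1)) s.

Lemma dec_dyadic (n k s : (nat -> M) -> M) : isF m n -> isF m k -> isF m s ->
  D1 m (fun e => P (dyadic (n e) (k e)) (s e)).
Proof.
move=> Hn Hk Hs; apply: (@D1_ext m (fun e => P (rval m (rcode m (dyadic (n e) (k e)))) (s e))).
- by apply: (D1_app2 m (fun q s => P (rval m q) s)) => //; apply: isF_dyadic.
- by move=> e; rewrite rcodeK.
Qed.

(** [path s n] numbers the interval reached after [n] bisections in which all guesses are those of
    the fixed stage [s]. *)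
Lemma path_ex : exists path : M -> M -> M, Rec2 m path /\
  forall s, path s 0 = 0 /\ forall n, path s (n + 1) =
    if decide (go_left s n (path s n)) then (1 + 1) * path s n else (1 + 1) * path s n + 1.
Proof.
have H1 : Rec1 m (fun _ => 0) by rec.
have H2 : Rec3 m (fun s n k => if decide (go_left s n k) then (1 + 1) * k else (1 + 1) * k + 1).
  by apply: isF_if; [apply: dec_dyadic; rec | rec | rec].
by have [f [Hf Ef]] := primitive_recursion m _ _ H1 H2; exists f.
Qed.

Section Path.

Variable path : M -> M -> M.
Hypothesis rec_path : Rec2 m path.
Hypothesis path0 : forall s, path s 0 = 0.
Hypothesis pathS : forall s n, path s (n + 1) =
  if decide (go_left s n (path s n)) then (1 + 1) * path s n else (1 + 1) * path s n + 1.

Lemma path_step s n : exists d : F, (d = 0 \/ d = 1) /\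
  (path s (n + 1))%:f = (path s n)%:f + (path s n)%:f + d.
Proof.
rewrite pathS; case: decideP => _; [exists 0 | exists 1]; rewrite !finjE.
- by split; [left | ring].
- by split; [right | ring].
Qed.

Lemma path_lt s n : path s n <m E n.
Proof.
apply: (rec_ind m (fun n => path s n <m E n)) n => [||n IH]; first by rec.
- by rewrite path0 mexp0; mlra.
- apply/finj_lt; rewrite pow2_S; have [d [Hd ->]] := path_step s n; move/finj_ltS: IH.
  by case: Hd => ->; lra.
Qed.

(** The intervals reached are nested. Denominators are cleared to obtain a decidable statement about
    numbers, on which induction can proceed. *)
Lemma path_nested s n n' : n <=m n' ->
  (path s n)%:f * (E n')%:f <= (path s n')%:f * (E n)%:f :> F /\
  ((path s n')%:f + 1) * (E n)%:f <= ((path s n)%:f + 1) * (E n')%:f :> F.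
Proof.
move=> /mleP [d ->].
suff [/finj_le H1 /finj_le H2] : path s n * E (n + d) <=m path s (n + d) * E n /\
    (path s (n + d) + 1) * E n <=m (path s n + 1) * E (n + d).
  by move: H1 H2; rewrite !finjE.
apply: (rec_ind m (fun d => path s n * E (n + d) <=m path s (n + d) * E n /\
    (path s (n + d) + 1) * E n <=m (path s n + 1) * E (n + d))) d => [||d [/finj_le IH1 /finj_le IH2]].
- by rec.
- by rewrite addr0; split; apply: mle_refl.
- move: IH1 IH2; rewrite addrA !finj_mul !finj_add !finj_1 => IH1 IH2.
  have [c [Hc Ec]] := path_step s (n + d); have H := pow2_gt0 n.
  split; apply/finj_le; rewrite !finj_mul ?finj_add ?finj_1 pow2_S Ec.
  + by case: Hc => ->; nra.
  + by case: Hc => ->; nra.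
Qed.

Lemma segment_dist t t' d : 0 <= t' - t -> t' - t <= d -> `|segment t' - segment t| <= `|b - a| * d.
Proof.
move=> H0 H; rewrite /segment (_ : _ - _ = (b - a) * (t' - t)); last by ring.
by rewrite normrM (ger0_norm H0) ler_wpM2l.
Qed.

Lemma dyadic_double n k : dyadic (n + 1) ((1 + 1) * k) = dyadic n k.
Proof.
rewrite /dyadic pow2_S !finjE; congr segment; have H := lt0r_neq0 (pow2_gt0 n); field.
by rewrite H /=; apply: lt0r_neq0; have := pow2_gt0 n; lra.
Qed.

Lemma path_signs s : ~ P a s -> P b s -> forall n,
  ~ P (dyadic n (path s n)) s /\ P (dyadic n (path s n + 1)) s.
Proof.
move=> Ha Hb n.
apply: (rec_ind m (fun n => ~ P (dyadic n (path s n)) s /\ P (dyadic n (path s n + 1)) s)) n => [||{}n [IH1 IH2]].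
- by apply: D1_and; [apply: D1_not|]; apply: dec_dyadic; rec.
- rewrite path0 add0r /dyadic mexp0 !finjE mul0r divr1 /segment mulr0 addr0 mulr1.
  by rewrite addrC subrK.
- rewrite pathS; case: decideP => H.
  + by split=> //; rewrite dyadic_double.
  + split=> //; rewrite (_ : _ + 1 + 1 = (1 + 1) * (path s n + 1)); last by ring.
    by rewrite dyadic_double.
Qed.

Lemma dyadic_unit n k : k <=m E n -> 0 <= k%:f / (E n)%:f :> F /\ k%:f / (E n)%:f <= 1 :> F.
Proof.
move=> /finj_le Hk; have H := pow2_gt0 n.
by split; [apply: divr_ge0; [exact: finj_ge0|exact: ltW] | rewrite ler_pdivrMr // mul1r].
Qed.

Lemma dyadic_stable n : exists B, forall n' k, n' <=m n -> k <=m E n' ->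
  forall s, B <=m s -> (P (dyadic n' k) s <-> P (dyadic n' k) B).
Proof.
(* The pigeonhole principle enters the bisection here. [Q p y s] says that the guess at the point
   coded by [p] is the same at stages [y] and [s], provided [y <= s]. Collection ranges over all [p]
   up to [(n, E n)], so numbers that code no point have to satisfy [Q] vacuously. *)
pose Q p y s := (msnd m p <=m E (mfst m p) /\ y <=m s) ->
  (P (dyadic (mfst m p) (msnd m p)) s <-> P (dyadic (mfst m p) (msnd m p)) y).
have [||B HB] := IPP_collection m Q (mpair m n (E n)) HIPP.
- rewrite /Q; apply: D1_imp; first by rec.
  by apply: D1_iff; apply: dec_dyadic; rec.
- move=> p _; case: (classic (msnd m p <=m E (mfst m p))) => [Hp|Hp]; last by exists 0 => s [].
  have [H0 H1] := dyadic_unit _ _ Hp.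
  by case: (P_stable _ H0 H1) => -[y Hy]; exists y => s [_ Hs];
    have := Hy y (mle_refl _ _); have := Hy s Hs; rewrite -/(dyadic _ _); tauto.
- exists B => n' k Hn Hk s Hs.
  have [|y [Hy HQ]] := HB (mpair m n' k).
    by apply: mpair_le => //; apply: mle_trans Hk _; apply: pow2_le.
  move: HQ; rewrite /Q mfst_pair msnd_pair => HQ.
  rewrite (HQ s) ?(HQ B) //; split=> //; exact: mle_trans Hy Hs.
Qed.

Lemma path_stable n : exists B, forall s, B <=m s -> path s n = path B n.
Proof.
have [B HB] := dyadic_stable n; exists B => s Hs.
suff H n' : n' <=m n -> path s n' = path B n' by apply: H; apply: mle_refl.
apply: (rec_ind m (fun n' => n' <=m n -> path s n' = path B n')) n' => [||n' IH Hn].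
- by apply: D1_imp; rec.
- by rewrite !path0.
- rewrite !pathS IH; last by mlra.
  have Hk : (1 + 1) * path B n' + 1 <=m E (n' + 1).
    apply/finj_le; rewrite pow2_S !finjE.
    by have /finj_ltS := path_lt B n'; lra.
  have := HB (n' + 1) _ Hn Hk s Hs; rewrite /go_left.
  by case: decideP; case: decideP => //; tauto.
Qed.

(** The ends of the interval of level [n] no longer change once the path has settled up to that
    level. They are fixed rationals with opposite guesses at all late stages, and the diagonal
    point, lying deeper in the same path, stays between them. *)
Lemma bisection_approx (delta : F) : 0 < delta -> exists y z, eventually m (fun s =>
  (`|dyadic s (path s s) - y| < delta /\ `|dyadic s (path s s) - z| < delta) /\
  (~ P y s /\ P z s)).
Proof.
move=> Hd; have [n Hn] : exists n, `|b - a| / (E n)%:f < delta.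
  (* The summand 1 keeps the divisor positive even for [a = b]. *)
  have Hc : 0 < `|b - a| + 1 :> F by have := normr_ge0 (b - a); lra.
  have [n Hn] := archimedean m (delta / (`|b - a| + 1)) ltac:(by rewrite divr_gt0).
  exists n; have HE := pow2_gt0 n; have Hn0 := den_gt0 m n.
  have HnE : n%:f + 1 <= (E n)%:f :> F by apply/finj_ltS/pow2_gt.
  move: Hn; rewrite ltr_pdivlMr // mulrC ltr_pdivrMr // => Hn.
  rewrite ltr_pdivrMr //; nra.
have [B HB] := path_stable n.
exists (dyadic n (path B n)), (dyadic n (path B n + 1)).
apply: eventually_mono (eventually_and m _ _ (eventually_and m _ _ P_a P_b)
  (eventually_and m _ _ (eventually_ge m n) (eventually_ge m B))) => s [[Ha Hb] [Hns HBs]].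
split; last by rewrite -(HB s HBs); apply: path_signs.
have [H1 H2] := path_nested s n s Hns; rewrite (HB s HBs) in H1 H2.
have [Es En] := (pow2_gt0 s, pow2_gt0 n).
have K1 : (path B n)%:f / (E n)%:f <= (path s s)%:f / (E s)%:f :> F.
  by rewrite ler_pdivrMr // mulrAC ler_pdivlMr.
have K2 : ((path s s)%:f + 1) / (E s)%:f <= ((path B n)%:f + 1) / (E n)%:f :> F.
  by rewrite ler_pdivrMr // mulrAC ler_pdivlMr.
have Is : 0 < (E s)%:f^-1 :> F by rewrite invr_gt0.
rewrite !mulrDl !mul1r in K2.
split; apply: le_lt_trans Hn.
- by apply: segment_dist; lra.
- by rewrite distrC; apply: segment_dist; rewrite finjE finj_1 mulrDl mul1r; lra.
Qed.

End Path.

(** The limit is the diagonal: at stage [s], the point reached after [s] bisections with the guesses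
    of that stage. It is Cauchy because any short enough interval that has become stable retains it;
    the stage at which this happens is not computed. *)
Theorem bisection : exists x, creal m x /\
  (forall n, exists t, (0 <= t /\ t <= 1) /\ x n = segment t) /\
  forall delta, 0 < delta -> exists y z, eventually m (fun s =>
    (`|x s - y| < delta /\ `|x s - z| < delta) /\ (~ P y s /\ P z s)).
Proof.
have [path [rec_path Hpath]] := path_ex.
have path0 s : path s 0 = 0 by case: (Hpath s).
have pathS s := proj2 (Hpath s).
have Happ := bisection_approx path rec_path path0 pathS.
exists (fun s => dyadic s (path s s)); split; [split|split] => //.
- by apply: isF_dyadic; rec.
- move=> eps He; have [|y [z [N HN]]] := Happ (eps / 2); first by lra.
  exists N => i j [Hi Hj]; have [[K1 _] _] := HN i Hi; have [[K2 _] _] := HN j Hj.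
  rewrite (_ : _ - _ = (dyadic i (path i i) - y) - (dyadic j (path j j) - y)); last by ring.
  apply: le_lt_trans (ler_normB _ _) _; lra.
- move=> n; exists ((path n n)%:f / (E n)%:f); split=> //.
  by apply: dyadic_unit; apply: mlt_le; apply: path_lt.
Qed.

End Bisection.

(** * From the pigeonhole principle to the intermediate value theorem *)

Section Sequences.

Variable m : rca0_model.
Notation M := (mnum m).
Notation F := (mfield m).
Implicit Types (x y u v : M -> F) (f : F -> M -> F).

Lemma eventually_contra (Q : Prop) (P P' : M -> Prop) :
  eventually m P -> eventually m P' -> (forall s, P s -> P' s -> Q) -> Q.
Proof. by move=> H H' K; have [s [/K K' /K']] := eventually_ex m _ (eventually_and m _ _ H H'). Qed.

Lemma seqv_sym x y : seqv m x y -> seqv m y x.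
Proof. by case. Qed.

Lemma sle_trans y x z : sle m x y -> sle m y z -> sle m x z.
Proof.
move=> H1 H2 eps He.
have [K1 K2] := (H1 (eps / 2) ltac:(lra), H2 (eps / 2) ltac:(lra)).
by apply: eventually_mono (eventually_and m _ _ K1 K2) => s [? ?]; lra.
Qed.

Lemma seqv_trans y x z : seqv m x y -> seqv m y z -> seqv m x z.
Proof. by move=> [H1 H2] [H3 H4]; split; apply: (sle_trans y). Qed.

Lemma seqvP x y : seqv m x y <-> forall eps, 0 < eps -> eventually m (fun n => `|x n - y n| < eps).
Proof.
split=> [[H1 H2] eps He|H].
- have [K1 K2] := (H1 (eps / 2) ltac:(lra), H2 (eps / 2) ltac:(lra)).
  apply: eventually_mono (eventually_and m _ _ K1 K2) => s [? ?].
  by rewrite ltr_norml; apply/andP; split; lra.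
- by split=> eps He; apply: eventually_mono (H eps He) => s; rewrite ltr_norml => /andP[]; lra.
Qed.

Lemma slt_intro x y (d : F) : 0 < d -> eventually m (fun n => x n + d <= y n) -> slt m x y.
Proof.
move=> Hd H; split.
- by move=> eps He; apply: eventually_mono H => s; lra.
- move=> /seqvP /(_ d Hd) K; apply: (eventually_contra _ _ _ H K) => s H1.
  by rewrite ltr_norml => /andP[]; lra.
Qed.

(** Failure of equality yields a distance [eps] at arbitrarily late places only. From some place on
    both sequences vary by less than [eps / 4], so part of the distance persists. *)
Lemma slt_gap x y : scauchy m x -> scauchy m y -> slt m x y ->
  exists d : F, 0 < d /\ eventually m (fun n => x n + d < y n).
Proof.
move=> Hx Hy [Hle Hne]; have [eps [He Hn]] : exists eps : F, 0 < eps /\ forall N, exists n, N <=m n /\ x n + eps < y n.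
  apply: NNPP => H; apply: Hne; split=> // eps He; apply: NNPP => K; apply: H; exists eps; split=> // N.
  apply: NNPP => L; apply: K; exists N => n Hn; rewrite leNgt; apply/negP => L'; apply: L.
  by exists n.
exists (eps / 4); split; first by lra.
have [[N HN] [N' HN']] := (Hx (eps / 4) ltac:(lra), Hy (eps / 4) ltac:(lra)).
have [n [Hn1 Hn2]] := Hn (N + N').
exists (N + N') => s Hs.
have [HNn HNs] : N <=m n /\ N <=m s by split; clear Hx Hy HN HN'; mlra.
have [HNn' HNs'] : N' <=m n /\ N' <=m s by split; clear Hx Hy HN HN'; mlra.
have := HN n s (conj HNn HNs); have := HN' n s (conj HNn' HNs').
rewrite !ltr_norml => /andP[? ?] /andP[? ?]; lra.
Qed.

Lemma creal_cst (a : F) : creal m (cst m a).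
Proof.
split; first exact: (isF_cst m (rcode m a)).
by move=> eps He; exists 0 => i j _; rewrite /cst subrr normr0.
Qed.

Lemma cauchy_sign u : scauchy m u -> [\/ seqv m u (cst m 0),
  exists d : F, 0 < d /\ eventually m (fun n => d < u n) |
  exists d : F, 0 < d /\ eventually m (fun n => u n < - d)].
Proof.
move=> Hu; have Hc : scauchy m (cst m 0) by case: (creal_cst 0).
case: (classic (seqv m u (cst m 0))) => [|H]; first by apply: Or31.
case: (classic (sle m u (cst m 0))) => Hle.
- have [|d [Hd K]] := slt_gap _ _ Hu Hc; first by split.
  by apply: Or33; exists d; split=> //; apply: eventually_mono K => s; rewrite /cst; lra.
- have [eps [He Hn]] : exists eps : F, 0 < eps /\ forall N, exists n, N <=m n /\ eps < u n.
    apply: NNPP => K; apply: Hle => eps He; apply: NNPP => L; apply: K; exists eps; split=> // N.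
    apply: NNPP => L'; apply: L; exists N => n Hn; rewrite leNgt; apply/negP => L''; apply: L'.
    by exists n; split=> //; move: L''; rewrite /cst add0r.
  apply: Or32; exists (eps / 2); split; first by lra.
  have [N HN] := Hu (eps / 2) ltac:(lra); have [n [Hn1 Hn2]] := Hn N; exists N => s Hs.
  by have := HN n s (conj Hn1 Hs); rewrite ltr_norml => /andP[? ?]; lra.
Qed.

Lemma near_intro x (d d' y : F) : d < d' -> eventually m (fun n => `|x n - y| <= d) -> near m x d' y.
Proof.
move=> Hd H; apply: (slt_intro _ _ (d' - d)); first by lra.
by apply: eventually_mono H => s; lra.
Qed.

Lemma near_self x (d : F) : scauchy m x -> 0 < d -> eventually m (fun n => near m x d (x n)).
Proof.
move=> Hx Hd; have [N HN] := Hx (d / 2) ltac:(lra); exists N => n Hn.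
apply: (near_intro _ (d / 2)); first by lra.
by exists N => s Hs; apply/ltW/HN.
Qed.

Lemma inv_gt0 (N : M) : 0 <m N -> 0 < N%:f^-1 :> F.
Proof. by move=> /finj_lt; rewrite finj_0 invr_gt0. Qed.

Lemma domain_close f x : in_domain m f x -> forall eps : F, 0 < eps -> exists d : F, 0 < d /\
  forall y z : F, near m x d y -> near m x d z -> eventually m (fun s => `|f y s - f z s| < eps).
Proof.
move=> H eps He; have [N [HN K]] := H eps He; exists N%:f^-1; split; first exact: inv_gt0.
by move=> y z Hy Hz; exists N => s Hs; apply: K.
Qed.

(** For late [s] the rational [x s] lies itself in the ball around [x], so continuity compares the
    diagonal value [f (x s) s] with [f y s]. *)
Lemma domain_value f x : scauchy m x -> in_domain m f x -> forall eps : F, 0 < eps -> exists d : F, 0 < d /\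
  forall y : F, near m x d y -> eventually m (fun s => `|cvalue m f x s - f y s| < eps).
Proof.
move=> Hx H eps He; have [N [HN K]] := H eps He; exists N%:f^-1; split; first exact: inv_gt0.
move=> y Hy; apply: eventually_mono (eventually_and m _ _ (near_self x _ Hx (inv_gt0 _ HN)) (eventually_ge m N))
  => s [Hs HNs]; exact: K.
Qed.

Lemma near_cst (a d : F) : 0 < d -> near m (cst m a) d a.
Proof.
move=> Hd; apply: (near_intro _ 0) => //; exists 0 => s _.
by rewrite /cst subrr normr0.
Qed.

Lemma domain_cauchy f (a : F) : in_domain m f (cst m a) -> scauchy m (f a).
Proof.
move=> H eps He; have [N [HN K]] := H eps He; exists N => i j Hij.
by apply: K => //; apply/near_cst/inv_gt0.
Qed.

Lemma domain_seqv f x (a : F) : scauchy m x -> in_domain m f x -> seqv m x (cst m a) ->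
  seqv m (cvalue m f x) (f a).
Proof.
move=> Hx H Hxa; apply/seqvP => eps He; have [d [Hd K]] := domain_value _ _ Hx H eps He.
apply: K; apply: (near_intro _ (d / 2)); first by lra.
by move/seqvP: Hxa => /(_ (d / 2) ltac:(lra)); apply: eventually_mono => s /ltW.
Qed.

(** Values respect equality of reals, so a zero equal to an end point would make [f] vanish
    there. *)
Lemma zero_in_open f x : creal m x -> in_unit m x -> in_domain m f x ->
  seqv m (cvalue m f x) (cst m 0) ->
  ~ seqv m (f 0) (cst m 0) -> ~ seqv m (f 1) (cst m 0) ->
  slt m (cst m 0) x /\ slt m x (cst m 1).
Proof.
move=> [_ Hx] [H0 H1] Hd Hz N0 N1; split; split=> // H.
- apply: N0; apply: seqv_trans Hz; apply/seqv_sym/domain_seqv => //; exact: seqv_sym.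
- by apply: N1; apply: seqv_trans Hz; apply/seqv_sym/domain_seqv.
Qed.

(** [e] is the direction of the sign change, which reduces matters to a function that is negative at
    0 and positive at 1. A limit 0 at either end would make the product 0, as Cauchy sequences are
    bounded from some place on; equal signs would make it positive. *)
Lemma sign_change_cases f : scauchy m (f 0) -> scauchy m (f 1) -> sign_changes m f ->
  exists e : F, (e = 1 \/ e = -1) /\ exists d : F, 0 < d /\
    eventually m (fun s => e * f 0 s < - d /\ d < e * f 1 s).
Proof.
move=> H0 H1 [Hle Hne].
have Hzero u v : seqv m u (cst m 0) -> scauchy m v -> seqv m (fun n => u n * v n) (cst m 0).
  move=> /seqvP Hu Hv; apply/seqvP => eps He.
  have [N HN] := Hv 1 ltr01; have Hb : 0 < `|v N| + 1 :> F by have := normr_ge0 (v N); lra.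
  have Heb : 0 < eps / (`|v N| + 1) by rewrite divr_gt0.
  apply: eventually_mono (eventually_and m _ _ (Hu _ Heb) (eventually_ge m N)) => s [K Hs].
  rewrite /cst subr0 normrM; rewrite /cst subr0 ltr_pdivlMr // in K.
  apply: le_lt_trans K; apply: ler_wpM2l => //.
  have := HN s N (conj Hs (mle_refl _ _)); have := ler_normD (v s - v N) (v N); rewrite subrK; lra.
have HC : (fun n => f 0 n * f 1 n) = (fun n => f 1 n * f 0 n).
  by apply: functional_extensionality => n; rewrite mulrC.
case: (cauchy_sign _ H0) => [Z|[d [Hd K]]|[d [Hd K]]].
- by case: Hne; apply: Hzero.
- case: (cauchy_sign _ H1) => [Z|[d' [Hd' K']]|[d' [Hd' K']]].
  + by case: Hne; rewrite HC; apply: Hzero.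
  + exfalso; have /Hle L : 0 < d * d' / 2 by have := mulr_gt0 Hd Hd'; lra.
    apply: (eventually_contra _ _ _ L (eventually_and m _ _ K K')) => s; rewrite /cst add0r => L1 [L2 L3].
    by have := mulr_gt0 Hd Hd'; nra.
  + exists (-1); split; first by right.
    exists (Num.min d d'); split; first by rewrite lt_min Hd.
    apply: eventually_mono (eventually_and m _ _ K K') => s [L1 L2].
    have [M1 M2] : Num.min d d' <= d /\ Num.min d d' <= d' by rewrite !ge_min !lexx orbT.
    by split; lra.
- case: (cauchy_sign _ H1) => [Z|[d' [Hd' K']]|[d' [Hd' K']]].
  + by case: Hne; rewrite HC; apply: Hzero.
  + exists 1; split; first by left.
    exists (Num.min d d'); split; first by rewrite lt_min Hd.
    apply: eventually_mono (eventually_and m _ _ K K') => s [L1 L2].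
    have [M1 M2] : Num.min d d' <= d /\ Num.min d d' <= d' by rewrite !ge_min !lexx orbT.
    by split; lra.
  + exfalso; have /Hle L : 0 < d * d' / 2 by have := mulr_gt0 Hd Hd'; lra.
    apply: (eventually_contra _ _ _ L (eventually_and m _ _ K K')) => s; rewrite /cst add0r => L1 [L2 L3].
    by have := mulr_gt0 Hd Hd'; nra.
Qed.

Lemma dec_lt_value f (a : F) : rec_fun m f -> Dec2 m (fun q s => a < f (rval m q) s).
Proof.
move=> Hf; pose g q s := rcode m (f (rval m q) s); have Hg : Rec2 m g := Hf.
apply: (@D1_ext m (fun e => rval m (rcode m a) < rval m (g (e 0%N) (e 1%N)))).
- by apply: (D1_app2 m (fun q r => rval m q < rval m r) _ _ (dec_rval_lt m)); rec.
- by move=> e; rewrite /g !rcodeK.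
Qed.

Lemma dec_gt_value f (a : F) : rec_fun m f -> Dec2 m (fun q s => f (rval m q) s < a).
Proof.
move=> Hf; pose g q s := rcode m (f (rval m q) s); have Hg : Rec2 m g := Hf.
apply: (@D1_ext m (fun e => rval m (g (e 0%N) (e 1%N)) < rval m (rcode m a))).
- by apply: (D1_app2 m (fun q r => rval m q < rval m r) _ _ (dec_rval_lt m)); rec.
- by move=> e; rewrite /g !rcodeK.
Qed.

Lemma unit_cst (a : F) : 0 <= a -> a <= 1 -> in_unit m (cst m a).
Proof. by move=> H0 H1; split=> eps He; exists 0 => n _; rewrite /cst; lra. Qed.

(* When [f] vanishes at no rational, its sign at a rational stabilizes, and
   bisection applies to it. *)
Lemma IPP_IVT : m_IPP m -> m_IVT m.
Proof.
move=> HIPP; apply/IVT_fieldP => f Hf Hc Hs.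
have Hcst (t : F) : 0 <= t -> t <= 1 -> in_domain m f (cst m t).
  by move=> H0 H1; apply: Hc; [apply: creal_cst | apply: unit_cst].
have Hcau t (H0 : 0 <= t) (H1 : t <= 1) := domain_cauchy f t (Hcst t H0 H1).
have [e [He [d [Hd Hev]]]] := sign_change_cases f (Hcau 0 (lexx _) ler01) (Hcau 1 ler01 (lexx _)) Hs.
have N0 : ~ seqv m (f 0) (cst m 0).
  move=> /seqvP /(_ d Hd) K; apply: (eventually_contra _ _ _ Hev K) => s [L1 L2].
  by rewrite /cst subr0 ltr_norml => /andP[? ?]; case: He => E; rewrite E in L1; lra.
have N1 : ~ seqv m (f 1) (cst m 0).
  move=> /seqvP /(_ d Hd) K; apply: (eventually_contra _ _ _ Hev K) => s [L1 L2].
  by rewrite /cst subr0 ltr_norml => /andP[? ?]; case: He => E; rewrite E in L2; lra.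
suff [x [Hx [Hu Hz]]] : exists x, creal m x /\ in_unit m x /\ seqv m (cvalue m f x) (cst m 0).
  by exists x; split=> //; split=> //; apply: zero_in_open (Hc x Hx Hu) Hz N0 N1.
case: (classic (exists t, [/\ 0 <= t, t <= 1 & seqv m (f t) (cst m 0)])) => [[t [H0 H1 Hz]]|HN].
  by exists (cst m t); split; [apply: creal_cst | split; [apply: unit_cst|]].
pose P (y : F) s := 0 < e * f y s.
have decP : Dec2 m (fun q s => P (rval m q) s).
  case: He => E.
  - by apply: (@D1_ext m _ _ (dec_lt_value f 0 Hf)) => e'; rewrite /P E mul1r.
  - by apply: (@D1_ext m _ _ (dec_gt_value f 0 Hf)) => e'; rewrite /P E mulN1r oppr_gt0.
have seg01 t : segment m 0 1 t = t by rewrite /segment subr0 add0r mul1r.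
have Pst t : 0 <= t -> t <= 1 -> stable m (P (segment m 0 1 t)).
  rewrite seg01 => H0 H1; case: (cauchy_sign _ (Hcau t H0 H1)) => [Z|[c [Hc0 K]]|[c [Hc0 K]]].
  - by case: HN; exists t.
  - by case: He => E; [left|right]; apply: eventually_mono K => s; rewrite /P E; lra.
  - by case: He => E; [right|left]; apply: eventually_mono K => s; rewrite /P E; lra.
have [||x [Hx [Hseg Happ]]] := bisection m P 0 1 HIPP decP Pst.
- by apply: eventually_mono Hev => s [? ?]; rewrite /P; lra.
- by apply: eventually_mono Hev => s [? ?]; rewrite /P; lra.
have Hu : in_unit m x.
  by split=> eps Heps; exists 0 => n _; have [t [[H0 H1] ->]] := Hseg n; rewrite seg01 /cst; lra.
exists x; split=> //; split=> //; apply/seqvP => eps Heps.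
(* The values at [y] and [z] have opposite signs, up to zero, and both come within [eps] of the
   value at [x], which is thereby squeezed between [- eps] and [eps]. *)
have [c [Hc0 K]] := domain_value f x (proj2 Hx) (Hc x Hx Hu) eps Heps.
have [|y [z Hyz]] := Happ (c / 2); first by lra.
have Hy : near m x c y.
  by apply: (near_intro _ (c / 2)); [lra | apply: eventually_mono Hyz => s [[/ltW]]].
have Hz : near m x c z.
  by apply: (near_intro _ (c / 2)); [lra | apply: eventually_mono Hyz => s [[_ /ltW]]].
apply: eventually_mono (eventually_and m _ _ Hyz (eventually_and m _ _ (K y Hy) (K z Hz))).
move=> s [[_ [Py Pz]] []]; rewrite /cst subr0 !ltr_norml => /andP[? ?] /andP[? ?].
move/negP: Py; rewrite /P -leNgt => Py; rewrite /P in Pz.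
by case: He => E; rewrite E in Py Pz; apply/andP; split; lra.
Qed.

(** Bisection asks whether the value exceeds 1/2, between rationals [a] and [b] so close to [x] and
    [y] that the values change by less than 1/4. Every value is eventually within 1/4 of 0 or of 1.
    Hence two points near the limit with different answers have values more than 1/2 apart, whereas
    continuity there allows less than 1/4. *)
Lemma two_valued_separation f x y : m_IPP m -> rec_fun m f -> two_valued m f ->
  creal m x -> creal m y -> seqv m (cvalue m f x) (cst m 0) -> seqv m (cvalue m f y) (cst m 1) -> False.
Proof.
move=> HIPP Hf [Hdom H2] Hx Hy /seqvP /(_ (1 / 4) ltac:(lra)) Zx /seqvP /(_ (1 / 4) ltac:(lra)) Zy.
pose P (z : F) s := 1 / 2 < f z s.
have decP : Dec2 m (fun q s => P (rval m q) s) := dec_lt_value f (1 / 2) Hf.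
have Hval z : eventually m (fun s => `|f z s| < 1 / 4) \/ eventually m (fun s => `|f z s - 1| < 1 / 4).
  case: (H2 _ (creal_cst z)) => /seqvP /(_ (1 / 4) ltac:(lra)) H; [left|right] => //.
  by apply: eventually_mono H => s; rewrite /cvalue /cst subr0.
have Pst z : stable m (P z).
  case: (Hval z) => H; [right|left]; apply: eventually_mono H => s; rewrite ltr_norml => /andP[? ?]; rewrite /P; lra.
have Hnear z (Hz : creal m z) : exists a : F, eventually m (fun s => `|cvalue m f z s - f a s| < 1 / 4).
  have [d [Hd K]] := domain_value f z (proj2 Hz) (Hdom z Hz) (1 / 4) ltac:(lra).
  have [n Hn] := eventually_ex m _ (near_self z d (proj2 Hz) Hd).
  by exists (z n); apply: K.
have [[a Ha] [b Hb]] := (Hnear x Hx, Hnear y Hy).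
have [||c [Hc [_ Happ]]] := bisection m P a b HIPP decP (fun t _ _ => Pst _).
- apply: eventually_mono (eventually_and m _ _ Zx Ha) => s [].
  by rewrite /cst subr0 !ltr_norml => /andP[? ?] /andP[? ?]; rewrite /P; lra.
- apply: eventually_mono (eventually_and m _ _ Zy Hb) => s [].
  by rewrite /cst !ltr_norml => /andP[? ?] /andP[? ?]; rewrite /P; lra.
have [d [Hd K]] := domain_close f c (Hdom c Hc) (1 / 4) ltac:(lra).
have [|u [v Huv]] := Happ (d / 2); first by lra.
have Hu : near m c d u.
  by apply: (near_intro _ (d / 2)); [lra | apply: eventually_mono Huv => s [[/ltW]]].
have Hv : near m c d v.
  by apply: (near_intro _ (d / 2)); [lra | apply: eventually_mono Huv => s [[_ /ltW]]].
have L := eventually_and m _ _ Huv (K u v Hu Hv).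
case: (Hval u) => Eu; case: (Hval v) => Ev;
  apply: (eventually_contra _ _ _ L (eventually_and m _ _ Eu Ev)) => s [[_ [Pu Pv]]];
  move/negP: Pu; rewrite /P -leNgt => Pu; rewrite /P in Pv;
  rewrite !ltr_norml => /andP[? ?] [/andP[? ?] /andP[? ?]]; lra.
Qed.

Lemma IPP_two_valued_constant : m_IPP m -> m_two_valued_constant m.
Proof.
move=> HIPP; apply/two_valued_constant_fieldP => f Hf H2 x y Hx Hy.
have [_ H] := H2; case: (H x Hx) => Ex; case: (H y Hy) => Ey.
- exact/(seqv_trans _ _ _ Ex)/seqv_sym.
- by case: (two_valued_separation f x y).
- by case: (two_valued_separation f y x).
- exact/(seqv_trans _ _ _ Ex)/seqv_sym.
Qed.

End Sequences.

(** * Digits *)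

Section Division.

Variable m : rca0_model.
Notation M := (mnum m).
Notation F := (mfield m).
Implicit Types a d q r : M.

Lemma div_ex a d : 0 <m d -> exists q r, a = q * d + r /\ r <m d.
Proof.
move=> Hd; apply: (m_ind m (fun a => exists q r, a = q * d + r /\ r <m d)) a => [||a [q [r [-> Hr]]]].
- by do 2!apply: S1_ex; apply: D1_S1; rec.
- by exists 0, 0; rewrite mul0r add0r.
- case: (classic (r + 1 <m d)) => H; first by exists q, (r + 1); rewrite addrA.
  by exists (q + 1), 0; split=> //; have -> : d = r + 1; [mlra | ring].
Qed.

Lemma div_unique q r q' r' d : q * d + r = q' * d + r' -> r <m d -> r' <m d -> q = q' /\ r = r'.
Proof.
move=> E Hr Hr'.
have H (x y u v : M) : x * d + u = y * d + v -> u <m d -> ~ x <m y.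
  move=> /(f_equal (finj m)); rewrite !finjE => E' /finj_ltS Hu /finj_ltS Hxy.
  by have := (finj_ge0 m v, finj_ge0 m d) => -[? ?]; fnra.
case: (mlt_total m q q') => [/(H _ _ _ _ E Hr) //|E'|/(H _ _ _ _ (esym E) Hr') //].
by split=> //; move: E; rewrite E' ![_ * d + _]addrC => /maddIr.
Qed.

Definition mdiv a d : M :=
  if decide (0 <m d) then epsilon (inhabits 0) (fun q => exists r, a = q * d + r /\ r <m d) else 0.
Definition mmod a d : M :=
  if decide (0 <m d) then epsilon (inhabits 0) (fun r => exists q, a = q * d + r /\ r <m d) else 0.

Lemma mdivP q r d : r <m d -> mdiv (q * d + r) d = q /\ mmod (q * d + r) d = r.
Proof.
move=> Hr; rewrite /mdiv /mmod; case: decideP => [Hd|[]]; last by mlra.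
have [|r' [E Hr']] := epsilon_spec (inhabits 0) (fun q' => exists r', q * d + r = q' * d + r' /\ r' <m d).
  by exists q, r.
have [|q' [E' Hr'']] := epsilon_spec (inhabits 0) (fun r' => exists q', q * d + r = q' * d + r' /\ r' <m d).
  by exists r, q.
by split; [case: (div_unique _ _ _ _ _ E) | case: (div_unique _ _ _ _ _ E')].
Qed.

Lemma div_eq a d : 0 <m d -> a = mdiv a d * d + mmod a d /\ mmod a d <m d.
Proof.
by move=> Hd; have [q [r [-> Hr]]] := div_ex a d Hd; case: (mdivP q r d Hr) => -> ->.
Qed.

Lemma rec_mdiv : Rec2 m mdiv.
Proof.
apply: (isF_graph m (fun y e => (0 <m e 1%N /\ exists r, r <m e 1%N /\ e 0%N = y * e 1%N + r)
  \/ (~ 0 <m e 1%N /\ y = 0))); last by apply: D1_S1; rec.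
move=> e y; case: (classic (0 <m e 1%N)) => Hd.
- split=> [[[_ [r [Hr ->]]]|[]] //|->]; first by case: (mdivP y r _ Hr).
  by left; split=> //; exists (mmod (e 0%N) (e 1%N)); case: (div_eq (e 0%N) _ Hd).
- by rewrite /mdiv; case: decideP => // _; tauto.
Qed.

Lemma rec_mmod : Rec2 m mmod.
Proof.
have rec_div := rec_mdiv.
apply: (isF_graph m (fun y e => (0 <m e 1%N /\ e 0%N = mdiv (e 0%N) (e 1%N) * e 1%N + y)
  \/ (~ 0 <m e 1%N /\ y = 0))); last by apply: D1_S1; rec.
move=> e y; case: (classic (0 <m e 1%N)) => Hd.
- have [E _] := div_eq (e 0%N) _ Hd; split=> [[[_ E']|[]] //|->]; last by left.
  by move: E'; rewrite {1}E ![_ * e 1%N + _]addrC => /maddIr.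
- by rewrite /mmod; case: decideP => // _; tauto.
Qed.

Lemma mdiv_le a b d : 0 <m d -> a <=m b -> mdiv a d <=m mdiv b d.
Proof.
move=> Hd Hab; apply/mltNge => H.
have [Ea Ha] := div_eq a d Hd; have [Eb Hb] := div_eq b d Hd.
move/finj_le: Hab; rewrite Ea Eb !finjE; move/finj_ltS: H; move/finj_ltS: Hb => Hb H.
by have := (finj_ge0 m (mmod a d), finj_ge0 m d) => -[? ?] ?; fnra.
Qed.

Lemma mdiv_small a d : a <m d -> mdiv a d = 0.
Proof. by move=> H; have := mdivP 0 a d H; rewrite mul0r add0r => -[]. Qed.

Lemma mdiv_eq0 a d : 0 <m d -> mdiv a d = 0 -> a <m d.
Proof. by move=> Hd E; have [Ea Ha] := div_eq a d Hd; rewrite Ea E mul0r add0r. Qed.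

Lemma mdiv_mdiv a d e : 0 <m d -> 0 <m e -> mdiv (mdiv a d) e = mdiv a (d * e).
Proof.
move=> Hd He; have [Ea Ha] := div_eq a d Hd; have [Eq Hq] := div_eq (mdiv a d) e He.
set q := mdiv (mdiv a d) e in Eq *; set s := mmod (mdiv a d) e in Eq Hq; set r := mmod a d in Ea Ha.
have -> : a = q * (d * e) + (s * d + r) by rewrite {1}Ea Eq; ring.
have [] := mdivP q (s * d + r) (d * e) => //.
apply/finj_lt; rewrite !finjE; move/finj_ltS: Hq; move/finj_ltS: Ha => Ha Hq.
by have := finj_ge0 m d; fnra.
Qed.

End Division.

#[export] Hint Resolve rec_mdiv rec_mmod : rec.

(** * Digits to base $N + 1$ and the cyclic move of a digit *)

Section Digits.

Variable m : rca0_model.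
Notation M := (mnum m).
Notation F := (mfield m).
Variable N : M.
Notation B := (N + 1).
Notation E := (mexp m B).

Lemma base_gt0 : 0 <m B.
Proof. by apply/finj_lt; rewrite !finjE den_gt0. Qed.

Lemma mmul_gt0 (a b : M) : 0 <m a -> 0 <m b -> 0 <m a * b.
Proof. exact: posden_mul. Qed.

Lemma exp_gt0 n : 0 <m E n.
Proof.
apply: (rec_ind m (fun n => 0 <m E n)) n => [||n IH]; first by rec.
- by rewrite mexp0; apply/finj_lt; rewrite !finjE.
- by rewrite mexpS; apply: mmul_gt0 => //; apply: base_gt0.
Qed.

Lemma expD n n' : E (n + n') = E n * E n'.
Proof.
apply: (rec_ind m (fun n' => E (n + n') = E n * E n')) n' => [||n' IH]; first by rec.
- by rewrite addr0 mexp0 mulr1.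
- by rewrite addrA !mexpS IH mulrA.
Qed.

Definition digit (j L : M) : M := mmod m (mdiv m L (E j)) B.

Lemma rec_digit : Rec2 m digit.
Proof. by rewrite /digit; rec. Qed.
Hint Resolve rec_digit : rec.

Lemma digit_le j L : digit j L <=m N.
Proof. by apply/mlt_S; rewrite /digit; case: (div_eq m (mdiv m L (E j)) B base_gt0). Qed.

Lemma digit_low j n x lo : lo <m E n -> j <m n -> digit j (x * E n + lo) = digit j lo.
Proof.
move=> Hlo /mltP [d En].
have [El Hl] := div_eq m lo (E j) (exp_gt0 j); rewrite /digit.
have -> : x * E n + lo = (x * E d * B + mdiv m lo (E j)) * E j + mmod m lo (E j).
  by rewrite {1}El En mexpS expD; ring.
have [-> _] := mdivP m (x * E d * B + mdiv m lo (E j)) _ _ Hl.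
have [Eq Hq] := div_eq m (mdiv m lo (E j)) B base_gt0.
have -> : x * E d * B + mdiv m lo (E j) =
    (x * E d + mdiv m (mdiv m lo (E j)) B) * B + mmod m (mdiv m lo (E j)) B.
  by rewrite {1}Eq; ring.
by case: (mdivP m (x * E d + mdiv m (mdiv m lo (E j)) B) _ _ Hq).
Qed.

Lemma div_exp n d L : mdiv m L (E (n + d)) = mdiv m (mdiv m L (E n)) (E d).
Proof. by rewrite mdiv_mdiv ?expD //; apply: exp_gt0. Qed.

Lemma digit_div n d L : digit (n + d) L = digit d (mdiv m L (E n)).
Proof. by rewrite /digit div_exp. Qed.

Lemma digit_high n d x lo : lo <m E n -> digit (n + d) (x * E n + lo) = digit d x.
Proof. by move=> Hlo; rewrite digit_div; case: (mdivP m x lo _ Hlo) => ->. Qed.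

Lemma exp1 : E 1 = B.
Proof. by have := mexpS m B 0; rewrite add0r mexp0 mul1r. Qed.

Lemma digit_push0 x c : c <=m N -> digit 0 (x * B + c) = c.
Proof.
move=> /mlt_S Hc; rewrite /digit mexp0.
have -> : x * B + c = (x * B + c) * 1 + 0 by ring.
have [-> _] := mdivP m (x * B + c) 0 1 ltac:(by apply/finj_lt; rewrite !finjE).
by case: (mdivP m x c _ Hc).
Qed.

Lemma digit_pushS j x c : c <=m N -> digit (j + 1) (x * B + c) = digit j x.
Proof. by move=> /mlt_S Hc; rewrite -(digit_high 1 j x c) exp1 // [1 + j]addrC. Qed.

(* The digit [p] of [L] moves to place [0]. *)
Definition move_digit (p L : M) : M :=
  (mdiv m L (E (p + 1)) * E p + mmod m L (E p)) * B + digit p L.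

Lemma split_digit p L :
  L = (mdiv m L (E (p + 1)) * B + digit p L) * E p + mmod m L (E p) /\ mmod m L (E p) <m E p.
Proof.
have [E1 H1] := div_eq m L (E p) (exp_gt0 p).
have [E2 H2] := div_eq m (mdiv m L (E p)) B base_gt0.
by rewrite mexpS -mdiv_mdiv -?E2 -?E1 //; [apply: exp_gt0 | apply: base_gt0].
Qed.

Lemma digit_move0 p L : digit 0 (move_digit p L) = digit p L.
Proof. by rewrite digit_push0 //; apply: digit_le. Qed.

Lemma digit_move_low p j L : j <m p -> digit (j + 1) (move_digit p L) = digit j L.
Proof.
move=> Hj; rewrite digit_pushS; last exact: digit_le.
have [E1 H1] := split_digit p L; rewrite [in RHS]E1.
by rewrite !digit_low.
Qed.

(** The move permutes the places [0] to [p] only, and division by [E n] with [n > p] forgets all of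
    these. The leading part of the number thus survives moves from lower places. *)
Lemma div_move p n L : p <m n -> mdiv m (move_digit p L) (E n) = mdiv m L (E n).
Proof.
move=> /mltP [d ->]; rewrite (_ : p + d + 1 = p + 1 + d); last by ring.
have [E1 H1] := split_digit p L; rewrite !(div_exp (p + 1) d).
have -> : move_digit p L = mdiv m L (E (p + 1)) * E (p + 1) + (mmod m L (E p) * B + digit p L).
  by rewrite /move_digit; move: (mdiv m L _) => hi; rewrite mexpS; ring.
have [|-> //] := mdivP m (mdiv m L (E (p + 1))) (mmod m L (E p) * B + digit p L) (E (p + 1)).
apply/finj_lt; rewrite mexpS !finjE; move/finj_ltS: H1 => H1.
have /finj_le H2 := digit_le p L; have := (finj_ge0 m N, finj_ge0 m (mmod m L (E p))) => -[? ?]; fnra.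
Qed.

Lemma digit_eq_div n j L L' : n <=m j -> mdiv m L (E n) = mdiv m L' (E n) -> digit j L = digit j L'.
Proof. by move=> /mleP [d ->] H; rewrite !digit_div H. Qed.

Lemma digit_move_high p j L : p <m j -> digit j (move_digit p L) = digit j L.
Proof. by move=> Hp; apply: (digit_eq_div j); [apply: mle_refl | apply: div_move]. Qed.

(** The digits are a permutation of the colors [0] to [N]. Injectivity and surjectivity are carried
    along together, so neither has to be derived from the other inside the model. *)
Definition arrangement (L : M) : Prop :=
  L <m E (N + 1) /\
  ((forall j, j <=m N -> forall j', j' <=m N -> digit j L = digit j' L -> j = j') /\
   (forall k, k <=m N -> exists j, j <=m N /\ digit j L = k)).

Lemma dec_arrangement : Dec1 m arrangement.
Proof. by rewrite /arrangement; rec. Qed.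

Lemma arrangement_ex : exists L, arrangement L.
Proof.
have H1 : Rec1 m (fun _ => 0) by rec.
(* Each color in turn is put at place 0 and pushes the earlier ones up. After [n] steps place [j]
   holds the color $n - 1 - j$. *)
have H2 : Rec3 m (fun _ n v => v * B + n) by rec.
have [f [Hf Ef]] := primitive_recursion m _ _ H1 H2; pose g := f 0.
have g0 : g 0 = 0 by case: (Ef 0).
have gS n : g (n + 1) = g n * B + n by case: (Ef 0).
have rec_g : Rec1 m g by apply: (isF_app2 m f); rec.
have Hg n : n <=m N + 1 -> g n <m E n /\ forall j, j <m n -> digit j (g n) + (j + 1) = n.
  apply: (rec_ind m (fun n => n <=m N + 1 -> g n <m E n /\ forall j, j <m n -> digit j (g n) + (j + 1) = n)) n
    => [||n IH Hn].
  - by apply: D1_imp; rec.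
  - by move=> _; rewrite g0 mexp0; split; [apply/finj_lt; rewrite !finjE | move=> j /m_nlt0].
  - have [H3 H4] := IH ltac:(mlra); have Hn' : n <=m N by mlra.
    rewrite gS; split.
      apply/finj_lt; rewrite mexpS !finjE; move/finj_ltS: H3; move/finj_le: Hn'.
      by have := finj_ge0 m N; fnra.
    move=> j Hj; case: (m_case m j) => [->|[j' Ej]]; first by rewrite digit_push0 // add0r.
    by rewrite Ej digit_pushS // addrA H4 //; mlra.
have [K1 K2] := Hg (N + 1) (mle_refl _ _); exists (g (N + 1)); split=> //; split.
- move=> j /mlt_S Hj j' /mlt_S Hj' Ed; have K := K2 j Hj; have K' := K2 j' Hj'.
  by rewrite Ed in K; mlra.
- move=> k Hk; have [j Ej] := proj1 (mleP _ _ _) Hk; exists j.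
  have Hj : j <m N + 1 by mlra.
  by have K := K2 j Hj; split; mlra.
Qed.

Lemma arrangement_move p L : p <=m N -> arrangement L -> arrangement (move_digit p L).
Proof.
move=> Hp [HL [Hinj Hsurj]]; split; [|split].
- apply: mdiv_eq0; first exact: exp_gt0.
  by rewrite div_move; [apply: mdiv_small | apply/mlt_S].
- have Hpos j : j <=m N -> exists j0, j0 <=m N /\ digit j (move_digit p L) = digit j0 L /\
      ((j = 0 /\ j0 = p) \/ ((j = j0 + 1 /\ j0 <m p) \/ (j = j0 /\ p <m j))).
    move=> Hj; case: (mlt_or_le m p j) => Hpj.
      by exists j; split=> //; split; [apply: digit_move_high | right; right].
    case: (m_case m j) => [->|[j' Ej]].
      by exists p; split=> //; split; [apply: digit_move0 | left].
    have Hj' : j' <m p by mlra.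
    by exists j'; split; [mlra | split; [rewrite Ej; apply: digit_move_low | right; left]].
  move=> j /Hpos [j0 [Hj0 [-> K]]] j' /Hpos [j0' [Hj0' [-> K']]] /(Hinj _ Hj0 _ Hj0') Ej.
  rewrite -{}Ej in K'; case: K => [[? ?]|[[? ?]|[? ?]]]; case: K' => [[? ?]|[[? ?]|[? ?]]]; mlra.
- move=> k /Hsurj [j [Hj Ek]]; case: (mlt_total m j p) => Hjp.
  + by exists (j + 1); split; [mlra | rewrite digit_move_low].
  + by exists 0; split; [apply: mge0 | rewrite digit_move0 -Hjp].
  + by exists j; split=> //; rewrite digit_move_high.
Qed.

End Digits.

(** * A cut with no real at it *)

(* A coloring [c] without infinite color drives a queue of the colors: at each
   step the current color is moved to the last place.  The number [L i] whose
   digits list the queue does not converge, although every number is eventually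
   on one side of it: a number [sigma] never separated from [L i] would list, in
   the cut of the stable places, all the colors, and so could not have distinct
   digits in a longer range of places. *)
Section Queue.

Variable m : rca0_model.
Notation M := (mnum m).
Notation F := (mfield m).
Variables (N : M) (c : M -> M).
Hypothesis rec_c : Rec1 m c.
Hypothesis c_le : forall i, c i <=m N.
Hypothesis c_finite : forall k, k <=m N -> eventually m (fun i => c i <> k).
Notation E := (mexp m (N + 1)).
Notation digit := (digit m N).
Notation arrangement := (arrangement m N).
Notation eventually := (eventually m).
Let rec_digit' : Rec2 m digit := rec_digit m N.

Lemma rec_move_digit : Rec2 m (move_digit m N).
Proof. by rewrite /move_digit; rec. Qed.

Lemma queue_ex : exists L pos : M -> M, Rec1 m L /\ Rec1 m pos /\
  (forall i, arrangement (L i)) /\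
  forall i, [/\ pos i <=m N, digit (pos i) (L i) = c i & L (i + 1) = move_digit m N (pos i) (L i)].
Proof.
have rec_arr := dec_arrangement m N; have rec_mv := rec_move_digit.
(* The premise makes the search total: [x] runs through all numbers, including those that do not
   pair a color with an arrangement. *)
have [|x|p [rec_p Hp]] := isF_search m (fun x p => arrangement (msnd m x) /\ mfst m x <=m N ->
    p <=m N /\ digit p (msnd m x) = mfst m x).
- by apply: D1_imp; rec.
- case: (classic (arrangement (msnd m x) /\ mfst m x <=m N)) => [[[_ [_ H]] /H [j Hj]]|H]; last by exists 0.
  by exists j.
have [L0 HL0] := arrangement_ex m N.
have H1 : Rec1 m (fun _ => L0) by rec.
have H2 : Rec3 m (fun _ n v => move_digit m N (p (mpair m (c n) v)) v) by rec.
have [f [rec_f Hf]] := primitive_recursion m _ _ H1 H2; pose L := f 0.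
have rec_L : Rec1 m L by apply: (isF_app2 m f); rec.
have Hp' n v : arrangement v -> p (mpair m (c n) v) <=m N /\ digit (p (mpair m (c n) v)) v = c n.
  by move=> Hv; have := Hp (mpair m (c n) v); rewrite msnd_pair mfst_pair; apply; split.
have LS i : L (i + 1) = move_digit m N (p (mpair m (c i) (L i))) (L i) by case: (Hf 0).
have HL i : arrangement (L i).
  apply: (rec_ind m (fun i => arrangement (L i))) i => [||i IH]; first by rec.
  - by rewrite /L; case: (Hf 0) => ->.
  - by rewrite LS; apply: arrangement_move => //; case: (Hp' i (L i) IH).
exists L, (fun i => p (mpair m (c i) (L i))); split=> //; split; first by rec.
by split=> // i; have [? ?] := Hp' i (L i) (HL i); split.
Qed.

Section Dynamics.

Variables L pos : M -> M.
Hypothesis rec_L : Rec1 m L.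
Hypothesis rec_pos : Rec1 m pos.
Hypothesis L_arr : forall i, arrangement (L i).
Hypothesis pos_le : forall i, pos i <=m N.
Hypothesis digit_pos : forall i, digit (pos i) (L i) = c i.
Hypothesis LS : forall i, L (i + 1) = move_digit m N (pos i) (L i).

(** Moves eventually come from below [n] only, so the quotient of [L i] by [E n] converges. Such
    places are closed upwards up to [N], and the lemmas below show that they have no least
    element. *)
Definition stable_place (n : M) : Prop := n <=m N /\ eventually (fun i => pos i <m n).

Lemma eventually_constant (g : M -> M) b : Rec1 m g ->
  (forall i, b <=m i -> g (i + 1) = g i) -> forall i, b <=m i -> g i = g b.
Proof.
move=> Hg H i /mleP [d ->].
apply: (rec_ind m (fun d => g (b + d) = g b)) d => [||d IH]; first by rec.
- by rewrite addr0.
- by rewrite addrA H //; mlra.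
Qed.

Lemma stable_place_div n : stable_place n ->
  exists b, forall i, b <=m i -> mdiv m (L i) (E n) = mdiv m (L b) (E n).
Proof.
move=> [Hn [b Hb]]; exists b; apply: (eventually_constant (fun i => mdiv m (L i) (E n))); first by rec.
by move=> i /Hb Hi; rewrite LS div_move.
Qed.

Lemma stable_place_le n n' : n <=m n' -> n' <=m N -> stable_place n -> stable_place n'.
Proof.
move=> Hn Hn' [_ H]; split=> //; apply: eventually_mono H => i Hi; exact: mlt_le_trans Hi Hn.
Qed.

Lemma digit_inj i j j' : j <=m N -> j' <=m N -> digit j (L i) = digit j' (L i) -> j = j'.
Proof. by have [_ [H _]] := L_arr i; move=> Hj Hj'; apply: H. Qed.

(* The place of a color only grows once the color has ceased to occur. *)
Lemma color_place k : k <=m N -> exists n, stable_place n /\ eventually (fun i => digit n (L i) = k).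
Proof.
move=> Hk; have [b Hb] := c_finite k Hk.
pose T n := exists i, b <=m i /\ exists j, j <=m N /\ (n <=m j /\ digit j (L i) = k).
(* [n] is the greatest place that the color [k] takes from stage [b] on, when it has ceased to
   occur. It exists because [T] is $\Sigma^0_1$ and fails beyond [N]. *)
have [n [[i0 [Hi0 [n' [Hn' [Hnn' En']]]]] HT]] : exists n, T n /\ ~ T (n + 1).
  apply: NNPP => H; have HT : T (N + 1).
    apply: (m_ind m T) => [||n Hn].
    - by apply: S1_ex; apply: D1_S1; rec.
    - have [_ [_ /(_ k Hk) [j [Hj Ej]]]] := L_arr b.
      by exists b; split; [apply: mle_refl | exists j; split=> //; split=> //; apply: mge0].
    - by apply: NNPP => Hn'; apply: H; exists n.
  by have [i [_ [j [Hj [Hj' _]]]]] := HT; mlra.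
have Hmax i j : b <=m i -> j <=m N -> digit j (L i) = k -> j <=m n.
  move=> Hi Hj Ej; apply/mltNge => Hnj; apply: HT; exists i; split=> //.
  by exists j; split=> //; split=> //; mlra.
have En : n' = n by apply: mle_anti => //; apply: (Hmax i0).
rewrite {}En in Hn' En' => {Hnn'}.
(* A move from place [n] would be an occurrence of [k], and a move from above would push [k] to
   [n + 1], beyond its greatest place. So every later move comes from below and leaves [k] where it
   is. *)
have step i : b <=m i -> digit n (L i) = k -> pos i <m n /\ digit n (L (i + 1)) = k.
  move=> Hi Ed; case: (mlt_total m (pos i) n) => H.
  - by split=> //; rewrite LS digit_move_high.
  - by case: (Hb i Hi); rewrite -(digit_pos i) H.
  - have Hi' : b <=m i + 1 by mlra.
    have Hn1 : n + 1 <=m N by have := pos_le i; mlra.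
    have := Hmax (i + 1) (n + 1) Hi' Hn1; rewrite LS digit_move_low // => /(_ Ed) Hbad; exfalso; mlra.
have Hd i : i0 <=m i -> digit n (L i) = k.
  move=> /mleP [d ->]; apply: (rec_ind m (fun d => digit n (L (i0 + d)) = k)) d => [||d IH]; first by rec.
  - by rewrite addr0.
  - by have [|] := step (i0 + d) _ IH; [mlra | rewrite addrA].
exists n; split; last by exists i0.
by split=> //; exists i0 => i Hi; have [|//] := step i _ (Hd i Hi); mlra.
Qed.

(** The color at place [n], once the places from [n + 1] on are frozen, settles at a stable place
    [n']. If [n'] were above [n], that color would already stand at [n'], and an arrangement does
    not repeat a color. So [n' <= n], and stability passes up to [n]. *)
Lemma stable_place_pred n : stable_place (n + 1) -> stable_place n.
Proof.
move=> Hn; have [b Hb] := stable_place_div _ Hn; have Hn1 := proj1 Hn.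
have HnN : n <=m N by mlra.
have [n' [Hn' [b' Hb']]] := color_place (digit n (L b)) (digit_le m N n (L b)).
case: (mlt_or_le m n n') => H; last exact: stable_place_le H HnN Hn'.
have K : n + 1 <=m n' by mlra.
have E1 : digit n' (L (b + b')) = digit n' (L b) by apply: digit_eq_div K _; apply: Hb; mlra.
have E2 : digit n' (L (b + b')) = digit n (L b) by apply: Hb'; mlra.
have En : n' = n by apply: (digit_inj b _ _ (proj1 Hn') HnN); rewrite -E1.
by rewrite En in H; mlra.
Qed.

Lemma stable_place_neq0 n : stable_place n -> n <> 0.
Proof. by move=> [_ [b Hb]] E0; apply: (m_nlt0 m (pos b)); rewrite -E0; apply: Hb; apply: mle_refl. Qed.

(** Suppose [sigma] agreed with the queue at all stable places. That the digits of [sigma] from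
    place [d] on are distinct is then a decidable property of all stable [d]; its least instance [d]
    is not stable, because stable places have stable predecessors. The color [digit d sigma] settles
    at some stable place [n > d], so [sigma] has the same digit at [n] and at [d], a
    contradiction. *)
Lemma queue_separates sigma : exists n, stable_place n /\
  eventually (fun i => mdiv m sigma (E n) <> mdiv m (L i) (E n)).
Proof.
apply: NNPP => HN.
have Hsame n : stable_place n -> eventually (fun i => mdiv m sigma (E n) = mdiv m (L i) (E n)).
  move=> Hn; have [b Hb] := stable_place_div _ Hn; apply: NNPP => H; apply: HN; exists n; split=> //.
  exists b => i Hi Ei; apply: H; exists b => i' Hi'; by rewrite Ei !Hb.
pose D d := d <=m N /\ forall j, j <=m N -> forall j', j' <=m N ->
  d <=m j /\ d <=m j' -> digit j sigma = digit j' sigma -> j = j'.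
have HD n : stable_place n -> D n.
  move=> Hn; split; first by case: Hn.
  have [b Hb] := Hsame n Hn; have Eb := Hb b (mle_refl _ _).
  move=> j Hj j' Hj' [Hnj Hnj'] Ej; apply: (digit_inj b _ _ Hj Hj').
  by rewrite -(digit_eq_div m N n j _ _ Hnj Eb) -(digit_eq_div m N n j' _ _ Hnj' Eb).
have [||d [[HdN Hd] Hmin]] := rec_least m D.
- apply: D1_and; first by rec.
  apply: D1_balle; first by rec.
  apply: D1_balle; first by rec.
  by apply: D1_imp; [rec | apply: D1_imp; rec].
- by have [n [/HD Hn _]] := color_place 0 (mge0 m N); exists n.
have Hnd : ~ stable_place d.
  move=> Hsd; case: (m_case m d) => [|[d' Ed]]; first exact: stable_place_neq0.
  rewrite Ed in Hsd; apply: (Hmin d'); first by mlra.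
  exact/HD/stable_place_pred.
have [n [Hn Hev]] := color_place (digit d sigma) (digit_le m N d sigma).
have Hdn : d <m n.
  by apply/mleNgt => H; apply: Hnd; apply: stable_place_le H HdN Hn.
have [i [E1 E2]] := eventually_ex m _ (eventually_and m _ _ Hev (Hsame n Hn)).
have E3 : digit n sigma = digit n (L i) by apply: digit_eq_div E2; apply: mle_refl.
have Hnn : n = d.
  by apply: Hd; [exact: (proj1 Hn) | | split; [mlra | apply: mle_refl] | rewrite E3].
by rewrite Hnn in Hdn; mlra.
Qed.

(** For a stable [n] the quotient of [L i] by [E n] becomes constant, and once it differs from that
    of [sigma], the order of the quotients decides the order of the numbers. *)
Lemma queue_decides sigma : eventually (fun i => sigma <m L i) \/ eventually (fun i => L i <m sigma).
Proof.
have [n [Hn H]] := queue_separates sigma; have [b Hb] := stable_place_div _ Hn.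
have Hne : mdiv m sigma (E n) <> mdiv m (L b) (E n).
  by have [i [Hi Hi']] := eventually_ex m _ (eventually_and m _ _ H (eventually_ge m b)); rewrite -(Hb i).
case: (mlt_total m (mdiv m sigma (E n)) (mdiv m (L b) (E n))) => // Hlt; [left|right];
  exists b => i /Hb Hi; apply/mleNgt => /(mdiv_le m _ _ _ (exp_gt0 m N n)); rewrite Hi => Hle; clear Hne; mlra.
Qed.

Lemma queue_lt i : L i <m E (N + 1).
Proof. by case: (L_arr i). Qed.

End Dynamics.

Theorem queue_cut : exists L K, [/\ Rec1 m L, 0 <m K, forall i, L i <m K &
  forall sigma, eventually (fun i => sigma <m L i) \/ eventually (fun i => L i <m sigma)].
Proof.
have [L [pos [rec_L [rec_pos [HL Hpos]]]]] := queue_ex.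
exists L, (E (N + 1)); split=> //.
- exact: exp_gt0.
- exact: queue_lt.
- by apply: (queue_decides L pos) => // i; case: (Hpos i).
Qed.

End Queue.

(** * Continuous functions that jump at the cut *)

Section Counterexamples.

Variable m : rca0_model.
Notation M := (mnum m).
Notation F := (mfield m).
Implicit Types (x : M -> F) (f : F -> M -> F).

Lemma not_IPP : ~ m_IPP m -> exists N c, [/\ Rec1 m c, forall i, c i <=m N &
  forall k, k <=m N -> eventually m (fun i => c i <> k)].
Proof.
move=> H; apply: NNPP => HN; apply: H; apply/IPP_fieldP => N c Hc HcN.
apply: NNPP => K; apply: HN; exists N, c; split=> // k Hk; apply: NNPP => L; apply: K.
exists k; split=> // b; apply: NNPP => K; apply: L; exists (b + 1) => i Hi E; apply: K.
by exists i; split=> //; mlra.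
Qed.

(** The least upper bound of [w] among the numbers; for a nonpositive [w] it is 0, hence the
    separate case. *)
Lemma ceiling (w : F) : exists s : M, w <= s%:f /\ (s = 0 \/ s%:f - 1 < w).
Proof.
have [a [b [c ->]]] := field_frac m w; have Hc := den_gt0 m c.
have E (s : M) : (a <=m b + s * (c + 1)) <-> (a%:f - b%:f) / (c%:f + 1) <= s%:f :> F.
  by rewrite finj_le ler_pdivrMr // !finjE; split; lra.
have [||s [/E Hs Hmin]] := rec_least m (fun s => a <=m b + s * (c + 1)).
- by rec.
- exists a; apply/finj_le; rewrite !finjE.
  by have := (finj_ge0 m a, finj_ge0 m b, finj_ge0 m c) => -[[? ?] ?]; nra.
- exists s; split=> //; case: (m_case m s) => [|[s' Es]]; [by left | right].
  have /E : ~ a <=m b + s' * (c + 1) by apply: Hmin; mlra.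
  by move/negP; rewrite -ltNge Es finjE finj_1; lra.
Qed.

Lemma near_mono x (d d' y : F) : d <= d' -> near m x d y -> near m x d' y.
Proof.
move=> Hd [H1 H2]; split.
  by move=> eps He; apply: eventually_mono (H1 eps He) => s; lra.
move=> [_ H3]; apply: H2; split=> // eps He.
by apply: eventually_mono (H3 eps He) => s; lra.
Qed.

Lemma near_dist x (d d' y : F) : d < d' -> near m x d y -> eventually m (fun n => `|x n - y| < d').
Proof.
move=> Hd [H _]; have := H ((d' - d) / 2) ltac:(lra).
by apply: eventually_mono => s; lra.
Qed.

Lemma inv_small (d : F) (b : M) : 0 < d -> exists n : M, 0 <m n /\ (b <=m n /\ n%:f^-1 < d).
Proof.
move=> Hd; have [n Hn] := archimedean m d Hd; exists (n + 1 + b); split; [mlra|split; first by mlra].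
have Hn0 := den_gt0 m n; apply: le_lt_trans Hn; rewrite lef_pV2 ?posrE ?finjE.
- by have := finj_ge0 m b; lra.
- by have := finj_ge0 m b; lra.
- by lra.
Qed.

Section Cut.

Variables (L : M -> M) (K : M).
Hypothesis rec_L : Rec1 m L.
Hypothesis K_gt0 : 0 <m K.
Hypothesis L_lt : forall i, L i <m K.
Hypothesis L_cut : forall s, eventually m (fun i => s <m L i) \/ eventually m (fun i => L i <m s).

Definition above (y : F) (i : M) : Prop := (L i)%:f < K%:f * y.

Lemma K_pos : 0 < K%:f :> F.
Proof. by move/finj_lt: K_gt0; rewrite finj_0. Qed.

Lemma dec_above : Dec2 m (fun q i => above (rval m q) i).
Proof.
apply: (@D1_ext m (fun e => L (e 1%N) * (msnd m (e 0%N) + 1) + K * msnd m (mfst m (e 0%N)) <m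
  K * mfst m (mfst m (e 0%N)))); first by rec.
move=> e; rewrite /above /rval finj_lt mulrA ltr_pdivlMr ?den_gt0 // !finjE.
by split; lra.
Qed.

Lemma above_mono (y z : F) i : y <= z -> above y i -> above z i.
Proof. by move=> Hyz; rewrite /above => H; have := K_pos; nra. Qed.

Lemma above_0 i : ~ above 0 i.
Proof. by rewrite /above mulr0 => H; have := finj_ge0 m (L i); lra. Qed.

Lemma above_1 i : above 1 i.
Proof. by rewrite /above mulr1; apply/finj_lt. Qed.

(** Integrality of [L] leaves room around every real. Let [s] be the ceiling of $Kx_n - 1/2$, for a
    late [n]. If eventually $s < L(i)$, then $L(i) \geq s + 1 \geq Kx_n + 1/2 > Ky$ for all [y] near
    [x]; if eventually $L(i) < s$, then $L(i) \leq s - 1 < Kx_n - 1/2 < Ky$. *)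
Lemma above_local x : creal m x -> exists d : F, 0 < d /\
  ((exists b, forall i, b <=m i -> forall y, near m x d y -> above y i) \/
   (exists b, forall i, b <=m i -> forall y, near m x d y -> ~ above y i)).
Proof.
(* A rational in the ball is within $2d$ of late terms, and these are within $d$ of $x_n$. With $d =
   1/(8K)$, multiplication by [K] turns $3d$ into $3/8$, which is less than $1/2$. *)
move=> [_ Hx]; have HK := K_pos; pose d := 1 / 8 / K%:f : F.
have Hd : 0 < d by rewrite /d divr_gt0 //; lra.
have HdK : K%:f * d = 1 / 8 by rewrite /d mulrC mulfVK // lt0r_neq0.
have [n Hn] := Hx d Hd.
have Hdist y : near m x d y -> K%:f * x n - 1 / 2 < K%:f * y /\ K%:f * y < K%:f * x n + 1 / 2.
  move=> Hy; have K1 : d < 2 * d by lra.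
  have [i [Hi Hi']] := eventually_ex m _ (eventually_and m _ _ (near_dist x _ _ y K1 Hy) (eventually_ge m n)).
  move: Hi (Hn n i (conj (mle_refl _ _) Hi')); rewrite !ltr_norml => /andP[? ?] /andP[? ?].
  split; rewrite -subr_gt0.
  - rewrite (_ : _ - _ = K%:f * (y - x n + 3 * d) + (1 / 2 - 3 * (K%:f * d))); last by ring.
    by rewrite HdK ltr_wpDr ?mulr_gt0 //; lra.
  - rewrite (_ : _ - _ = K%:f * (x n - y + 3 * d) + (1 / 2 - 3 * (K%:f * d))); last by ring.
    by rewrite HdK ltr_wpDr ?mulr_gt0 //; lra.
have [s [Hs1 Hs2]] := ceiling (K%:f * x n - 1 / 2).
exists d; split=> //; case: (L_cut s) => -[b Hb]; [right|left]; exists b => i /Hb /finj_ltS Hi y /Hdist [Hy1 Hy2].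
- by rewrite /above => H; flra.
- case: Hs2 => [Es|Hs2]; last by rewrite /above; lra.
  by exfalso; move: Hi; rewrite Es finj_0; have := finj_ge0 m (L i); lra.
Qed.

Definition step_fun (y : F) (i : M) : F := if decide (above y i) then 1 else 0.

Lemma rec_step_fun : rec_fun m step_fun.
Proof.
have H := dec_above.
apply: (isF_ext m (fun e => if decide (above (rval m (e 0%N)) (e 1%N)) then rcode m 1 else rcode m 0)).
- by move=> e; rewrite /step_fun; case: decideP.
- by apply: isF_if; [exact: H | exact: isF_cst | exact: isF_cst].
Qed.

Lemma step_fun_two_valued : two_valued m step_fun.
Proof.
split=> x Hx; have [d [Hd Hloc]] := above_local x Hx.
- move=> eps He.
  have Hex b v : (forall i, b <=m i -> forall y, near m x d y -> step_fun y i = v) ->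
      exists N : M, 0 <m N /\ forall y z, near m x N%:f^-1 y -> near m x N%:f^-1 z ->
        forall i j, N <=m i /\ N <=m j -> `|step_fun y i - step_fun z j| < eps.
    move=> H; have [N [HN [HbN Hd']]] := inv_small d b Hd; exists N; split=> // y z Hy Hz i j [Hi Hj].
    have Hnear := near_mono x N%:f^-1 d _ (ltW Hd').
    rewrite (H i (mle_trans _ _ _ _ HbN Hi) y (Hnear _ Hy)) (H j (mle_trans _ _ _ _ HbN Hj) z (Hnear _ Hz)).
    by rewrite subrr normr0.
  case: Hloc => -[b Hb].
  + by apply: (Hex b 1) => i Hi y Hy; rewrite /step_fun; case: decideP => // -[]; apply: Hb.
  + by apply: (Hex b 0) => i Hi y Hy; rewrite /step_fun; case: decideP => // /(Hb i Hi y Hy).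
- have Hself := near_self m x d (proj2 Hx) Hd.
  case: Hloc => -[b Hb]; [right|left]; apply/seqvP => eps He;
    apply: eventually_mono (eventually_and m _ _ Hself (eventually_ge m b)) => i [Hn Hi];
    rewrite /cvalue /step_fun /cst; have Hi' := Hb i Hi _ Hn.
  + by case: decideP => [_|[]] //; rewrite subrr normr0.
  + by case: decideP => [/Hi' //|_]; rewrite subr0 normr0.
Qed.

Definition jump_fun (y : F) (i : M) : F := if decide (above y i) then y + 2 else y - 2.

Lemma rec_jump_fun : rec_fun m jump_fun.
Proof.
have H := dec_above.
pose g1 q := rcode m (((mfst m (mfst m q) + (1 + 1) * (msnd m q + 1))%:f - (msnd m (mfst m q))%:f) /
  ((msnd m q)%:f + 1)).
pose g2 q := rcode m (((mfst m (mfst m q))%:f - (msnd m (mfst m q) + (1 + 1) * (msnd m q + 1))%:f) /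
  ((msnd m q)%:f + 1)).
have H1 : Rec1 m g1 by apply: isF_rcode_frac; rec.
have H2 : Rec1 m g2 by apply: isF_rcode_frac; rec.
apply: (isF_ext m (fun e => if decide (above (rval m (e 0%N)) (e 1%N)) then g1 (e 0%N) else g2 (e 0%N))).
- move=> e; have Hn := den_neq0 m (msnd m (e 0%N)); rewrite /jump_fun.
  by case: decideP => _; rewrite /g1 /g2 /rval; congr rcode; rewrite !finjE; field.
- by apply: isF_if; [exact: H | rec | rec].
Qed.

(** By [above_local] the branch is eventually the same throughout a ball around [x], where the
    function is then a translation. *)
Lemma jump_fun_cont x : creal m x -> in_domain m jump_fun x.
Proof.
move=> Hx eps He; have [d [Hd Hloc]] := above_local x Hx.
have Hclose N y z : N%:f^-1 < eps / 4 -> near m x N%:f^-1 y -> near m x N%:f^-1 z -> `|y - z| < eps.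
  move=> HN /(near_dist x _ _ _ HN) Hy /(near_dist x _ _ _ HN) Hz.
  have [i [Hi Hi']] := eventually_ex m _ (eventually_and m _ _ Hy Hz).
  by move: Hi Hi'; rewrite !ltr_norml => /andP[? ?] /andP[? ?]; apply/andP; split; lra.
have Hmin : 0 < Num.min d (eps / 4) by rewrite lt_min Hd /=; lra.
have Hex b v : (forall i, b <=m i -> forall y, near m x d y -> jump_fun y i = y + v) ->
    exists N : M, 0 <m N /\ forall y z, near m x N%:f^-1 y -> near m x N%:f^-1 z ->
      forall i j, N <=m i /\ N <=m j -> `|jump_fun y i - jump_fun z j| < eps.
  move=> H; have [N [HN [HbN HdN]]] := inv_small _ b Hmin; exists N; split=> // y z Hy Hz i j [Hi Hj].
  move: HdN; rewrite lt_min => /andP[Hd1 Hd2].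
  have Hnear := near_mono x N%:f^-1 d _ (ltW Hd1).
  rewrite (H i (mle_trans _ _ _ _ HbN Hi) y (Hnear _ Hy)) (H j (mle_trans _ _ _ _ HbN Hj) z (Hnear _ Hz)).
  by rewrite opprD addrACA subrr addr0; apply: (Hclose N).
case: Hloc => -[b Hb].
- by apply: (Hex b 2) => i Hi y Hy; rewrite /jump_fun; case: decideP => // -[]; apply: Hb.
- by apply: (Hex b (-2)) => i Hi y Hy; rewrite /jump_fun; case: decideP => // /(Hb i Hi y Hy).
Qed.

(** Both branches have slope one and so preserve the gap between the arguments. A step up widens it,
    and a step down is excluded by [above_mono]. *)
Lemma jump_fun_increasing : strictly_increasing m jump_fun.
Proof.
move=> x y [_ Hx] _ [_ Hy] _ Hxy; have [d [Hd Hev]] := slt_gap m x y Hx Hy Hxy.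
apply: (slt_intro m _ _ d Hd); apply: eventually_mono Hev => i Hi.
have Hle : x i <= y i by lra.
rewrite /cvalue /jump_fun; case: decideP => H1; case: decideP => H2; try lra.
by case: H2; apply: above_mono Hle H1.
Qed.

Lemma jump_fun_sign_changes : sign_changes m jump_fun.
Proof.
apply: (slt_intro m _ _ 1 ltr01); exists 0 => i _; rewrite /jump_fun /cst.
case: decideP => [/above_0 //|_]; case: decideP => [_|[]]; last exact: above_1.
lra.
Qed.

(** The late terms of a real in the unit interval lie between $-1/4$ and $5/4$, where adding or
    subtracting 2 leaves an absolute value of at least $3/4$. *)
Lemma jump_fun_no_zero : ~ zero_exists m jump_fun.
Proof.
move=> [x [_ [[[H0 _] [H1 _]] /seqvP Hz]]].
have [K0 [K1 K2]] := (H0 (1 / 4) ltac:(lra), (H1 (1 / 4) ltac:(lra), Hz (1 / 4) ltac:(lra))).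
have [i [I0 [I1 I2]]] := eventually_ex m _ (eventually_and m _ _ K0 (eventually_and m _ _ K1 K2)).
move: I0 I1 I2; rewrite /cvalue /jump_fun /cst subr0 ltr_norml => I0 I1.
by case: decideP => _ /andP[? ?]; lra.
Qed.

End Cut.

Lemma IVT_increasing_IPP : m_IVT_increasing m -> m_IPP m.
Proof.
move=> /IVT_increasing_fieldP H; apply: NNPP => /not_IPP [N [c [Hc HcN Hfin]]].
have [L [K [rec_L HK HL Hcut]]] := queue_cut m N c Hc HcN Hfin.
apply: (jump_fun_no_zero L K); apply: H.
- exact: rec_jump_fun.
- by move=> x Hx _; apply: jump_fun_cont.
- exact: jump_fun_increasing.
- exact: jump_fun_sign_changes.
Qed.

Lemma two_valued_constant_IPP : m_two_valued_constant m -> m_IPP m.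
Proof.
move=> /two_valued_constant_fieldP H; apply: NNPP => /not_IPP [N [c [Hc HcN Hfin]]].
have [L [K [rec_L HK HL Hcut]]] := queue_cut m N c Hc HcN Hfin.
have R : rec_fun m (step_fun L K) by apply: rec_step_fun.
have T : two_valued m (step_fun L K) by apply: step_fun_two_valued.
have /seqvP /(_ 1 ltr01) := H _ R T _ _ (creal_cst m 0) (creal_cst m 1).
move=> /(eventually_ex m) [i]; rewrite /cvalue /step_fun /cst.
case: decideP => [/above_0 //|_]; case: decideP => [_|[]]; last exact: above_1.
by rewrite sub0r normrN normr1 ltxx.
Qed.

End Counterexamples.

Theorem principles_equivalent (m : rca0_model) :
  [/\ m_IPP m <-> m_IVT m, m_IPP m <-> m_IVT_increasing m & m_IPP m <-> m_two_valued_constant m].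
Proof.
have H : m_IVT m -> m_IVT_increasing m by move=> H G [H1 [_ H2]]; apply: H.
split; split.
- exact: IPP_IVT.
- by move/H; apply: IVT_increasing_IPP.
- by move/(IPP_IVT m)/H.
- exact: IVT_increasing_IPP.
- exact: IPP_two_valued_constant.
- exact: two_valued_constant_IPP.
Qed.

Import ListNotations.

Theorem theorem3p8 (A B : form)
  (hA : In A [IPP; IVT; IVT_increasing; two_valued_constant])
  (hB : In B [IPP; IVT; IVT_increasing; two_valued_constant]) :
  provable RCA0 (Iff A B).
Proof.
apply: completeness => s Hs e X.
(* The given assignment supplies the set that the record asks for. *)
pose m := RCA0Model s Hs (X 0%N).
have H C : In C [IPP; IVT; IVT_increasing; two_valued_constant] -> (sat s e X C <-> m_IPP m).
  have [H1 H2 H3] := principles_equivalent m.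
  case=> [<-|[<-|[<-|[<-|[]]]]].
  - by rewrite (sat_IPP m e X).
  - by rewrite (sat_IVT m e X) H1.
  - by rewrite (sat_IVT_increasing m e X) H2.
  - by rewrite (sat_two_valued_constant m e X) H3.
have [KA KB] := (H A hA, H B hB).
by split=> K; [apply/KB/KA | apply/KA/KB].
Qed.
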